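(* Let $p(\cdot)\in\mathcal{P}_{\gamma_{d}}^{\infty}(\mathbb{R}^{d})\cap LH_{0}(\mathbb{R}^{d})$ and $q_{1}(\cdot),q_{2}(\cdot)\in\mathcal{P}_{0,\infty}$, and let $\alpha_1,\alpha_2\ge 0$. The inclusion $B_{p(\cdot),q_1(\cdot)}^{\alpha_{1}}(\gamma_d)\subset B_{p(\cdot),q_2(\cdot)}^{\alpha_{2}}(\gamma_d)$ holds in each of the following two cases: (i) $\alpha_{1}>\alpha_{2}>0$ (with no relation required between $q_{1}(\cdot)$ and $q_{2}(\cdot)$); (ii) $\alpha_{1}=\alpha_{2}$ and $q_{1}(t)\leq q_{2}(t)$ for a.e. $t>0$.
   Context: Measures: $\gamma_d(dx)=\pi^{-d/2}e^{-|x|^2}dx$ on $\mathbb{R}^d$, and $\mu(dt)=dt/t$ on $\mathbb{R}^+=(0,\infty)$. Variable Lebesgue norm: for a measure $\nu$ on $\Omega$ and a measurable finite-valued exponent $p(\cdot):\Omega\to[1,\infty)$, $\|f\|_{p(\cdot),\nu}=\inf\{\lambda>0:\int_\Omega |f(x)/\lambda|^{p(x)}\,\nu(dx)\le 1\}$, and $L^{p(\cdot)}(\Omega,\nu)$ is the set of measurable $f$ with $\|f\|_{p(\cdot),\nu}<\infty$. $L^{p(\cdot)}(\gamma_d)=L^{p(\cdot)}(\mathbb{R}^d,\gamma_d)$. Exponent classes: $p(\cdot)\in LH_0(\mathbb{R}^d)$ means $p(\cdot)$ is real-valued and there is $C_1>0$ with $|p(x)-p(y)|\le C_1/\log(e+1/|x-y|)$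 for all $x,y\in\mathbb{R}^d$. $p(\cdot)\in\mathcal{P}^\infty_{\gamma_d}(\mathbb{R}^d)$ means $p(\cdot)$ is a measurable exponent with values $\ge1$ and there are $C_{\gamma_d}>0$, $p_\infty\ge1$ with $|p(x)-p_\infty|\le C_{\gamma_d}/|x|^2$ for all $x\ne0$. $\mathcal{P}_{0,\infty}$ is the set of measurable $q(\cdot):\mathbb{R}^+\to\mathbb{R}^+$ with $1\le \operatorname{ess\,inf} q\le\operatorname{ess\,sup} q<\infty$, such that the limits $q(0)=\lim_{x\to0}q(x)$ and $q(\infty)=\lim_{x\to\infty}q(x)$ exist and, for some constant $A$, $|q(x)-q(0)|\le A/\ln(1/x)$ for $0<x\le1/2$ and $|q(x)-q(\infty)|\le A/\ln x$ for $x>2$. Semigroups: the Ornstein–Uhlenbeck semigroup is $T_tf(x)=(1-e^{-2t})^{-d/2}\int_{\mathbb{R}^d}\exp\left(-\frac{e^{-2t}(|x|^2+|y|^2)-2e^{-t}\langle x,y\rangle}{1-e^{-2t}}\right)f(y)\,\gamma_d(dy)$, $t>0$; the Poisson–Hermite semigroup is $P_tf(x)=\frac1{\sqrt\pi}\int_0^\infty\frac{e^{-u}}{\sqrt u}T_{t^2/4u}f(x)\,du$, $t>0$. Variable Gaussian Besov–Lipschitz space: for $\alpha\ge0$ and $k$ the smallest integer greater than $\alpha$, $B^\alpha_{p(\cdot),q(\cdot)}(\gamma_d)$ is the set of $f\in L^{p(\cdot)}(\gamma_d)$ such that $\left\|t^{k-\alpha}\left\|\frac{\partial^kP_tf}{\partial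 t^k}\right\|_{p(\cdot),\gamma_d}\right\|_{q(\cdot),\mu}<\infty$ (outer norm in the variable $t\in\mathbb{R}^+$). *)

(* Defs.v *)
From HB Require Import structures.
From mathcomp Require Import all_boot all_order all_algebra archimedean.
From mathcomp Require Import all_classical all_reals all_analysis.
From mathcomp Require Import measurable_realfun ess_sup_inf.

Set Implicit Arguments.
Unset Strict Implicit.
Unset Printing Implicit Defensive.

Import Order.TTheory GRing.Theory Num.Theory.
Import numFieldNormedType.Exports.

Local Open Scope classical_set_scope.
Local Open Scope ring_scope.

(* R^d is the type of d-tuples with its product sigma-algebra: the norm that
   the library puts on row vectors is the sup norm. *)
Notation Rvec R d := (d.-tuple (Real.sort R)).

Section euclidean_structure.
Context {R : realType} {d : nat}.
Implicit Types x y : Rvec R d.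

Definition dotv x y : R := \sum_(i < d) tnth x i * tnth y i.
Definition normv x : R := Num.sqrt (dotv x x).
Definition subv x y : Rvec R d := [tuple tnth x i - tnth y i | i < d].
Definition zerov : Rvec R d := [tuple 0 | i < d].

Lemma measurable_normv : measurable_fun [set: Rvec R d] normv.
Proof.
apply: (@measurableT_comp _ _ _ _ _ _ (@Num.sqrt R)).
  by apply: continuous_measurable_fun; exact: sqrt_continuous.
apply: measurable_sum => i.
by apply: measurable_funM; exact: (@measurable_tnth _ R).
Qed.

End euclidean_structure.

(* The measure f(x) m(dx); f0 and mf are arguments, as in mrestr, so that the
   measure instance can be inferred. *)
Definition mdensity d (T : measurableType d) (R : realType)
    (m : set T -> \bar R) (f : T -> R) (f0 : forall x, 0 <= f x)
    (mf : measurable_fun [set: T] f) : set T -> \bar R :=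
  fun A => (\int[m]_(x in A) (f x)%:E)%E.

Section mdensity_measure.
Context d (T : measurableType d) (R : realType).
Variables (m : {measure set T -> \bar R}) (f : T -> R).
Hypotheses (f0 : forall x, 0 <= f x) (mf : measurable_fun [set: T] f).
Local Open Scope ereal_scope.
Local Notation mfd := (mdensity m f0 mf).

Let mdensity0 : mfd set0 = 0. Proof. exact: integral_set0. Qed.

Let mdensity_ge0 A : 0 <= mfd A.
Proof. by apply: integral_ge0 => x _; rewrite lee_fin. Qed.

Let mdensity_sigma_additive : semi_sigma_additive mfd.
Proof.
move=> F mF tF mUF; rewrite /mdensity ge0_integral_bigcup//.
- apply: is_cvg_ereal_nneg_natsum_cond => n _ _.
  by apply: integral_ge0 => x _; rewrite lee_fin.
- exact/measurable_EFinP/measurable_funTS.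
- by move=> x _; rewrite lee_fin.
Qed.

HB.instance Definition _ := isMeasure.Build _ _ _ mfd
  mdensity0 mdensity_ge0 mdensity_sigma_additive.

End mdensity_measure.

Section lebesgue_Rvec.
Context {R : realType}.

Definition consv n (z : Rvec R n * R) : Rvec R n.+1 := [tuple of z.2 :: z.1].

Lemma measurable_consv n : measurable_fun [set: Rvec R n * R] (@consv n).
Proof. exact: measurable_cons. Qed.

(* The image measure pushforward (m \x lebesgue_measure) (@consv n); its
   instance is named because inference cannot find the measurability proof. *)
Definition lebesgue_cons n (m : {measure set (Rvec R n) -> \bar R}) :
    {measure set (Rvec R n.+1) -> \bar R} :=
  measure_function_pushforward__canonical__measure_function_Measure
    (m \x @lebesgue_measure R)%E (@measurable_consv n).

(* Lebesgue measure on R^d, as an iterated product. *)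
Fixpoint lebesgue_Rvec d : {measure set (Rvec R d) -> \bar R} :=
  if d is d'.+1 then lebesgue_cons (lebesgue_Rvec d')
  else \d_([tuple] : Rvec R 0).

Lemma lebesgue_Rvec_box d (A : 'I_d -> set R) :
    (forall i, measurable (A i)) ->
  lebesgue_Rvec d [set x | forall i, A i (tnth x i)] =
  (\prod_(i < d) lebesgue_measure (A i))%E.
Proof.
elim: d A => [|d IH] A mA.
  by rewrite big_ord0 /= diracE mem_set// => -[].
have mbox : measurable [set x : Rvec R d | forall i, A (lift ord0 i) (tnth x i)].
  rewrite (_ : [set x | _] =
      \bigcap_(i in [set: 'I_d])
        ((fun x : Rvec R d => tnth x i) @^-1` A (lift ord0 i))).
    apply: fin_bigcap_measurable => // i _.
    by rewrite -[X in measurable X]setTI; exact: measurable_tnth.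
  by apply/seteqP; split=> x /= Hx i; [move=> _|]; exact: Hx.
rewrite big_ord_recl muleC /= /lebesgue_cons /pushforward.
rewrite -(IH (fun i => A (lift ord0 i)))//.
rewrite -product_measure1E//; last exact: mA.
congr (_ _).
apply/seteqP; split=> -[x t] /= => [H|[H0 H1] i].
  split=> [i|]; first by have := H (lift ord0 i); rewrite tnthS.
  by have := H ord0.
by case: (unliftP ord0 i) => [j ->|->] //; rewrite tnthS; exact: H0.
Qed.

End lebesgue_Rvec.

Section gauss_measure.
Context {R : realType}.

Definition gauss_density d (x : Rvec R d) : R :=
  pi `^ (- (d%:R / 2)) * expR (- normv x ^+ 2).

Lemma gauss_density_ge0 d (x : Rvec R d) : 0 <= gauss_density x.
Proof. by rewrite mulr_ge0 ?powR_ge0 ?expR_ge0. Qed.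

Lemma measurable_gauss_density d :
  measurable_fun [set: Rvec R d] (@gauss_density d).
Proof.
apply: measurable_funM => //; apply: measurableT_comp => //.
by apply: measurableT_comp => //; apply: measurable_funX; exact: measurable_normv.
Qed.

Definition gauss_measure d : {measure set (Rvec R d) -> \bar R} :=
  mdensity (lebesgue_Rvec d) (@gauss_density_ge0 d) (@measurable_gauss_density d).

End gauss_measure.

Section positive_half_line.
Context {R : realType}.

Definition Rpos : set R := `]0, +oo[.

Lemma measurable_Rpos : measurable Rpos. Proof. exact: measurable_itv. Qed.

Definition lebesgue_Rpos : {measure set (measurableTypeR R) -> \bar R} :=
  mrestr (@lebesgue_measure R) measurable_Rpos.

Definition haar_density (t : R) : R := t^-1 * \1_Rpos t.

Lemma haar_density_ge0 t : 0 <= haar_density t.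
Proof.
rewrite /haar_density indicE; case: (boolP (t \in Rpos)) => [|_];
  last by rewrite mulr0.
by rewrite inE /Rpos/= in_itv/= andbT => t0; rewrite mulr1 invr_ge0 ltW.
Qed.

Lemma measurable_haar_density : measurable_fun [set: R] haar_density.
Proof.
rewrite (_ : haar_density = (fun t => t `^ (-1) * \1_Rpos t)); last first.
  apply/funext => t; rewrite /haar_density indicE; case: (boolP (t \in Rpos)) => [|_].
    by rewrite inE /Rpos/= in_itv/= andbT => t0; rewrite powR_inv1// ltW.
  by rewrite !mulr0.
apply: measurable_funM; first exact: measurable_powR.
by apply: measurable_indic; exact: measurable_Rpos.
Qed.

(* The measure dt/t on (0, oo). *)
Definition haar_measure : {measure set (measurableTypeR R) -> \bar R} :=
  mdensity (@lebesgue_measure R) haar_density_ge0 measurable_haar_density.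

End positive_half_line.

Section variable_lebesgue.
Context d (T : measurableType d) (R : realType).
Variables (nu : {measure set T -> \bar R}) (D : set T) (p : T -> R).

(* Functions are extended-real-valued, since the Besov-Lipschitz spaces take
   the norm of a function which is itself defined by a possibly infinite norm. *)
Definition var_norm (f : T -> \bar R) : \bar R :=
  ereal_inf [set lambda%:E | lambda in [set lambda : R | 0 < lambda /\
    (\int[nu]_(x in D) (`|f x| * (lambda^-1)%:E) `^ (p x) <= 1)%E]].

Definition var_Lp : set (T -> R) :=
  [set f | measurable_fun D f /\ (var_norm (EFin \o f) < +oo)%E].

End variable_lebesgue.

Section exponents.
Context {R : realType}.

(* For x = y the inverse is 0 and the bound reads 0 <= C1. *)
Definition LH0 d (p : Rvec R d -> R) : Prop :=
  exists2 C1 : R, 0 < C1 & forall x y,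
    `|p x - p y| <= C1 / ln (expR 1 + (normv (subv x y))^-1).

Definition P_gauss_infty d (p : Rvec R d -> R) : Prop :=
  [/\ measurable_fun [set: Rvec R d] p,
      forall x, 1 <= p x
    & exists C pinfty : R, [/\ 0 < C, 1 <= pinfty
      & forall x, x <> zerov -> `|p x - pinfty| <= C / normv x ^+ 2]].

(* Only the values of q on (0, oo) matter. *)
Definition P_zero_infty (q : R -> R) : Prop :=
  [/\ measurable_fun Rpos q,
      forall t, 0 < t -> 0 < q t,
      [/\ (1 <= ess_inf lebesgue_Rpos (EFin \o q))%E,
          (ess_inf lebesgue_Rpos (EFin \o q) <=
             ess_sup lebesgue_Rpos (EFin \o q))%E
        & (ess_sup lebesgue_Rpos (EFin \o q) < +oo)%E]
    & exists q0 qinfty A : R,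
      [/\ q x @[x --> 0^'+] --> q0,
          q x @[x --> +oo] --> qinfty,
          forall x, 0 < x <= 1 / 2 -> `|q x - q0| <= A / ln (1 / x)
        & forall x, 2 < x -> `|q x - qinfty| <= A / ln x]].

End exponents.

Section semigroups.
Context {R : realType} {d : nat}.
Implicit Types (f : Rvec R d -> R) (x y : Rvec R d) (t : R).

Definition ornstein_uhlenbeck t f x : R :=
  (1 - expR (- 2 * t)) `^ (- (d%:R / 2)) *
  \int[gauss_measure d]_y
    (expR (- ((expR (- 2 * t) * (normv x ^+ 2 + normv y ^+ 2)
               - 2 * expR (- t) * dotv x y) / (1 - expR (- 2 * t)))) * f y).

Definition poisson_hermite t f x : R :=
  (Num.sqrt pi)^-1 *
  \int[lebesgue_measure]_(u in Rpos)
    (expR (- u) / Num.sqrt u * ornstein_uhlenbeck (t ^+ 2 / (4 * u)) f x).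

End semigroups.

Section besov_lipschitz.
Context {R : realType}.

Definition besov_order (alpha : R) : nat := (Num.truncn alpha).+1.

Lemma besov_orderP (alpha : R) : 0 <= alpha ->
  alpha < (besov_order alpha)%:R /\
  forall m : nat, alpha < m%:R -> (besov_order alpha <= m)%N.
Proof.
move=> a0; split; first by have /andP[] := truncn_itv a0.
by move=> m; rewrite /besov_order truncn_lt_nat.
Qed.

Definition besov d (alpha : R) (p : Rvec R d -> R) (q : R -> R) :
    set (Rvec R d -> R) :=
  let k := besov_order alpha in
  [set f | var_Lp (gauss_measure d) setT p f /\
    (var_norm haar_measure Rpos q (fun t =>
       (t `^ (k%:R - alpha))%:E *
       var_norm (gauss_measure d) setT p
         (fun x => (derive1n k (fun s => poisson_hermite s f x) t)%:E)) < +oo)%E].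

End besov_lipschitz.

(* Main.v *)
(* Let g_k(t) be the p(.)-norm of the k-th t-derivative of P_t f. A Young-type
   inequality and the regularity of p(.) make T_t, hence P_t, bounded on
   L^{p(.)}(gamma_d) uniformly in t. As |d_t^k P_t f| <= C t^{-k} P_{t/2} |f| and
   d_t^k P_{a+b} f = P_a (d_t^k P_b f), it follows that g_k(t) <= C t^{-k}, that g_k is
   decreasing up to a constant, and that g_k(t) <= g_k(2t) + C t g_{k+1}(t/2).
   The second property makes t^{k-alpha} g_k(t) bounded as soon as its q(.)-norm is
   finite. If q1 <= q2 then, after division by a large constant, the function is at
   most 1 and raising the exponent decreases the modular. If alpha1 > alpha2, choose
   beta between alpha2 and min(alpha1, k2): the third property, iterated over dyadic
   scales, brings g_{k1}(t) = O(t^{beta-k1}) down to g_{k2}(t) = O(t^{beta-k2}) on (0,1],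
   so t^{k2-alpha2} g_{k2}(t) decays like a power of t at both ends and its q2(.)-norm
   is finite for every q2 >= 1. *)
From HB Require Import structures.
Require Import Defs.
From mathcomp Require Import all_boot all_order all_algebra archimedean.
From mathcomp Require Import all_classical all_reals all_analysis.
From mathcomp Require Import measurable_realfun ess_sup_inf.
From mathcomp Require Import ring lra.
Set Implicit Arguments.
Unset Strict Implicit.
Unset Printing Implicit Defensive.
Import Order.TTheory GRing.Theory Num.Theory.
Import numFieldNormedType.Exports.
Local Open Scope classical_set_scope.
Local Open Scope ring_scope.

(** * Measure-theoretic complements *)

(** Log-Hoelder continuity alone does not control exp(g (p x - p y)). The Mehler kernel reaches Z^d
    e^{|x|^2}, with Z = (1 - e^{-2s})^{-1/2}, so the number g produced by averaging may be as large
    as 1 + d ln Z + |x|^2. The two hypotheses on p(.) answer the two large terms: [LH0] beats ln Z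
    when |x - y|^2 <= 1/Z, and the |x|^{-2} decay of p - p_infty beats |x|^2. Young's inequality
    with a free parameter takes the place of Jensen's; it tolerates kernels of mass at most 2 and an
    additive error exp(|x|^2 / 8), which is integrable for gamma. Time derivatives are computed on
    the subordination side: after s = t^2 / (4u), the time t occurs only in the density of the
    one-sided 1/2-stable law. Derivatives fall on that explicit density, and its convolution law
    yields the semigroup law of P_t. Measurability of g_k in t is not established: integrals of its
    powers over dt/t are compared as lower integrals of nonnegative functions. *)

Section measure_complements.
Context d (T : measurableType d) (R : realType).
Implicit Types (mu : {measure set T -> \bar R}) (D N : set T) (f g : T -> \bar R).
Local Open Scope ereal_scope.

Import HBNNSimple.

(* No measurability: the integral of a nonnegative function is the lower one. *)
Lemma ge0_le_lower_integral mu D f g :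
    (forall x, D x -> 0 <= f x) -> (forall x, D x -> f x <= g x) ->
  \int[mu]_(x in D) f x <= \int[mu]_(x in D) g x.
Proof.
move=> f0 fg; have g0 x : D x -> 0 <= g x.
  by move=> Dx; exact: le_trans (f0 _ Dx) (fg _ Dx).
rewrite !ge0_integralE//; apply: le_ereal_sup => _ [h hf <-].
exists h => // x; apply: le_trans (hf x) _.
by rewrite !patchE; case: ifPn => // /[!inE]; exact: fg.
Qed.

(** Every simple function below [f] is measurable, so the null set is removed from that simple
    function rather than from [f], on which no measurability is assumed. *)
Lemma ge0_lower_integral_setD_null mu D N f : measurable N -> mu N = 0 ->
    (forall x, D x -> 0 <= f x) ->
  \int[mu]_(x in D) f x <= \int[mu]_(x in D `\` N) f x.
Proof.
move=> mN N0 f0; rewrite [leLHS]ge0_integralE//; apply: ge_ereal_sup => _ [h hf <-].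
rewrite -integralT_nnsfun (ge0_negligible_integral mN)//; last 2 first.
- exact/measurable_EFinP.
- by move=> x _; rewrite lee_fin.
rewrite setTD [leLHS]integral_mkcond [leRHS]integral_mkcond.
apply: ge0_le_lower_integral => x _.
  by rewrite patchE; case: ifPn => // _; rewrite lee_fin.
rewrite !patchE; case: ifPn => [/[!inE] nNx|/negP nNx].
  have [Dx|nDx] := pselect (D x).
    rewrite mem_set//=; apply: le_trans (hf x) _.
    by rewrite patchE mem_set.
  rewrite memNset/=; last by case.
  by apply: le_trans (hf x) _; rewrite patchE memNset.
case: ifPn => // /[!inE] -[Dx nNx'] ; exact: f0.
Qed.

Section mdensity_integral.
Variables (mu : {measure set T -> \bar R}) (w : T -> R).
Hypotheses (w0 : forall x, (0 <= w x)%R) (mw : measurable_fun setT w).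

Let nu := mdensity mu w0 mw.

Let mdensity_integral_nnsfun (h : {nnsfun T >-> R}) :
  \int[nu]_x (h x)%:E = \int[mu]_x ((h x)%:E * (w x)%:E).
Proof.
have mhi r : measurable (h @^-1` [set r]).
  by rewrite -[X in measurable X]setTI; exact: measurable_funP.
under [RHS]eq_integral.
  move=> x _; rewrite fimfunE -fsumEFin// ge0_mule_fsuml; last first.
    by move=> r; exact: nnfun_muleindic_ge0.
  over.
rewrite [RHS]ge0_integral_fsum//; last 2 first.
- move=> r; apply: emeasurable_funM; apply/measurable_EFinP => //.
  by apply: measurable_funM => //; exact: measurable_indic.
- by move=> r x _; apply: mule_ge0; [exact: nnfun_muleindic_ge0|rewrite lee_fin].
rewrite integralT_nnsfun sintegralE; apply: eq_fsbigr => r rh.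
have r0 : (0 <= r)%R by case: (set_mem rh) => x _ <-.
under [RHS]eq_integral do rewrite EFinM -muleA.
rewrite ge0_integralZl//; last 2 first.
- by apply: emeasurable_funM; apply/measurable_EFinP => //; exact: measurable_indic.
- by move=> x _; rewrite mule_ge0 ?lee_fin.
congr (_ * _); rewrite [LHS]/= /nu /mdensity integral_mkcond.
apply: eq_integral => x _; rewrite patchE indicE.
by case: ifPn => _; rewrite ?mul1e ?mul0e.
Qed.

Lemma ge0_integral_mdensity f : measurable_fun setT f -> (forall x, 0 <= f x) ->
  \int[nu]_x f x = \int[mu]_x (f x * (w x)%:E).
Proof.
move=> mf f0; pose g := nnsfun_approx measurableT mf.
have gf x : (EFin \o g ^~ x) n @[n --> \oo] --> f x.
  by apply: cvg_nnsfun_approx => //.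
have ndg x : {homo (g ^~ x) : n m / (n <= m)%N >-> (n <= m)%R}.
  by move=> a b ab; exact/lefP/nd_nnsfun_approx.
transitivity (limn (fun n => \int[nu]_x (g n x)%:E)).
  rewrite -monotone_convergence//=.
  - by apply: eq_integral => x _; apply/esym/cvg_lim => //; exact: gf.
  - by move=> n; exact/measurable_EFinP.
  - by move=> n x _; rewrite lee_fin.
  - by move=> x _ a b ab; rewrite lee_fin; exact: ndg.
under eq_fun do rewrite mdensity_integral_nnsfun.
rewrite -monotone_convergence//=.
- apply: eq_integral => x _; apply/cvg_lim => //.
  by apply: cvgeZr => //; exact: gf.
- by move=> n; apply: emeasurable_funM; exact/measurable_EFinP.
- by move=> n x _; rewrite mule_ge0 ?lee_fin.
- by move=> x _ a b ab; rewrite lee_wpmul2r ?lee_fin//; exact: ndg.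
Qed.

End mdensity_integral.

End measure_complements.

Section measurability.
Context d (T : measurableType d) (R : realType).

Lemma measurable_fun_powR2 (h p : T -> R) :
  measurable_fun setT h -> measurable_fun setT p ->
  measurable_fun setT (fun x => h x `^ p x).
Proof.
move=> mh mp; rewrite /powR; apply: measurable_fun_ifT.
- exact: measurable_fun_eqr.
- apply: measurableT_comp => //; apply: measurableT_comp => //.
  exact: measurable_fun_eqr.
- apply: measurableT_comp => //; apply: measurable_funM => //.
  by apply: measurableT_comp => //; exact: measurable_ln.
Qed.

(** The value +oo is split off, and [0 < p x] makes its power +oo; what remains is a real power. *)
Lemma measurable_fun_poweR2 (h : T -> \bar R) (p : T -> R) :
  measurable_fun setT h -> measurable_fun setT p ->
  (forall x, 0 < p x) -> (forall x, 0 <= h x)%E ->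
  measurable_fun setT (fun x => (h x `^ p x)%E).
Proof.
move=> mh mp p0 h0.
rewrite (_ : (fun x => _) =
    (fun x => if (h x == +oo)%E then +oo%E else (fine (h x) `^ p x)%:E)).
  apply: measurable_fun_ifT => //.
  - apply: (measurable_fun_bool true).
    rewrite (_ : _ @^-1` _ = h @^-1` [set +oo%E]).
      exact: mh.
    by apply/seteqP; split => x /eqP.
  - apply/measurable_EFinP; apply: measurable_fun_powR2 => //.
    exact: measurableT_comp.
apply/funext => x; case: (h x) (h0 x) => [r _| _|//] //.
by rewrite poweRyr// gt_eqF.
Qed.

(** Tonelli applies to the positive and negative parts separately, and [fine] totalises their
    difference, so no integrability is assumed. *)
Lemma measurable_fun_Rintegral d2 (T2 : measurableType d2)
    (m : {sigma_finite_measure set T2 -> \bar R}) (D : set T2) (f : T * T2 -> R) :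
  measurable D -> measurable_fun setT f ->
  measurable_fun setT (fun x => \int[m]_(y in D) f (x, y)).
Proof.
move=> mD mf; rewrite /Rintegral; apply: measurableT_comp => //.
under eq_fun do rewrite integral_mkcond integralE.
pose g (z : T * T2) := (f z * \1_D z.2).
have mg : measurable_fun setT (EFin \o g).
  apply/measurable_EFinP; apply: measurable_funM => //.
  by apply: measurableT_comp => //; exact: measurable_indic.
have gE x : (fun y => (f (x, y))%:E) \_ D = (fun y => (g (x, y))%:E).
  apply/funext => y; rewrite patchE /g/= indicE.
  by case: ifPn => _; rewrite ?mulr1 ?mulr0.
apply: emeasurable_funB.
- rewrite (_ : (fun x => _) = fubini_F m (EFin \o g)^\+%E).
    apply: measurable_fun_fubini_tonelli_F => //.
    exact: measurable_funepos.
  apply/funext => x; rewrite /fubini_F gE; apply: eq_integral => y _.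
  by rewrite !funeposE.
- rewrite (_ : (fun x => _) = fubini_F m (EFin \o g)^\-%E).
    apply: measurable_fun_fubini_tonelli_F => //.
    exact: measurable_funeneg.
  apply/funext => x; rewrite /fubini_F gE; apply: eq_integral => y _.
  by rewrite !funenegE.
Qed.

End measurability.

(** The identity f^-1 = f |f|^(-2) survives at the zeros of [f], where 0^-1 = 0, and reduces
    inversion to a power with constant exponent. *)
Lemma measurable_funVr d (T : measurableType d) (R : realType) (f : T -> R) :
  measurable_fun setT f -> measurable_fun setT (fun x => (f x)^-1).
Proof.
move=> mf; rewrite (_ : (fun x => _) = (fun x => f x * `|f x| `^ (- 2%:R))).
  apply: measurable_funM => //.
  by apply: (measurableT_comp (measurable_powR _)); exact: measurableT_comp.
apply/funext => x; rewrite powR_invn// real_normK ?num_real//.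
by have [->|fx0] := eqVneq (f x) 0; [rewrite invr0 mul0r|field].
Qed.

Lemma measurable_fun_sqrtr d (T : measurableType d) (R : realType) (f : T -> R) :
  measurable_fun setT f -> measurable_fun setT (fun x => Num.sqrt (f x)).
Proof.
apply: measurableT_comp; apply: continuous_measurable_fun; exact: sqrt_continuous.
Qed.

(** * Improper integrals of nonnegative functions by exhaustion *)

Section ftc_exhaustion.
Context {R : realType}.
Local Notation leb := (@lebesgue_measure R).
Implicit Types (f F : R -> R) (a b : nat -> R) (D : set R).

(** The segments increase to [D]. For a nonnegative integrand, monotone convergence turns an
    improper integral over [D] into a limit over these segments. *)
Definition exhausts D a b :=
  [/\ forall n m, (n <= m)%N -> a m <= a n /\ b n <= b m,
      forall n, a n < b n,
      forall n, `[a n, b n] `<=` D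
    & forall x, D x -> exists n, a n <= x <= b n].

Lemma ge0_integral_exhausts D a b (f : R -> \bar R) : exhausts D a b ->
    measurable_fun D f -> (forall x, D x -> 0 <= f x)%E -> measurable D ->
  (\int[leb]_(x in `[a n, b n]) f x @[n --> \oo] --> \int[leb]_(x in D) f x)%E.
Proof.
move=> [mon ab sub ex] mf f0 mD.
have -> : D = \bigcup_n `[a n, b n]%classic.
  apply/seteqP; split=> [x /ex[n xn]|x [n _]]; last exact: sub.
  by exists n => //=; rewrite in_itv.
apply: ge0_nondecreasing_set_cvg_integral.
- move=> n m nm; apply/subsetPset => x /=; rewrite !in_itv/= => /andP[anx xbn].
  have [amn bnm] := mon _ _ nm.
  by rewrite (le_trans amn anx) (le_trans xbn bnm).
- by move=> n; exact: measurable_itv.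
- by move=> n; apply: measurable_funS mf.
- by move=> n x /sub; exact: f0.
Qed.

Lemma FTC_itvcc f F (a b : R) : a < b ->
    (forall x : R, x \in `[a, b] -> is_derive x (1 : R) F (f x)) ->
    {in `[a, b], forall x, {for x, continuous f}} ->
  (\int[leb]_(x in `[a, b]) (f x)%:E = (F b - F a)%:E)%E.
Proof.
move=> ab dF cf.
have cF x : x \in `[a, b] -> {for x, continuous F}.
  move=> xab; have := dF _ xab => dFx.
  apply: differentiable_continuous; apply/derivable1_diffP; exact: ex_derive.
rewrite EFinB; apply: continuous_FTC2 => //.
- by apply: continuous_in_subspaceT => x /[!inE] xab; exact: cf.
- split.
  + by move=> x xab; have := dF _ (subset_itv_oo_cc xab) => ?; exact: ex_derive.
  + apply: cvg_at_right_filter; apply: cF.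
    by rewrite in_itv/= lexx ltW.
  + apply: cvg_at_left_filter; apply: cF.
    by rewrite in_itv/= lexx ltW.
- by move=> x xab; have := dF _ (subset_itv_oo_cc xab) => ?; rewrite derive1E derive_val.
Qed.

Section ftc_open.
Variables (D : set R) (a b : nat -> R) (f F : R -> R).
Hypotheses (Dab : exhausts D a b) (oD : open D).
Hypothesis f0 : forall x, D x -> 0 <= f x.
Hypothesis dF : forall x : R, D x -> is_derive x (1 : R) F (f x).
Hypothesis cf : forall x, D x -> {for x, continuous f}.

Let cvgF : ((F (b n) - F (a n))%:E @[n --> \oo] --> \int[leb]_(x in D) (f x)%:E)%E.
Proof.
have mD : measurable D by exact: open_measurable.
have := ge0_integral_exhausts (f := EFin \o f) Dab _ _ mD.
have [mon ab sub ex] := Dab.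
rewrite (_ : (fun n => _) = (fun n => (F (b n) - F (a n))%:E)); last first.
  apply/funext => n; apply: FTC_itvcc => // x xab.
  - by apply: dF; apply: sub xab.
  - by apply: cf; apply: sub xab.
apply => //.
apply/measurable_EFinP; apply: open_continuous_measurable_fun => // x /[!inE].
exact: cf.
Qed.

Lemma ge0_FTC_exhausts (A B : R) :
    F (a n) @[n --> \oo] --> A -> F (b n) @[n --> \oo] --> B ->
  (\int[leb]_(x in D) (f x)%:E = (B - A)%:E)%E.
Proof.
move=> FA FB; apply/esym; have := cvgF; apply: cvg_unique => //.
by apply: cvg_EFin; [exact: nearW|exact: cvgB].
Qed.

(** A bound on the increments of [F] takes the place of its limits at the two ends of [D]. *)
Lemma ge0_FTC_exhausts_le (K : R) : (forall x y, D x -> D y -> F y - F x <= K) ->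
  (\int[leb]_(x in D) (f x)%:E <= K%:E)%E.
Proof.
move=> FK; have [mon ab sub ex] := Dab.
have aD n : D (a n) by apply: (sub n); rewrite /= in_itv/= lexx ltW.
have bD n : D (b n) by apply: (sub n); rewrite /= in_itv/= lexx ltW.
rewrite -(cvg_lim _ cvgF)//; apply: lime_le.
  by apply/cvg_ex; eexists; exact: cvgF.
by apply: nearW => n; rewrite lee_fin; exact: FK.
Qed.

End ftc_open.

(** The index [n.+2] rather than [n.+1] keeps the first segment from collapsing to the point 1. *)
Lemma exhausts_Rpos : exhausts Rpos (fun n => n.+2%:R^-1) (fun n => n.+2%:R).
Proof.
split.
- move=> n m nm; split; last by rewrite ler_nat !ltnS.
  by rewrite lef_pV2 ?posrE ?ltr0n// ler_nat !ltnS.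
- move=> n; apply: (@lt_trans _ _ 1); last by rewrite ltr1n.
  by rewrite invf_lt1 ?ltr0n// ltr1n.
- move=> n x; rewrite /Rpos/= !in_itv/= andbT => /andP[+ _].
  by apply: lt_le_trans; rewrite invr_gt0 ltr0n.
- move=> x; rewrite /Rpos/= in_itv/= andbT => x0.
  pose N := Num.truncn (Num.max x x^-1).
  exists N; have : Num.max x x^-1 < N.+1%:R.
    by apply: real_truncnS_gt; rewrite num_real.
  rewrite gt_max => /andP[xN xVN]; apply/andP; split.
    rewrite -[leRHS]invrK lef_pV2 ?posrE ?ltr0n ?invr_gt0//.
    by rewrite (le_trans (ltW xVN))// ler_nat.
  by rewrite (le_trans (ltW xN))// ler_nat.
Qed.

Lemma open_Rpos : open (@Rpos R). Proof. exact: interval_open. Qed.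

End ftc_exhaustion.

Section translation.
Context {R : realType}.
Local Notation leb := (@lebesgue_measure R).

(** The image of Lebesgue measure under the translation agrees with it on half-open intervals, hence
    everywhere by uniqueness. *)
Lemma lebesgue_integral_translate (c : R) (f : R -> \bar R) :
    measurable_fun setT f -> (forall x, 0 <= f x)%E ->
  (\int[leb]_x f (x + c)%R = \int[leb]_x f x)%E.
Proof.
move=> mf f0.
have mc : @measurable_fun _ _ (measurableTypeR R) (measurableTypeR R) setT (fun x => (x + c)%R).
  exact: measurable_funD.
pose nu : {measure set (measurableTypeR R) -> \bar R} :=
  measure_function_pushforward__canonical__measure_function_Measure leb mc.
have U : forall X : set R, ocitv X -> leb X = nu X.
  move=> _ [[x y] _ <-]; rewrite /nu /= /pushforward/=.
  rewrite (_ : _ @^-1` _ = `]x - c, y - c]%classic).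
    rewrite !lebesgue_measure_itv/= !lte_fin ltrD2r.
    by case: ifP => // _; rewrite -!EFinB; congr EFin; ring.
  by apply/seteqP; split => z /=; rewrite !in_itv/= ltrBlDr lerBrDr.
have E := lebesgue_measure_unique U.
have -> : (\int[leb]_x f x = \int[nu]_x f x)%E.
  apply: eq_measure_integral => A mA _; exact: (E A mA).
have := ge0_integral_pushforward mc leb measurableT mf (fun y _ => f0 y).
by rewrite preimage_setT => <-.
Qed.

End translation.

(** * The primitive of the Gaussian function *)

Section gauss_primitive.
Context {R : realType}.
Local Notation leb := (@lebesgue_measure R).

(** This is sqrt(pi) (1 + erf w) / 2. It expresses the antiderivatives both of the subordination
    density and of its convolution integrand. *)
Definition gauss_primitive (w : R) : R := \int[leb]_(x in `]-oo, w]) gauss_fun x.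

Let integrable_gauss D : measurable D -> leb.-integrable D (EFin \o @gauss_fun R).
Proof. by move=> mD; exact: integrableS (integrableT_gauss). Qed.

Lemma is_derive_gauss_primitive (w : R) :
  is_derive w (1 : R) gauss_primitive (gauss_fun w).
Proof.
have w1 : w < w + 1 by rewrite ltrDl.
have [] := @continuous_FTC1 R gauss_fun -oo%O w (w + 1) w1 _ _ (@continuous_gauss_fun R w).
- by apply: integrable_gauss; exact: measurable_itv.
- by rewrite ltNyr.
move=> d1 d2.
by apply: DeriveDef; [exact: d1|rewrite -derive1E; exact: d2].
Qed.

Lemma gauss_primitive_ge0 w : 0 <= gauss_primitive w.
Proof. by apply: Rintegral_ge0 => x _; exact: gauss_fun_ge0. Qed.

(** The Gaussian is even and has total mass sqrt(pi). *)
Lemma gauss_primitiveN w : gauss_primitive (- w) = Num.sqrt pi - gauss_primitive w.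
Proof.
apply/eqP; rewrite eq_sym subr_eq -eqe EFinD; apply/eqP.
have fi D : measurable D -> (\int[leb]_(x in D) (gauss_fun x)%:E)%E \is a fin_num.
  by move=> mD; apply: integrable_fin_num => //; exact: integrable_gauss.
rewrite -integralT_gauss /gauss_primitive /Rintegral !fineK//; last 2 first.
- by apply: fi; exact: measurable_itv.
- by apply: fi; exact: measurable_itv.
rewrite ge0_integration_by_substitutionNy//; last 2 first.
- by apply: continuous_subspaceT => x; exact: continuous_gauss_fun.
- by move=> x _; exact: gauss_fun_ge0.
under [X in (X + _)%E]eq_integral do rewrite /= /gauss_fun sqrrN -/(gauss_fun _).
rewrite -integral_itv_obnd_cbnd; last first.
  by apply/measurable_EFinP/measurable_funTS; exact: measurable_gauss_fun.
rewrite addeC -ge0_integral_setU//=.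
- by rewrite -itv_bndbnd_setU// set_itvNyy.
- by apply/measurable_EFinP/measurable_funTS; exact: measurable_gauss_fun.
- by move=> x _; rewrite lee_fin gauss_fun_ge0.
- rewrite disj_set2E; apply/eqP; rewrite -subset0 => x []/=.
  by rewrite !in_itv/= andbT leNgt => /negP.
Qed.

Lemma gauss_primitive_le w : gauss_primitive w <= Num.sqrt pi.
Proof. by rewrite -subr_ge0 -gauss_primitiveN gauss_primitive_ge0. Qed.

Lemma nondecreasing_gauss_primitive : {homo gauss_primitive : x y / x <= y}.
Proof.
move=> x y xy; rewrite /gauss_primitive /Rintegral fine_le//.
- by apply: integrable_fin_num => //; apply: integrable_gauss; exact: measurable_itv.
- by apply: integrable_fin_num => //; apply: integrable_gauss; exact: measurable_itv.
apply: ge0_subset_integral => //.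
- by apply/measurable_EFinP/measurable_funTS; exact: measurable_gauss_fun.
- by move=> z _; rewrite lee_fin gauss_fun_ge0.
- by move=> z /=; rewrite !in_itv/= => /le_trans; exact.
Qed.

Lemma cvg_gauss_primitive_y : gauss_primitive x @[x --> +oo] --> (Num.sqrt pi : R).
Proof.
have H : gauss_primitive n%:R @[n --> \oo] --> (Num.sqrt pi : R).
  rewrite /gauss_primitive /Rintegral.
  rewrite (_ : Num.sqrt pi = fine (\int[leb]_x (gauss_fun x)%:E)); last first.
    by rewrite integralT_gauss.
  apply: fine_cvg; rewrite fineK; last by rewrite integralT_gauss.
  rewrite (_ : setT = \bigcup_n `]-oo, n%:R]%classic); last first.
    apply/seteqP; split => // x _; exists (Num.truncn (Num.max 0 x)).+1 => //=.
    rewrite in_itv/= (@le_trans _ _ (Num.max 0 x))// ?le_max ?lexx ?orbT//.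
    by apply/ltW/real_truncnS_gt; rewrite num_real.
  apply: ge0_nondecreasing_set_cvg_integral.
  - move=> n m nm; apply/subsetPset => x /=; rewrite !in_itv/= => /le_trans; apply.
    by rewrite ler_nat.
  - by move=> n; exact: measurable_itv.
  - by move=> n; apply/measurable_EFinP/measurable_funTS; exact: measurable_gauss_fun.
  - by move=> n x _; rewrite lee_fin gauss_fun_ge0.
apply/cvgrPdist_le => e e0.
have /cvgrPdist_le/(_ _ e0)[N _ /(_ N)/= HN] := H.
exists N%:R; split; first exact: num_real.
move=> x /ltW Nx; have := HN (leqnn _).
rewrite !ger0_norm ?subr_ge0 ?gauss_primitive_le//.
by apply: le_trans; rewrite lerD2l lerN2 nondecreasing_gauss_primitive.
Qed.

Lemma cvg_gauss_primitive_Ny (u : nat -> R) :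
  - u n @[n --> \oo] --> +oo -> gauss_primitive (u n) @[n --> \oo] --> (0 : R).
Proof.
move=> uy; under eq_fun do rewrite -[u _]opprK gauss_primitiveN.
suff : Num.sqrt pi - gauss_primitive (- u n) @[n --> \oo] --> (Num.sqrt pi - Num.sqrt pi : R).
  by rewrite subrr.
apply: cvgB; first exact: cvg_cst.
exact: (cvg_comp _ _ uy cvg_gauss_primitive_y).
Qed.

End gauss_primitive.

(** * The subordination density *)

Section levy.
Context {R : realType}.
Local Notation leb := (@lebesgue_measure R).
Implicit Types a b r s t : R.

(* Vanishes for s <= 0, because then Num.sqrt s = 0 and 0^-1 = 0. *)
Definition levy t s : R :=
  t / (2 * Num.sqrt pi) * (s * Num.sqrt s)^-1 * expR (- (t ^+ 2 / (4 * s))).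

Lemma levy_le0 t s : s <= 0 -> levy t s = 0.
Proof. by move=> s0; rewrite /levy (ler0_sqrtr s0) mulr0 invr0 mulr0 mul0r. Qed.

Lemma levy_ge0 t s : 0 <= t -> 0 <= levy t s.
Proof.
move=> t0; have [s0|s0] := leP s 0; first by rewrite levy_le0.
rewrite /levy !mulr_ge0 ?expR_ge0 ?invr_ge0// mulr_ge0 ?sqrtr_ge0//.
exact: ltW.
Qed.

Lemma measurable_levy t : measurable_fun setT (levy t).
Proof.
apply: measurable_funM; last first.
  apply: measurableT_comp => //; apply: measurableT_comp => //.
  apply: measurable_funM => //; apply: measurable_funVr.
  exact: measurable_funM.
apply: measurable_funM => //; apply: measurable_funVr; apply: measurable_funM => //.
exact: measurable_fun_sqrtr.
Qed.

(** Apart from the linear prefactor, the density decreases in [t]. *)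
Lemma le_levy c t s : 0 < c -> c <= t -> levy t s <= t / c * levy c s.
Proof.
move=> c0 ct; have t0 := lt_le_trans c0 ct.
have [s0|s0] := leP s 0; first by rewrite !levy_le0// mulr0.
have -> : t / c * levy c s =
    t / (2 * Num.sqrt pi) * (s * Num.sqrt s)^-1 * expR (- (c ^+ 2 / (4 * s))).
  rewrite /levy; field; rewrite !gt_eqF ?sqrtr_gt0 ?pi_gt0//.
rewrite /levy ler_wpM2l//.
  rewrite !mulr_ge0 ?invr_ge0 ?mulr_ge0 ?sqrtr_ge0//; exact: ltW.
by rewrite ler_expR lerN2 ler_wpM2r ?ler_sqr ?nnegrE ?invr_ge0 ?mulr_ge0// ltW.
Qed.

(** The substitution t / (2 sqrt s) gives an explicit antiderivative. The mass is in fact 1; the 2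
    comes from confining [gauss_primitive] to [0, sqrt pi] over the whole line. *)
Lemma integral_levy_le t : 0 < t -> (\int[leb]_(s in Rpos) (levy t s)%:E <= 2%:E)%E.
Proof.
move=> t0.
have sp0 : 0 < Num.sqrt (pi : R) by rewrite sqrtr_gt0 pi_gt0.
pose F s := - (2 / Num.sqrt pi) * gauss_primitive (t / 2 * (Num.sqrt s)^-1).
have posP s : Rpos s -> 0 < s by rewrite /Rpos/= in_itv/= andbT.
have dlevy s : Rpos s -> is_derive s (1 : R) F (levy t s).
  move=> /posP s0.
  have ss0 : 0 < Num.sqrt s by rewrite sqrtr_gt0.
  have ds := is_derive1_sqrt s0.
  have dsV : is_derive s (1 : R) (fun s => (Num.sqrt s)^-1)
      (- (Num.sqrt s) ^- 2 *: (2 * Num.sqrt s)^-1).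
    by apply: is_deriveV; rewrite gt_eqF.
  have dw : is_derive s (1 : R) (fun s => t / 2 * (Num.sqrt s)^-1)
      (t / 2 *: (- (Num.sqrt s) ^- 2 *: (2 * Num.sqrt s)^-1)).
    exact: is_deriveZ.
  have dP := @is_derive1_comp _ gauss_primitive (fun s => t / 2 * (Num.sqrt s)^-1)
    _ _ _ (is_derive_gauss_primitive _) dw.
  have dF : is_derive s (1 : R) F _ := is_deriveZ (- (2 / Num.sqrt pi)) dP.
  apply: (is_derive_eq dF).
  rewrite /levy /gauss_fun !scalerAr.
  have -> : (t / 2 / Num.sqrt s) ^+ 2 = t ^+ 2 / (4 * s).
    rewrite !exprMn !exprVn sqr_sqrtr ?ltW//; field; by rewrite gt_eqF.
  rewrite (_ : s * Num.sqrt s = Num.sqrt s ^+ 3); last first.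
    by rewrite exprSr sqr_sqrtr// ltW.
  by rewrite /GRing.scale/=; field; rewrite !gt_eqF.
apply: (ge0_FTC_exhausts_le exhausts_Rpos open_Rpos _ dlevy).
- by move=> x _; apply: levy_ge0; exact: ltW.
- move=> s /posP s0; rewrite /levy.
  have cV (f : R -> R) : f s != 0 -> {for s, continuous f} ->
      {for s, continuous (fun x => (f x)^-1)}.
    by move=> fs0 cf; exact: cvgV.
  apply: cvgM; last first.
    apply: continuous_comp; last exact: continuous_expR.
    apply: cvgN; apply: cvgM; first exact: cvg_cst.
    apply: cV; first by rewrite gt_eqF// mulr_gt0.
    by apply: cvgM => //; exact: cvg_cst.
  apply: cvgM; first exact: cvg_cst.
  apply: cV; first by rewrite gt_eqF// mulr_gt0 ?sqrtr_gt0.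
  apply: cvgM => //; exact: sqrt_continuous.
- move=> x y _ _; rewrite /F !mulNr opprK addrC -mulrBr.
  have := gauss_primitive_le (t / 2 / Num.sqrt x).
  have := gauss_primitive_ge0 (t / 2 / Num.sqrt y).
  move=> h1 h2; rewrite mulrAC ler_pdivrMr// ler_pM2l//.
  by apply: le_trans h2; rewrite lerBlDr lerDl.
Qed.

End levy.

(** * Convolution law of the subordination density *)

Section levy_convolution.
Context {R : realType}.
Local Notation leb := (@lebesgue_measure R).
Variables (a b r : R).
Hypotheses (a0 : 0 < a) (b0 : 0 < b) (r0 : 0 < r).

Let q s : R := Num.sqrt (s * (r - s)).
Let w e s : R := (b * s + e * a * (r - s)) / (2 * Num.sqrt r * q s).
Let K : R := a * b / (pi * r * Num.sqrt r) * expR (- ((a ^+ 2 + b ^+ 2) / (4 * r))).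
Let cm : R := (a^-1 + b^-1) / 2 * expR (- (a * b / (2 * r))).
Let cp : R := (b^-1 - a^-1) / 2 * expR (a * b / (2 * r)).
(* Antiderivative of the integrand: up to a constant, w (-1) s ^ 2 and w 1 s ^ 2 both
   complete the square in the exponent a^2 / (4 s) + b^2 / (4 (r - s)). *)
Let F s : R := K * (cm * gauss_primitive (w (-1) s) + cp * gauss_primitive (w 1 s)).
Let f s := levy a s * levy b (r - s).
Let E s := expR (- (a ^+ 2 / (4 * s) + b ^+ 2 / (4 * (r - s)))).

Let in0r s : `]0, r[%classic s -> 0 < s /\ 0 < r - s.
Proof. by rewrite /= in_itv/= subr_gt0 => /andP. Qed.

Let sp0 : 0 < Num.sqrt (pi : R). Proof. by rewrite sqrtr_gt0 pi_gt0. Qed.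
Let sr0 : 0 < Num.sqrt r. Proof. by rewrite sqrtr_gt0. Qed.

Let q2 s : 0 < s -> 0 < r - s -> q s ^+ 2 = s * (r - s).
Proof. by move=> s0 m0; rewrite sqr_sqrtr// ltW// mulr_gt0. Qed.

Let fE s : 0 < s -> 0 < r - s -> f s = a * b / (4 * pi) / q s ^+ 3 * E s.
Proof.
move=> s0 m0; rewrite /f /levy /E opprD expRD.
have ss0 : 0 < Num.sqrt s by rewrite sqrtr_gt0.
have sm0 : 0 < Num.sqrt (r - s) by rewrite sqrtr_gt0.
have -> : q s ^+ 3 = s * Num.sqrt s * ((r - s) * Num.sqrt (r - s)).
  rewrite exprSr q2// /q sqrtrM; last exact: ltW.
  by rewrite mulrACA.
rewrite -[in a * b / (4 * pi)](@sqr_sqrtr _ (pi : R)) ?pi_ge0//.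
by field; rewrite !gt_eqF.
Qed.

Let dw e s : 0 < s -> 0 < r - s ->
  is_derive s (1 : R) (w e) (Num.sqrt r * (b * s - e * a * (r - s)) / (4 * q s ^+ 3)).
Proof.
move=> s0 m0; have q0 : 0 < q s by rewrite sqrtr_gt0 mulr_gt0.
have dp : is_derive s (1 : R) (fun s => s * (r - s)) (r - s - s).
  have h1 := is_derive_id s (1 : R).
  have h2 := is_deriveB (is_derive_cst r s (1 : R)) h1.
  apply: (is_derive_eq (is_deriveM h1 h2)).
  by rewrite ?fctE /GRing.scale/=; ring.
have dq : is_derive s (1 : R) q ((2 * q s)^-1 * (r - s - s)).
  apply: (@is_derive1_comp _ Num.sqrt (fun s => s * (r - s))) => //.
  by apply: is_derive1_sqrt; rewrite mulr_gt0.
have dN : is_derive s (1 : R) (fun s => b * s + e * a * (r - s)) (b - e * a).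
  have h1 := is_derive_id s (1 : R).
  have h2 := is_deriveB (is_derive_cst r s (1 : R)) h1.
  apply: (is_derive_eq (is_deriveD (is_deriveZ b h1) (is_deriveZ (e * a) h2))).
  by rewrite /GRing.scale/=; ring.
have D0 : 2 * Num.sqrt r * q s != 0 by rewrite gt_eqF// !mulr_gt0.
have dD := @is_deriveV _ (fun s => 2 * Num.sqrt r * q s) _ _ _ D0 (is_deriveZ (2 * Num.sqrt r) dq).
apply: (is_derive_eq (is_deriveM dN dD)).
have Er : r = Num.sqrt r ^+ 2 by rewrite sqr_sqrtr ?ltW.
rewrite /GRing.scale/=.
transitivity (((b - e * a) * 2 * q s ^+ 2 - (b * s + e * a * (r - s)) * (r - s - s))
  / (4 * Num.sqrt r * q s ^+ 3)).
  by field; rewrite !gt_eqF.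
transitivity (Num.sqrt r ^+ 2 * (b * s - e * a * (r - s)) / (4 * Num.sqrt r * q s ^+ 3)).
  by rewrite q2// -Er; congr (_ / _); ring.
by field; rewrite !gt_eqF.
Qed.

Let gauss_w e s : e ^+ 2 = 1 -> 0 < s -> 0 < r - s ->
  gauss_fun (w e s) = E s * expR ((a ^+ 2 + b ^+ 2) / (4 * r)) * expR (- e * (a * b / (2 * r))).
Proof.
move=> e1 s0 m0; have q0 : 0 < q s by rewrite sqrtr_gt0 mulr_gt0.
rewrite /gauss_fun /E -!expRD; congr expR.
rewrite /w expr_div_n !exprMn q2// sqr_sqrtr ?ltW//.
rewrite (_ : (b * s + e * a * (r - s)) ^+ 2 =
  b ^+ 2 * s ^+ 2 + 2 * e * a * b * s * (r - s) + e ^+ 2 * a ^+ 2 * (r - s) ^+ 2); last by ring.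
by rewrite e1; field; rewrite !gt_eqF.
Qed.

(** The exponentials in [cm] and [cp] cancel the factors exp(- e a b / (2 r)) of [gauss_w]. The
    remaining weights (1/b + 1/a) / 2 and (1/b - 1/a) / 2 combine the numerators b s + a (r - s) and
    b s - a (r - s) of the two derivatives into the constant r. *)
Let dF s : `]0, r[%classic s -> is_derive s (1 : R) F (f s).
Proof.
move=> /in0r[s0 m0]; have q0 : 0 < q s by rewrite sqrtr_gt0 mulr_gt0.
have h e := @is_derive1_comp _ gauss_primitive (w e) _ _ _
  (is_derive_gauss_primitive _) (dw e s0 m0).
have dF0 : is_derive s (1 : R) F _ :=
  is_deriveZ K (is_deriveD (is_deriveZ cm (h (-1))) (is_deriveZ cp (h 1))).
apply: (is_derive_eq dF0).
rewrite !gauss_w ?expr1n ?sqrrN ?expr1n// fE// /GRing.scale/= /K /cm /cp.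
rewrite opprK !mul1r !mulN1r !expRN.
have := expR_gt0 ((a ^+ 2 + b ^+ 2) / (4 * r)).
have := expR_gt0 (a * b / (2 * r)).
move: (expR (a * b / (2 * r))) (expR ((a ^+ 2 + b ^+ 2) / (4 * r))) => u v u0 v0.
have := pi_gt0 R; move: (pi : R) => p p0.
by field; rewrite !gt_eqF.
Qed.

Let cf s : `]0, r[%classic s -> {for s, continuous f}.
Proof.
move=> srs; have [s0 m0] := in0r srs.
have q0 : 0 < q s by rewrite sqrtr_gt0 mulr_gt0.
have cV (g : R -> R) : g s != 0 -> {for s, continuous g} ->
    {for s, continuous (fun x => (g x)^-1)}.
  by move=> fs0 cg; exact: cvgV.
have cB : {for s, continuous (fun s => r - s)} by apply: cvgB => //; exact: cvg_cst.
rewrite /f /levy; apply: cvgM.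
  apply: cvgM; last first.
    apply: continuous_comp; last exact: continuous_expR.
    apply: cvgN; apply: cvgM; first exact: cvg_cst.
    apply: cV; first by rewrite gt_eqF// mulr_gt0.
    by apply: cvgM => //; exact: cvg_cst.
  apply: cvgM; first exact: cvg_cst.
  apply: cV; first by rewrite gt_eqF// mulr_gt0 ?sqrtr_gt0.
  apply: cvgM => //; exact: sqrt_continuous.
apply: cvgM; last first.
  apply: continuous_comp; last exact: continuous_expR.
  apply: cvgN; apply: cvgM; first exact: cvg_cst.
  apply: cV; first by rewrite gt_eqF// mulr_gt0.
  by apply: cvgM => //; exact: cvg_cst.
apply: cvgM; first exact: cvg_cst.
apply: cV; first by rewrite gt_eqF// mulr_gt0 ?sqrtr_gt0.
apply: cvgM => //; apply: continuous_comp => //; exact: sqrt_continuous.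
Qed.

(** With these endpoints s (r - s) is a perfect square, so [q] has no root left there, and the
    reflection s -> r - s exchanges [sa] and [sb]. *)
Let den n : R := 1 + n.+2%:R ^+ 2.
Let sa n : R := r / den n.
Let sb n : R := r * n.+2%:R ^+ 2 / den n.

Let den0 n : 0 < den n. Proof. by rewrite /den ltr_wpDr// sqr_ge0. Qed.
Let rsa n : r - sa n = sb n.
Proof. by rewrite /sa /sb /den; field; rewrite gt_eqF// den0. Qed.
Let rsb n : r - sb n = sa n. Proof. by rewrite -rsa subKr. Qed.
Let sa0 n : 0 < sa n. Proof. by rewrite divr_gt0. Qed.
Let sb0 n : 0 < sb n. Proof. by rewrite divr_gt0// mulr_gt0// exprn_gt0// ltr0n. Qed.

Let qsa n : q (sa n) = r * n.+2%:R / den n.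
Proof.
rewrite /q rsa /sa /sb (_ : r / _ * _ = (r * n.+2%:R / den n) ^+ 2).
  by rewrite sqrtr_sqr ger0_norm// divr_ge0 ?mulr_ge0// ltW.
by field; rewrite gt_eqF.
Qed.
Let qsb n : q (sb n) = r * n.+2%:R / den n.
Proof. by rewrite -qsa /q rsb rsa mulrC. Qed.

Let ww (al be : R) (n : nat) : R := (al * n.+2%:R ^+ 2 + be) / (2 * Num.sqrt r * n.+2%:R).

Let wsa e n : w e (sa n) = ww (e * a) b n.
Proof.
rewrite /w qsa rsa /sa /sb /ww; have := den0 n; move: (den n) => D D0.
by field; rewrite !gt_eqF ?ltr0n.
Qed.
Let wsb e n : w e (sb n) = ww b (e * a) n.
Proof.
rewrite /w qsb rsb /sa /sb /ww; have := den0 n; move: (den n) => D D0.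
by field; rewrite !gt_eqF ?ltr0n.
Qed.

Let wwN al be n : - ww al be n = ww (- al) (- be) n.
Proof. by rewrite /ww -mulNr opprD mulNr. Qed.

Let cvg_ww al be : 0 < al -> ww al be n @[n --> \oo] --> +oo.
Proof.
move=> al0; apply/cvgryPge => A; near=> n.
have n1 : (1 : R) <= n.+2%:R by rewrite ler1n.
have n0 : (0 : R) < n.+2%:R by rewrite ltr0n.
rewrite /ww ler_pdivlMr ?mulr_gt0// -lerBlDr.
have h : (`|A| * (2 * Num.sqrt r) + `|be|) / al <= n.+2%:R.
  apply: (@le_trans _ _ n%:R); first by near: n; exact: nbhs_infty_ger.
  by rewrite ler_nat -addn2 leq_addr.
rewrite ler_pdivrMr// [leRHS]mulrC in h.
apply: (@le_trans _ _ ((`|A| * (2 * Num.sqrt r) + `|be|) * n.+2%:R)); last first.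
  by rewrite expr2 [leRHS]mulrA ler_pM2r.
rewrite [leRHS]mulrDl; have hb := ler_norm (- be); rewrite normrN in hb.
apply: lerD.
  by rewrite -[leRHS]mulrA ler_pM2r ?ler_norm// !mulr_gt0.
by apply: (le_trans hb); rewrite ler_peMr.
Unshelve. all: by end_near. Qed.

(** As s runs over ]0, r[, [w (-1)] goes from -oo to +oo, whereas [w 1] tends to +oo at both ends.
    Only the [cm] term therefore contributes to the increment of [F], by a full sqrt(pi). *)
Lemma integral_levy_convolution :
  (\int[leb]_(s in `]0%R, r[) (levy a s * levy b (r - s))%:E = (levy (a + b) r)%:E)%E.
Proof.
have ex : exhausts (`]0, r[%classic : set R) sa sb.
  have anti n m : (n <= m)%N -> sa m <= sa n.
    move=> nm; rewrite /sa ler_pM2l// lef_pV2 ?posrE//.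
    by rewrite /den lerD2l ler_sqr ?nnegrE// ler_nat !ltnS.
  split.
  - by move=> n m nm; have := anti _ _ nm; rewrite -!rsa => h; split => //; rewrite lerD2l lerN2.
  - move=> n; rewrite /sa /sb ltr_pM2r ?invr_gt0// -subr_gt0.
    by rewrite -{2}[r]mulr1 -mulrBr mulr_gt0// subr_gt0 exprn_egt1// ltr1n.
  - move=> n s /=; rewrite !in_itv/= => /andP[h1 h2].
    rewrite (lt_le_trans (sa0 n) h1)/= (le_lt_trans h2)// -subr_gt0 rsb//.
  - move=> s /in0r[s0 m0].
    pose X := Num.max (r / s) (r / (r - s)).
    exists (Num.truncn X); set n := Num.truncn X.
    have : X < n.+1%:R by apply: real_truncnS_gt; rewrite num_real.
    rewrite gt_max => /andP[h1 h2].
    have san : sa n <= r / n.+1%:R.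
      rewrite /sa ler_pM2l// lef_pV2 ?posrE// ?ltr0n//.
      rewrite /den (@le_trans _ _ n.+2%:R)// ?ler_nat//.
      by rewrite (@le_trans _ _ (n.+2%:R ^+ 2))// ?lerDr// expr2 ler_peMr// ler1n.
    rewrite (le_trans san)/=; last first.
      by rewrite ler_pdivrMr ?ltr0n// -ler_pdivrMl// mulrC ltW.
    rewrite -lerN2 -(lerD2l r) rsb (le_trans san)//.
    by rewrite ler_pdivrMr ?ltr0n// -ler_pdivrMl// mulrC ltW.
have f0 s : `]0, r[%classic s -> 0 <= f s.
  by move=> _; rewrite mulr_ge0// levy_ge0// ltW.
rewrite (ge0_FTC_exhausts ex (@interval_open _ _ _ _ _) f0 dF cf
   (A := K * (cm * 0 + cp * Num.sqrt pi))
   (B := K * (cm * Num.sqrt pi + cp * Num.sqrt pi))) //.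
- congr EFin.
  rewrite (_ : _ - _ = K * cm * Num.sqrt pi); last by ring.
  rewrite /K /cm /levy (_ : - ((a + b) ^+ 2 / (4 * r)) =
    - ((a ^+ 2 + b ^+ 2) / (4 * r)) - (a * b / (2 * r))); last first.
    by field; rewrite gt_eqF.
  rewrite expRD -[in _ / (pi * r * _)](@sqr_sqrtr _ (pi : R)) ?pi_ge0//.
  by field; rewrite !gt_eqF.
- apply: cvgM; first exact: cvg_cst.
  apply: cvgD; (apply: cvgM; first exact: cvg_cst).
    apply: cvg_gauss_primitive_Ny; under eq_fun do rewrite wsa wwN.
    by apply: cvg_ww; rewrite mulN1r opprK.
  under eq_fun do rewrite wsa; apply: cvg_comp; last exact: cvg_gauss_primitive_y.
  by apply: cvg_ww; rewrite mul1r.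
- apply: cvgM; first exact: cvg_cst.
  apply: cvgD; (apply: cvgM; first exact: cvg_cst);
  under eq_fun do rewrite wsb; (apply: cvg_comp; last exact: cvg_gauss_primitive_y);
  exact: cvg_ww.
Qed.

End levy_convolution.

(** * The change of variables of subordination *)

Section subordination.
Context {R : realType}.
Local Notation leb := (@lebesgue_measure R).
Variables (t : R) (G : R -> R).
Hypotheses (t0 : 0 < t) (cG : forall s, 0 < s -> {for s, continuous G}).
Hypothesis G0 : forall s, 0 < s -> 0 <= G s.

Let c := t ^+ 2 / 4.
Let c0 : 0 < c. Proof. by rewrite divr_gt0// exprn_gt0. Qed.
Let F u : R := c * u^-1.
Let H s := Num.sqrt pi * levy t s * G s.

Let dF (u : R) : 0 < u -> is_derive u (1 : R) F (- (c * u ^- 2)).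
Proof.
move=> u0; have u1 : u != 0 by rewrite gt_eqF.
have := is_deriveZ c (@is_deriveV _ id _ _ _ u1 (is_derive_id u (1 : R))).
by move=> h; apply: (is_derive_eq h); rewrite /GRing.scale/= mulr1 mulrN.
Qed.

Let cV (u : R) (g : R -> R) : g u != 0 -> {for u, continuous g} ->
    {for u, continuous (fun x => (g x)^-1)}.
Proof. by move=> fs0 cg; exact: cvgV. Qed.

Let cdF (u : R) : 0 < u -> {for u, continuous F^`()%classic}.
Proof.
move=> u0.
have E : \forall x \near u, - (c * x ^- 2) = F^`()%classic x.
  near=> x; have x0 : 0 < x by near: x; exact: lt_nbhsr.
  by have := dF x0 => ?; rewrite derive1E derive_val.
have E1 := nbhs_singleton E.
suff : F^`()%classic x @[x --> u] --> - (c * u ^- 2) by rewrite E1.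
apply: cvg_trans; first exact: (near_eq_cvg E).
apply: cvgN; apply: cvgM; first exact: cvg_cst.
apply: (@cV u (fun x => x ^+ 2)); first by rewrite gt_eqF// exprn_gt0.
exact: exprn_continuous.
Unshelve. all: by end_near. Qed.

Lemma continuous_levy s : 0 < s -> {for s, continuous (levy t)}.
Proof.
move=> s0; rewrite /levy; apply: cvgM; last first.
  apply: continuous_comp; last exact: continuous_expR.
  apply: cvgN; apply: cvgM; first exact: cvg_cst.
  apply: (@cV s (fun x => 4 * x)); first by rewrite gt_eqF// mulr_gt0.
  by apply: cvgM => //; exact: cvg_cst.
apply: cvgM; first exact: cvg_cst.
apply: (@cV s (fun x => x * Num.sqrt x)); first by rewrite gt_eqF// mulr_gt0 ?sqrtr_gt0.
apply: cvgM => //; exact: sqrt_continuous.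
Qed.

Let cH s : 0 < s -> {for s, continuous H}.
Proof.
move=> s0; apply: cvgM; last exact: cG.
by apply: cvgM; [exact: cvg_cst|exact: continuous_levy].
Qed.

Let a n : R := n.+2%:R^-1.
Let b n : R := n.+2%:R.
Let n0 n : (0 : R) < n.+2%:R. Proof. by rewrite ltr0n. Qed.

Let HF (u : R) : 0 < u -> H (F u) * - (- (c * u ^- 2)) = expR (- u) / Num.sqrt u * G (t ^+ 2 / (4 * u)).
Proof.
move=> u0; have su0 : 0 < Num.sqrt u by rewrite sqrtr_gt0.
have sp0 : 0 < Num.sqrt (pi : R) by rewrite sqrtr_gt0 pi_gt0.
rewrite /H /levy; have -> : F u = t ^+ 2 / (4 * u).
  by rewrite /F /c; field; rewrite gt_eqF.
have -> : Num.sqrt (t ^+ 2 / (4 * u)) = t / (2 * Num.sqrt u).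
  rewrite -[in LHS](sqr_sqrtr (ltW u0)) (_ : _ / _ = (t / (2 * Num.sqrt u)) ^+ 2).
    by rewrite sqrtr_sqr ger0_norm// ltW// divr_gt0// mulr_gt0.
  by field; rewrite gt_eqF.
have -> : t ^+ 2 / (4 * (t ^+ 2 / (4 * u))) = u.
  by field; rewrite !gt_eqF.
move: (G _) (expR _) => g e; rewrite /c.
move: (Num.sqrt pi) sp0 => P P0. have := sqr_sqrtr (ltW u0); move: (Num.sqrt u) su0 => v v0 <-.
by field; rewrite !gt_eqF.
Qed.

(** The substitution s = t^2 / (4u) moves [t] out of the argument of [G] and into the explicit
    density, so that differentiating in time requires no derivative of [G]. It is carried out on
    segments, and both sides then pass to the limit. *)
Lemma integral_levy_subordination :
  (\int[leb]_(u in Rpos) (expR (- u) / Num.sqrt u * G (t ^+ 2 / (4 * u)))%:E =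
   \int[leb]_(s in Rpos) (Num.sqrt pi * levy t s * G s)%:E)%E.
Proof.
have posP s : Rpos s -> 0 < s by rewrite /Rpos/= in_itv/= andbT.
have mRpos : measurable (@Rpos R) by exact: measurable_Rpos.
have [mon ab sub ex] := @exhausts_Rpos R.
(* [F] is decreasing, so the images of the two endpoints are swapped. *)
have ex' : exhausts (@Rpos R) (fun n => F (b n)) (fun n => F (a n)).
  split.
  - move=> n m nm; have [h1 h2] := mon _ _ nm; rewrite /F !ler_pM2l// lef_pV2 ?posrE//.
    split => //; rewrite lef_pV2 ?posrE ?invr_gt0//.
  - move=> n; rewrite /F ltr_pM2l// ltf_pV2 ?posrE ?invr_gt0//; exact: ab.
  - move=> n s; rewrite /Rpos/= !in_itv/= andbT => /andP[+ _].
    by apply: lt_le_trans; rewrite /F mulr_gt0 ?invr_gt0.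
  - move=> s /posP s0; have [|n /andP[h1 h2]] := ex (c / s).
      by rewrite /Rpos/= in_itv/= andbT divr_gt0.
    exists n; apply/andP; split.
      by rewrite /F ler_pdivrMr// mulrC -ler_pdivrMr.
    by rewrite /F ler_pdivlMr ?invr_gt0// mulrC -ler_pdivlMr.
have mH : measurable_fun Rpos H.
  by apply: open_continuous_measurable_fun => [|s /[!inE]/posP]; [exact: open_Rpos|exact: cH].
have H0 s : Rpos s -> (0 <= (H s)%:E)%E.
  move=> /posP s0; rewrite lee_fin /H; apply: mulr_ge0; last exact: G0.
  by apply: mulr_ge0; [exact: sqrtr_ge0|apply: levy_ge0; exact: ltW].
have mH' : measurable_fun Rpos (EFin \o H) by exact/measurable_EFinP.
have L1 := ge0_integral_exhausts ex' mH' H0 mRpos.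
pose h u := H (F u) * (c * u ^- 2).
have hE u : 0 < u -> h u = expR (- u) / Num.sqrt u * G (t ^+ 2 / (4 * u)).
  by move=> u0; rewrite -HF// opprK.
have ch u : 0 < u -> {for u, continuous h}.
  move=> u0; apply: cvgM; last first.
    apply: cvgM; first exact: cvg_cst.
    apply: (@cV u (fun x => x ^+ 2)); first by rewrite gt_eqF// exprn_gt0.
    exact: exprn_continuous.
  apply: continuous_comp; last by apply: cH; rewrite mulr_gt0 ?invr_gt0.
  by apply: cvgM; [exact: cvg_cst|apply: (@cV _ id); rewrite ?gt_eqF//; exact: cvg_id].
have h0 u : 0 < u -> 0 <= h u.
  move=> u0; have := H0 (F u); rewrite lee_fin => Hu.
  rewrite mulr_ge0//; last by rewrite mulr_ge0 ?ltW// invr_gt0 exprn_gt0.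
  by apply: Hu; rewrite /Rpos/= in_itv/= andbT mulr_gt0 ?invr_gt0.
have mh : measurable_fun Rpos h.
  by apply: open_continuous_measurable_fun => [|s /[!inE]/posP]; [exact: open_Rpos|exact: ch].
have L2 : (\int[leb]_(x in `[a n, b n]) (h x)%:E @[n --> \oo] --> \int[leb]_(x in Rpos) (h x)%:E)%E.
  apply: (@ge0_integral_exhausts _ _ a b (EFin \o h)) => //; first exact/measurable_EFinP.
  by move=> u /posP u0; rewrite lee_fin h0.
transitivity (\int[leb]_(u in Rpos) (h u)%:E)%E.
  by apply: eq_integral => u /[!inE]/posP u0; rewrite hE.
have := L2; rewrite (_ : (fun n => _) = (fun n => \int[leb]_(x in `[F (b n), F (a n)]) (H x)%:E)%E).
  by move=> L3; apply: cvg_unique L3 L1.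
apply/funext => n.
have an0 : 0 < a n by rewrite invr_gt0.
have inP x : x \in `[a n, b n] -> 0 < x.
  by rewrite in_itv/= => /andP[+ _]; exact: lt_le_trans.
have cF x : 0 < x -> {for x, continuous F}.
  by move=> x0; apply: cvgM; [exact: cvg_cst|apply: (@cV _ id); rewrite ?gt_eqF//; exact: cvg_id].
rewrite (@integration_by_substitution_decreasing R F H (a n) (b n)).
- apply: eq_integral => x /[!inE] xab; have x0 := inP _ xab.
  rewrite !fctE /=; have := dF x0 => ?; rewrite derive1E derive_val opprK//.
- by apply: ltW; exact: ab.
- by move=> x y /inP x0 /inP y0 xy; rewrite /F ltr_pM2l// ltf_pV2 ?posrE.
- by move=> x /subset_itv_oo_cc/inP; exact: cdF.
- apply/cvg_ex; eexists; apply: cvg_at_right_filter; exact: cdF.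
- apply/cvg_ex; eexists; apply: cvg_at_left_filter; exact: cdF.
- split.
  + by move=> x /subset_itv_oo_cc/inP x0; have := dF x0 => ?; exact: ex_derive.
  + by apply: cvg_at_right_filter; exact: cF.
  + by apply: cvg_at_left_filter; exact: cF.
- apply: continuous_in_subspaceT => x /[!inE]; rewrite /= in_itv/= => /andP[+ _] => h1.
  by apply: cH; apply: lt_le_trans h1; rewrite mulr_gt0 ?invr_gt0.
Qed.

End subordination.

(** * Time derivatives of the subordination density *)

Section levy_derivatives.
Context {R : realType}.
Implicit Types (c t s z : R) (k : nat).

(** Up to sign and a factor 1/2 these are the Hermite polynomials H_{k+1}: the k-th derivative of z
    exp(- z^2) is exp(- z^2) times the k-th of them. *)
Fixpoint hpoly k : {poly R} :=
  if k is k'.+1 then (hpoly k')^`() - 2%:P * 'X * hpoly k' else 'X.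

(* The k-th derivative in t of levy t s, for s > 0. *)
Definition levyn k t s : R :=
  (Num.sqrt pi)^-1 * s^-1 * (2 * Num.sqrt s) ^- k *
  ((hpoly k).[t / (2 * Num.sqrt s)] * expR (- (t / (2 * Num.sqrt s)) ^+ 2)).

Lemma levyn0 t s : 0 < s -> levyn 0 t s = levy t s.
Proof.
move=> s0; have ss0 : 0 < Num.sqrt s by rewrite sqrtr_gt0.
have sp0 : 0 < Num.sqrt (pi : R) by rewrite sqrtr_gt0 pi_gt0.
rewrite /levyn /levy /= hornerX expr0 exprMn exprVn exprMn sqr_sqrtr ?ltW//.
rewrite (_ : (2 : R) ^+ 2 = 4); last by ring.
by field; rewrite !gt_eqF.
Qed.

Lemma is_derive_levyn k t s : 0 < s ->
  is_derive t (1 : R) (levyn k ^~ s) (levyn k.+1 t s).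
Proof.
move=> s0; have ss0 : 0 < Num.sqrt s by rewrite sqrtr_gt0.
set c := (2 * Num.sqrt s)^-1.
have dz : is_derive t (1 : R) (fun t => t * c) c.
  have h : is_derive t (1 : R) (fun t => t * c) _ :=
    is_deriveM (is_derive_id t (1 : R)) (is_derive_cst c t (1 : R)).
  by apply: (is_derive_eq h); rewrite /GRing.scale/= mulr0 add0r mulr1.
have dp : is_derive (t * c) (1 : R) (horner (hpoly k)) ((hpoly k)^`().[t * c]).
  exact: is_derive_poly.
have dpz := @is_derive1_comp _ (horner (hpoly k)) (fun t => t * c) _ _ _ dp dz.
have de0 : is_derive (t * c) (1 : R) (fun z => - z ^+ 2) (- (2 * (t * c))).
  have h : is_derive (t * c) (1 : R) (fun z => - z ^+ 2) _ :=
    is_deriveN (is_deriveX 2 (is_derive_id (t * c) (1 : R))).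
  by apply: (is_derive_eq h); rewrite /GRing.scale/= expr1 mulr1 -mulr_natl.
have de1 := @is_derive1_comp _ (fun z => - z ^+ 2) (fun t => t * c) _ _ _ de0 dz.
have de := @is_derive1_comp _ expR _ _ _ _ (is_derive_expR _) de1.
have h : is_derive t (1 : R) (levyn k ^~ s) _ :=
  is_deriveZ ((Num.sqrt pi)^-1 * s^-1 * (2 * Num.sqrt s) ^- k) (is_deriveM dpz de).
apply: (is_derive_eq h).
rewrite /levyn /= -!/c hornerD hornerN !hornerM hornerC hornerX.
rewrite /GRing.scale/= -!exprVn (exprS c) -/c.
by ring.
Qed.

(** Each factor z is absorbed by one half of the exponent, the other half being left to the
    induction hypothesis; this is why [a] varies in the induction. *)
Lemma ler_horner_expR (q : {poly R}) (a : R) : 0 < a ->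
  exists2 C, 0 <= C & forall z, 0 <= z -> `|q.[z]| <= C * expR (a * z ^+ 2).
Proof.
elim/poly_ind: q a => [|q c IH] a a0.
  by exists 0 => // z _; rewrite horner0 normr0 mul0r.
have a20 : 0 < a / 2 by rewrite divr_gt0.
have [C C0 HC] := IH _ a20; exists (C * (1 + 2 / a) + `|c|).
  by rewrite addr_ge0// mulr_ge0// addr_ge0// divr_ge0// ltW.
move=> z z0; rewrite hornerMXaddC (le_trans (ler_normD _ _))// mulrDl lerD//; last first.
  rewrite ler_peMr// -[leLHS]expR0 ler_expR mulr_ge0 ?sqr_ge0//; exact: ltW.
rewrite normrM (ger0_norm z0).
rewrite (_ : a * z ^+ 2 = a / 2 * z ^+ 2 + a / 2 * z ^+ 2); last by field.
rewrite expRD.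
have zle : z <= (1 + 2 / a) * expR (a / 2 * z ^+ 2).
  have := expR_ge1Dx (a / 2 * z ^+ 2) => h.
  apply: (@le_trans _ _ ((1 + 2 / a) * (1 + a / 2 * z ^+ 2))); last first.
    by rewrite ler_pM2l// addr_gt0// divr_gt0.
  have -> : (1 + 2 / a) * (1 + a / 2 * z ^+ 2) = 1 + a / 2 * z ^+ 2 + 2 / a + z ^+ 2.
    by field; rewrite gt_eqF.
  have h1 : 0 <= a / 2 * z ^+ 2 by rewrite mulr_ge0 ?sqr_ge0// ltW.
  have h2 : 0 <= 2 / a by rewrite divr_ge0// ltW.
  by move: h1 h2; set u := a / 2 * _; set v := 2 / a; nra.
have := HC _ z0; set A := expR _ in zle * => hq.
rewrite (_ : C * (1 + 2 / a) * (A * A) = (C * A) * ((1 + 2 / a) * A)); last by ring.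
by rewrite ler_pM.
Qed.

(* With z = t / (2 sqrt s), the bound reads z ^ k |hpoly k (z)| <= C z exp(3 z^2 / 4),
   and hpoly 0 = X provides the factor z when k = 0. *)
Lemma levyn_le k : exists2 C, 0 <= C & forall t s, 0 < t -> 0 < s ->
  `|levyn k t s| <= C * t ^- k * levy (t / 2) s.
Proof.
have [q qE] : exists q : {poly R}, forall z, z ^+ k * (hpoly k).[z] = z * q.[z].
  case: k => [|k]; first by exists 1 => z; rewrite /= hornerX hornerC mul1r mulr1.
  by exists ('X^k * hpoly k.+1) => z; rewrite hornerM hornerXn exprS mulrA.
(* Halving the time turns exp(- z^2) into exp(- z^2 / 4), which leaves 3/4 of the exponent for the
   polynomial. *)
have [C C0 HC] := @ler_horner_expR q (3 / 4) ltac:(by []).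
exists (2 * C); first by rewrite mulr_ge0.
move=> t s t0 s0; have ss0 : 0 < Num.sqrt s by rewrite sqrtr_gt0.
have sp0 : 0 < Num.sqrt (pi : R) by rewrite sqrtr_gt0 pi_gt0.
set z := t / (2 * Num.sqrt s); have z0 : 0 < z by rewrite divr_gt0// mulr_gt0.
have -> : levyn k t s = (Num.sqrt pi)^-1 * s^-1 * t ^- k *
    (z * q.[z] * expR (- z ^+ 2)).
  rewrite -qE /levyn -/z (_ : (2 * Num.sqrt s) ^- k = t ^- k * z ^+ k); first by ring.
  rewrite /z expr_div_n mulrA mulVf ?mul1r// expf_neq0// gt_eqF//.
have -> : levy (t / 2) s = (Num.sqrt pi)^-1 * s^-1 * (z / 2) * expR (3 / 4 * z ^+ 2) * expR (- z ^+ 2).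
  rewrite -mulrA -expRD (_ : _ + _ = - ((t / 2) ^+ 2 / (4 * s))); last first.
    rewrite /z expr_div_n exprMn sqr_sqrtr ?ltW//.
    by field; rewrite gt_eqF.
  by rewrite /levy /z; field; rewrite !gt_eqF.
have tk0 : 0 < t ^- k by rewrite invr_gt0 exprn_gt0.
clearbody z; rewrite !normrM (ger0_norm (expR_ge0 _)) (gtr0_norm z0) (gtr0_norm tk0).
rewrite (@gtr0_norm _ (Num.sqrt pi)^-1) ?invr_gt0// (@gtr0_norm _ s^-1) ?invr_gt0//.
rewrite (_ : 2 * C * t ^- k * _ = (Num.sqrt pi)^-1 * s^-1 * t ^- k *
  (z * (C * expR (3 / 4 * z ^+ 2)) * expR (- z ^+ 2))); last by field; rewrite ?expf_neq0 ?gt_eqF.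
rewrite ler_pM2l ?mulr_gt0 ?invr_gt0 ?exprn_gt0// ler_pM2r ?expR_gt0// ler_pM2l//.
by apply: HC; exact: ltW.
Qed.

Lemma measurable_levyn k t : measurable_fun setT (levyn k t).
Proof.
have mz : measurable_fun setT (fun s : R => t / (2 * Num.sqrt s)).
  apply: measurable_funM => //; apply: measurable_funVr; apply: measurable_funM => //.
  exact: measurable_fun_sqrtr.
apply: measurable_funM; last first.
  apply: measurable_funM; last first.
    apply: measurableT_comp => //; apply: measurableT_comp => //.
    exact: measurable_funX.
  apply: (measurableT_comp _ mz); apply: continuous_measurable_fun.
  exact: continuous_horner.
apply: measurable_funM.
  by apply: measurable_funM => //; exact: measurable_funVr.
apply: measurable_funVr; apply: measurable_funX; apply: measurable_funM => //.
exact: measurable_fun_sqrtr.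
Qed.

End levy_derivatives.

(** * Differentiation under the integral sign *)

Section iterated_differentiation_under_integral.
Context d (Y : measurableType d) {R : realType} (mu : {measure set Y -> \bar R}).
Variables (B : set Y) (F : nat -> R -> Y -> R).
Hypothesis mB : measurable B.
Hypothesis dF : forall k (t : R) y, 0 < t -> B y ->
  is_derive t (1 : R) (F k ^~ y) (F k.+1 t y).
Hypothesis mF : forall k t, 0 < t -> measurable_fun B (F k t).
(** Domination is asked only on windows ]c, 4c[, because the available bounds blow up as t tends to
    0; t lies in the window with c = t / 2. *)
Hypothesis domF : forall k c, 0 < c -> exists G : Y -> R,
  [/\ forall y, 0 <= G y, mu.-integrable B (EFin \o G)
    & forall t y, c < t -> t < 4 * c -> B y -> `|F k t y| <= G y].

Let I k t : R := \int[mu]_(y in B) F k t y.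

Let in_window (t : R) : 0 < t -> [/\ 0 < t / 2, t / 2 < t & t < 4 * (t / 2)].
Proof. by move=> t0; split; lra. Qed.

Lemma integrable_iterated k t : 0 < t -> mu.-integrable B (EFin \o F k t).
Proof.
move=> t0; have [c0 ct tc] := in_window t0; have [G [G0 iG FG]] := domF k c0.
apply: (le_integrable mB _ _ iG); first by apply/measurable_EFinP; exact: mF.
by move=> y By /=; rewrite lee_fin (ger0_norm (G0 y)) FG.
Qed.

Lemma is_derive_iterated k (t : R) : 0 < t -> is_derive t (1 : R) (I k) (I k.+1 t).
Proof.
move=> t0; have [c0 ct tc] := in_window t0; have [G [G0 iG FG]] := domF k.+1 c0.
have win (x : R) : `](t / 2), (4 * (t / 2))[%classic x -> [/\ 0 < x, t / 2 < x & x < 4 * (t / 2)].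
  by rewrite /= in_itv/= => /andP[h1 h2]; split => //; exact: lt_trans h1.
have tI : `](t / 2), (4 * (t / 2))[%classic t by rewrite /= in_itv/= ct tc.
have intF (x : R) : `](t / 2), (4 * (t / 2))[%classic x -> mu.-integrable B (EFin \o F k x).
  by move=> /win[x0 _ _]; exact: integrable_iterated.
have dF1 (x : R) y : `](t / 2), (4 * (t / 2))[%classic x -> B y -> derivable (F k ^~ y) x 1.
  by move=> /win[x0 _ _] By; have := dF k x0 By => ?; exact: ex_derive.
have p1 (x : R) y : 0 < x -> B y -> partial1of2 (F k) x y = F k.+1 x y.
  by move=> x0 By; rewrite partial1of2E; have := dF k x0 By => ?; rewrite derive_val.
have ub (x : R) y : `](t / 2), (4 * (t / 2))[%classic x -> B y -> `|partial1of2 (F k) x y| <= G y.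
  by move=> /win[x0 h1 h2] By; rewrite p1// FG.
apply: DeriveDef.
  exact: (derivable_under_integral mB tI intF dF1 G0 iG ub).
rewrite -derive1E (differentiation_under_integral mB tI intF dF1 G0 iG ub).
by apply: eq_Rintegral => y /[!inE] By; rewrite p1.
Qed.

(** Derivatives are local, so agreement of [g] with the integral on the open half-line is enough. *)
Lemma derive1n_iterated (g : R -> R) : (forall t : R, 0 < t -> g t = I 0 t) ->
  forall k (t : R), 0 < t -> derive1n k g t = I k t.
Proof.
move=> gI; elim=> [|k IH] t t0; first by rewrite derive1n0 gI.
rewrite derive1nS derive1E.
have -> : 'D_1 (derive1n k g) t = 'D_1 (I k) t.
  apply: near_eq_derive.
  by near=> x; apply: IH; near: x; exact: lt_nbhsr.
by have := is_derive_iterated k t0 => ?; rewrite derive_val.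
Unshelve. all: by end_near. Qed.

End iterated_differentiation_under_integral.

(** * Gaussian integrals and the Mehler kernel *)

Section sigma_finite_packing.
Context d (T : measurableType d) (R : realType).

(* The proof of sigma-finiteness is an argument, so that the instance can be inferred. *)
Definition sfm (mu : {measure set T -> \bar R}) (h : sigma_finite setT mu) :
  set T -> \bar R := mu.

HB.instance Definition _ mu h := Measure.copy (@sfm mu h) mu.
HB.instance Definition _ mu h :=
  @Measure_isSigmaFinite.Build _ _ _ (@sfm mu h) h.

Lemma sigma_finite_lty (mu : {measure set T -> \bar R}) :
  (mu setT < +oo)%E -> sigma_finite setT mu.
Proof.
move=> h; exists (fun=> setT); first by apply/seteqP; split => // x _; exists 0%N.
by move=> _; split.
Qed.

End sigma_finite_packing.

Section tonelli.
Context d1 d2 (T1 : measurableType d1) (T2 : measurableType d2) (R : realType).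
Variables (m1 : {measure set T1 -> \bar R}) (m2 : {measure set T2 -> \bar R}).
Hypotheses (s1 : sigma_finite setT m1) (s2 : sigma_finite setT m2).
Local Open Scope ereal_scope.

Lemma tonelli (f : T1 * T2 -> \bar R) : measurable_fun setT f ->
    (forall z, 0 <= f z) ->
  \int[m1]_x \int[m2]_y f (x, y) = \int[m2]_y \int[m1]_x f (x, y).
Proof. exact: (@fubini_tonelli _ _ _ _ _ (sfm s1) (sfm s2)). Qed.

Lemma measurable_tonelli (f : T1 * T2 -> \bar R) : measurable_fun setT f ->
    (forall z, 0 <= f z) ->
  measurable_fun setT (fun x => \int[m2]_y f (x, y)).
Proof. exact: (@measurable_fun_fubini_tonelli_F _ _ _ _ _ (sfm s2)). Qed.

Lemma tonelli_prod (f : T1 * T2 -> \bar R) : measurable_fun setT f ->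
    (forall z, 0 <= f z) ->
  \int[m1 \x sfm s2]_z f z = \int[m1]_x \int[m2]_y f (x, y).
Proof. exact: (@fubini_tonelli1 _ _ _ _ _ (sfm s1) (sfm s2)). Qed.

End tonelli.

Section lebesgue_Rvec_product.
Context {R : realType}.
Local Notation leb := (@lebesgue_measure R).
Local Open Scope ereal_scope.

Lemma sigma_finite_lebesgue_Rvec d : sigma_finite setT (@lebesgue_Rvec R d).
Proof.
pose A (n : nat) (i : 'I_d) : set R := `[(- n%:R)%R, n%:R%R]%classic.
exists (fun n => [set x : Rvec R d | forall i, A n i (tnth x i)]).
  apply/seteqP; split => // x _.
  pose M := (\sum_(i < d) `|tnth x i|)%R.
  exists (Num.truncn M).+1 => //= i; rewrite /A /= in_itv/= -ler_norml.
  have : (M < (Num.truncn M).+1%:R)%R by apply: real_truncnS_gt; rewrite num_real.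
  move=> /ltW; apply: le_trans; rewrite /M (bigD1 i)//= lerDl.
  by apply: sumr_ge0.
move=> n; split.
  rewrite (_ : [set x | _] =
      \bigcap_(i in [set: 'I_d]) ((fun x : Rvec R d => tnth x i) @^-1` A n i)).
    apply: fin_bigcap_measurable => // i _.
    by rewrite -[X in measurable X]setTI; apply: measurable_tnth => //; exact: measurable_itv.
  by apply/seteqP; split=> x /= Hx i; [move=> _|]; exact: Hx.
rewrite lebesgue_Rvec_box; last by move=> i; exact: measurable_itv.
have fin i : leb (A n i) \is a fin_num.
  by rewrite /A lebesgue_measure_itv/=; case: ifP.
by rewrite -ge0_fin_numE ?prode_ge0//; apply: prode_fin_num.
Qed.

Lemma integral_lebesgue_Rvec_prod d (f : 'I_d -> R -> R) :
    (forall i, measurable_fun setT (f i)) -> (forall i x, 0 <= f i x)%R ->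
  \int[lebesgue_Rvec d]_x (\prod_(i < d) f i (tnth x i))%:E =
  \prod_(i < d) \int[leb]_x (f i x)%:E.
Proof.
elim: d f => [|d IH] f mf f0.
  rewrite big_ord0 /=; under eq_integral do rewrite big_ord0.
  by rewrite integral_dirac//= diracT mul1e.
have sleb : sigma_finite setT leb by exact: sigma_finiteT.
have mg n (g : 'I_n -> R -> R) : (forall i, measurable_fun setT (g i)) ->
    measurable_fun setT (fun x : Rvec R n => (\prod_(i < n) g i (tnth x i))%R).
  move=> mg; apply: measurable_prod => i _.
  by apply: measurableT_comp => //; exact: measurable_tnth.
have g0 n (g : 'I_n -> R -> R) (x : Rvec R n) : (forall i x, 0 <= g i x)%R ->
    0 <= (\prod_(i < n) g i (tnth x i))%:E.
  by move=> g0; rewrite lee_fin prodr_ge0.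
rewrite big_ord_recl -(IH (fun i => f (lift ord0 i)))//.
rewrite [in LHS]/lebesgue_Rvec -/lebesgue_Rvec /lebesgue_cons /=.
have mc : @measurable_fun _ _ (Rvec R d * measurableTypeR R)%type (Rvec R d.+1)
    setT (@consv R d) := @measurable_consv R d.
rewrite (ge0_integral_pushforward mc)//; last 2 first.
- by apply/measurable_EFinP; exact: mg.
- by move=> x _; exact: g0.
rewrite preimage_setT.
have mh : measurable_fun [set: Rvec R d * R]
    (fun z => (\prod_(i < d) f (lift ord0 i) (tnth z.1 i) * f ord0 z.2)%:E).
  apply/measurable_EFinP; apply: measurable_funM; last exact: measurableT_comp.
  by apply: (measurableT_comp (mg _ (fun i => f (lift ord0 i)) _)).
transitivity (\int[lebesgue_Rvec d \x sfm sleb]_z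
    (\prod_(i < d) f (lift ord0 i) (tnth z.1 i) * f ord0 z.2)%:E).
  apply: eq_integral => -[x t] _ /=; rewrite big_ord_recl mulrC.
  by congr (_ * _)%:E; apply: eq_bigr => i _; rewrite tnthS.
rewrite (tonelli_prod (sigma_finite_lebesgue_Rvec d) sleb)//; last first.
  by move=> z; rewrite lee_fin mulr_ge0// prodr_ge0.
under eq_integral.
  move=> x _; under eq_integral do rewrite EFinM /=.
  rewrite ge0_integralZl//; last 3 first.
  - by apply/measurable_EFinP; exact: mf.
  - by move=> y _; rewrite lee_fin.
  - by apply: (g0 _ (fun i => f (lift ord0 i))) => i y; exact: f0.
  over.
rewrite ge0_integralZr// 1?muleC//.
- by apply/measurable_EFinP; apply: (mg _ (fun i => f (lift ord0 i))) => i; exact: mf.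
- by move=> x _; apply: (g0 _ (fun i => f (lift ord0 i))) => i y; exact: f0.
- by apply: integral_ge0 => x _; rewrite lee_fin.
Qed.

(** Completing the square gives a multiple of the normal density of mean b / (2a) and variance 1 /
    (2a). *)
Lemma integral_gaussR (a b : R) : (0 < a)%R ->
  \int[leb]_x (expR (- (a * x ^+ 2) + b * x))%:E =
  (Num.sqrt (pi / a) * expR (b ^+ 2 / (4 * a)))%:E.
Proof.
move=> a0; pose s := Num.sqrt (2 * a)^-1; pose m := (b / (2 * a))%R.
have a20 : (0 < (2 * a)^-1)%R by rewrite invr_gt0 mulr_gt0.
have s0 : s != 0%R by rewrite gt_eqF// sqrtr_gt0.
have s2 : (s ^+ 2 = (2 * a)^-1)%R by rewrite sqr_sqrtr// ltW.
have pk0 := normal_peak_gt0 s0.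
have pkE : (normal_peak s = (Num.sqrt (pi / a))^-1)%R.
  rewrite /normal_peak s2 -mulr_natr (_ : (_ * _ * _)%R = (pi / a)%R)//.
  by have := pi_gt0 R; move: (pi : R) => p p0; field; rewrite gt_eqF.
have := integral_normal_pdf m s; rewrite normal_pdfE//.
under eq_integral.
  move=> x _; rewrite (_ : (_ * _ = (normal_peak s * expR (- (b ^+ 2 / (4 * a)))) *
    expR (- (a * x ^+ 2) + b * x))%R); last first.
    rewrite -mulrA -expRD; congr (_ * expR _)%R.
    rewrite s2 /m -mulr_natr; field; by rewrite gt_eqF.
  rewrite EFinM; over.
rewrite ge0_integralZl//; last 2 first.
- apply/measurable_EFinP; apply: measurableT_comp => //.
  apply: measurable_funD; last exact: measurable_funM.
  by apply: measurableT_comp => //; apply: measurable_funM => //; exact: measurable_funX.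
- by rewrite lee_fin mulr_ge0 ?expR_ge0// ltW.
move=> h; have c0 : (normal_peak s * expR (- (b ^+ 2 / (4 * a))) != 0)%R.
  by rewrite gt_eqF// mulr_gt0 ?expR_gt0.
have E1 : 1%E = ((normal_peak s * expR (- (b ^+ 2 / (4 * a))))^-1 *
    (normal_peak s * expR (- (b ^+ 2 / (4 * a)))))%:E :> \bar R by rewrite mulVf.
rewrite -[LHS]mul1e E1 EFinM -muleA h mule1 pkE; congr EFin.
by rewrite expRN -invfM invrK.
Qed.

Lemma integral_gauss_Rvec d (a : R) (b : 'I_d -> R) : (0 < a)%R ->
  \int[lebesgue_Rvec d]_x
    (expR (\sum_(i < d) (- (a * tnth x i ^+ 2) + b i * tnth x i)))%:E =
  (Num.sqrt (pi / a) ^+ d * expR (\sum_(i < d) b i ^+ 2 / (4 * a)))%:E.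
Proof.
move=> a0; under eq_integral do rewrite expR_sum.
rewrite (integral_lebesgue_Rvec_prod (f := fun i x => expR (- (a * x ^+ 2) + b i * x)))//.
- under eq_bigr do rewrite integral_gaussR//.
  rewrite prodEFin big_split/= prodr_const card_ord expR_sum//.
- move=> i; apply: measurableT_comp => //.
  apply: measurable_funD; last exact: measurable_funM.
  by apply: measurableT_comp => //; apply: measurable_funM => //; exact: measurable_funX.
Qed.

End lebesgue_Rvec_product.

Section gauss_integrals.
Context {R : realType} {d : nat}.
Implicit Types (x y z : Rvec R d) (s r : R).
Local Notation gam := (@gauss_measure R d).

Lemma dotvv_ge0 x : 0 <= dotv x x.
Proof. by apply: sumr_ge0 => i _; rewrite -expr2 sqr_ge0. Qed.

Lemma normv_sqr x : normv x ^+ 2 = dotv x x.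
Proof. by rewrite sqr_sqrtr// dotvv_ge0. Qed.

Lemma measurable_dotv dT (T : measurableType dT) (f g : T -> Rvec R d) :
  measurable_fun setT f -> measurable_fun setT g ->
  measurable_fun setT (fun t => dotv (f t) (g t)).
Proof.
move=> mf mg; apply: measurable_sum => i; apply: measurable_funM.
- by apply: (measurableT_comp (@measurable_tnth _ R _ i)).
- by apply: (measurableT_comp (@measurable_tnth _ R _ i)).
Qed.

Lemma powR_half_dim (a : R) : 0 < a -> a `^ (- (d%:R / 2)) = (Num.sqrt a)^-1 ^+ d.
Proof.
move=> a0; rewrite powRN mulrC powRrM powR12_sqrt ?ltW// powR_mulrn ?sqrtr_ge0//.
by rewrite exprVn.
Qed.

Lemma ge0_integral_gauss (f : Rvec R d -> \bar R) :
    measurable_fun setT f -> (forall x, 0 <= f x)%E ->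
  (\int[gam]_x f x = \int[lebesgue_Rvec d]_x (f x * (gauss_density x)%:E))%E.
Proof. exact: ge0_integral_mdensity. Qed.

Lemma measurable_sum_quad (al : R) (b : 'I_d -> R) :
  measurable_fun setT (fun y : Rvec R d =>
    \sum_(i < d) (al * tnth y i ^+ 2 + b i * tnth y i)).
Proof.
apply: measurable_sum => i; apply: measurable_funD; apply: measurable_funM => //.
- by apply: measurable_funX; exact: (@measurable_tnth _ R).
- exact: (@measurable_tnth _ R).
Qed.

(** The Gaussian integrals that follow reduce to this one by completing squares coordinatewise;
    [al < 1] keeps the total quadratic coefficient negative. *)
Lemma integral_gauss_quad (al : R) (b : 'I_d -> R) : al < 1 ->
  (\int[gam]_y (expR (\sum_(i < d) (al * tnth y i ^+ 2 + b i * tnth y i)))%:E =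
  ((Num.sqrt (1 - al))^-1 ^+ d * expR (\sum_(i < d) b i ^+ 2 / (4 * (1 - al))))%:E)%E.
Proof.
move=> al1; have a0 : 0 < 1 - al by rewrite subr_gt0.
have sp0 : 0 < Num.sqrt (pi : R) by rewrite sqrtr_gt0 pi_gt0.
have mE : measurable_fun setT (fun y : Rvec R d =>
    (expR (\sum_(i < d) (al * tnth y i ^+ 2 + b i * tnth y i)))%:E).
  by apply/measurable_EFinP; apply: measurableT_comp => //; exact: measurable_sum_quad.
rewrite ge0_integral_gauss//.
under eq_integral.
  move=> y _; rewrite -EFinM (_ : _ * _ = (Num.sqrt pi)^-1 ^+ d *
    expR (\sum_(i < d) (- ((1 - al) * tnth y i ^+ 2) + b i * tnth y i))); last first.
    rewrite /gauss_density powR_half_dim ?pi_gt0// mulrCA -expRD; congr (_ * expR _).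
    rewrite normv_sqr /dotv -sumrN -big_split/=; apply: eq_bigr => i _; ring.
  rewrite EFinM; over.
rewrite ge0_integralZl//; last first.
  apply/measurable_EFinP; apply: measurableT_comp => //.
  have := measurable_sum_quad (- (1 - al)) b.
  by under eq_fun do under eq_bigr do rewrite mulNr.
rewrite integral_gauss_Rvec// -EFinM mulrA -exprMn; congr (_ ^+ _ * _)%:E.
rewrite sqrtrM ?pi_ge0// sqrtrV ?ltW//.
by rewrite mulrA mulVf ?gt_eqF// mul1r.
Qed.

Lemma gauss_measure_setT : gam setT = 1%E.
Proof.
have := @integral_gauss_quad 0 (fun=> 0) ltr01.
rewrite subr0 sqrtr1 invr1 expr1n mul1r.
under eq_integral do under eq_bigr do rewrite !mul0r addr0.
under [in X in _ = X -> _]eq_bigr do rewrite expr0n/= mul0r.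
under eq_integral do rewrite big1// expR0.
by rewrite integral_cst// mul1e big1// expR0.
Qed.

Lemma sigma_finite_gauss : sigma_finite setT gam.
Proof. by apply: sigma_finite_lty; rewrite [ltLHS]gauss_measure_setT ltry. Qed.

(** This weight dominates the p(x)-th power of the error exp(|x|^2 / (8P)) left by the exponent
    change, as p(x) <= P. *)
Lemma integral_gauss_sqr_lty :
  (\int[gam]_x (expR (dotv x x / 8))%:E < +oo)%E.
Proof.
have h : (8 : R)^-1 < 1 by rewrite invf_lt1 ?ltr1n.
have := @integral_gauss_quad 8^-1 (fun=> 0) h.
under eq_integral do under eq_bigr do rewrite mul0r addr0 mulrC expr2.
by under eq_integral do rewrite -mulr_suml -/(dotv _ _); move=> ->; rewrite ltry.
Qed.

End gauss_integrals.

Section mehler_kernel.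
Context {R : realType} {d : nat}.
Implicit Types (x y z : Rvec R d) (s r : R).
Local Notation gam := (@gauss_measure R d).

Definition mehler s x y : R :=
  (1 - expR (- 2 * s)) `^ (- (d%:R / 2)) *
  expR (- ((expR (- 2 * s) * (normv x ^+ 2 + normv y ^+ 2)
            - 2 * expR (- s) * dotv x y) / (1 - expR (- 2 * s)))).

Lemma mehler_ge0 s x y : 0 <= mehler s x y.
Proof. by rewrite mulr_ge0 ?powR_ge0 ?expR_ge0. Qed.

Lemma dotvC x y : dotv x y = dotv y x.
Proof. by apply: eq_bigr => i _; rewrite mulrC. Qed.

Lemma mehlerC s x y : mehler s x y = mehler s y x.
Proof. by rewrite /mehler dotvC (addrC (normv x ^+ 2)). Qed.

Lemma measurable_mehler dT (T : measurableType dT) (a : T -> R) (f g : T -> Rvec R d) :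
  measurable_fun setT a -> measurable_fun setT f -> measurable_fun setT g ->
  measurable_fun setT (fun t => mehler (a t) (f t) (g t)).
Proof.
move=> ma mf mg.
have me2 : measurable_fun setT (fun t => expR (- 2 * a t)).
  by apply: measurableT_comp => //; exact: measurable_funM.
have me1 : measurable_fun setT (fun t => expR (- a t)).
  by apply: measurableT_comp => //; exact: measurableT_comp.
have m1 : measurable_fun setT (fun t => 1 - expR (- 2 * a t)) by exact: measurable_funB.
apply: measurable_funM.
  exact: (measurableT_comp (measurable_powR _) m1).
apply: measurableT_comp => //; apply: measurableT_comp => //.
apply: measurable_funM; last exact: measurable_funVr.
apply: measurable_funB.
  apply: measurable_funM => //; under eq_fun do rewrite !normv_sqr.
  by apply: measurable_funD; exact: measurable_dotv.
by apply: measurable_funM; [exact: measurable_funM|exact: measurable_dotv].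
Qed.

Lemma expRN2 s : expR (- 2 * s) = expR (- s) ^+ 2.
Proof. by rewrite -expRM_natl mulrN mulNr. Qed.

Lemma expRN_lt1 s : 0 < s -> 0 < expR (- s) < 1.
Proof. by move=> s0; rewrite expR_gt0 expR_lt1 oppr_lt0. Qed.

Lemma onem_sqr_gt0 (c : R) : 0 < c < 1 -> 0 < 1 - c ^+ 2.
Proof. by move=> /andP[c0 c1]; rewrite subr_gt0 expr_lt1// ltW. Qed.

Lemma mehlerE s x y : 0 < s ->
  mehler s x y = (Num.sqrt (1 - expR (- s) ^+ 2))^-1 ^+ d *
    expR (\sum_(i < d) - ((expR (- s) ^+ 2 * (tnth x i ^+ 2 + tnth y i ^+ 2)
      - 2 * expR (- s) * (tnth x i * tnth y i)) / (1 - expR (- s) ^+ 2))).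
Proof.
move=> /expRN_lt1/onem_sqr_gt0 s0; rewrite /mehler expRN2 powR_half_dim//.
congr (_ * expR _); rewrite sumrN; congr (- _).
rewrite -mulr_suml sumrB -!mulr_sumr big_split/= !normv_sqr.
by congr ((_ * (_ + _) - _) / _); apply: eq_bigr => i _; rewrite expr2.
Qed.

Lemma integral_mehler s x : 0 < s -> (\int[gam]_y (mehler s x y)%:E = 1)%E.
Proof.
move=> s0; have := expRN_lt1 s0; under eq_integral do rewrite mehlerE//.
move: (expR (- s)) => c c01; have := onem_sqr_gt0 c01.
set v := 1 - c ^+ 2 => v0; have sv0 : 0 < Num.sqrt v by rewrite sqrtr_gt0.
pose al := - (c ^+ 2 / v).
have alE : 1 - al = v^-1 by rewrite /al opprK /v; field; rewrite gt_eqF.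
have al1 : al < 1 by rewrite -subr_gt0 alE invr_gt0.
under eq_integral.
  move=> y _; rewrite (_ : \sum_(i < d) _ = \sum_(i < d) - (c ^+ 2 / v * tnth x i ^+ 2) +
    \sum_(i < d) (al * tnth y i ^+ 2 + (2 * c / v * tnth x i) * tnth y i)); last first.
    by rewrite -big_split/=; apply: eq_bigr => i _; rewrite /al; field; rewrite gt_eqF.
  rewrite expRD mulrA EFinM; over.
rewrite ge0_integralZl//; last first.
  by apply/measurable_EFinP; apply: measurableT_comp => //; exact: measurable_sum_quad.
rewrite integral_gauss_quad// -EFinM alE sqrtrV ?ltW// invrK mulrACA -exprMn mulVf ?gt_eqF//.
rewrite expr1n mul1r -expRD -big_split/= big1 ?expR0// => i _.
by field; rewrite gt_eqF.
Qed.

Lemma mehler_chapman_kolmogorov s r x z : 0 < s -> 0 < r ->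
  (\int[gam]_y (mehler s x y * mehler r y z)%:E = (mehler (s + r) x z)%:E)%E.
Proof.
move=> s0 r0; rewrite mehlerE ?addr_gt0// opprD expRD.
under eq_integral do rewrite !mehlerE//.
have := expRN_lt1 s0; have := expRN_lt1 r0.
(* With exp(-s) and exp(-r) replaced by arbitrary numbers of ]0, 1[, the composition of the two
   kernels becomes a rational identity between quadratic forms. *)
move: (expR (- s)) (expR (- r)) => c e e01 c01.
have := onem_sqr_gt0 c01; have := onem_sqr_gt0 e01.
have /onem_sqr_gt0 : 0 < c * e < 1.
  move: c01 e01 => /andP[c0 c1] /andP[e0 e1].
  by rewrite mulr_gt0// -[ltRHS]mulr1 ltr_pM// ltW.
set v := 1 - c ^+ 2; set w := 1 - e ^+ 2; set u := 1 - (c * e) ^+ 2 => u0 w0 v0.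
have sv0 : 0 < Num.sqrt v by rewrite sqrtr_gt0.
have sw0 : 0 < Num.sqrt w by rewrite sqrtr_gt0.
have su0 : 0 < Num.sqrt u by rewrite sqrtr_gt0.
pose al := - (c ^+ 2 / v) - e ^+ 2 / w.
have alE : 1 - al = u / (v * w).
  by rewrite /al /u /v /w; field; rewrite !gt_eqF.
have al1 : al < 1 by rewrite -subr_gt0 alE divr_gt0// mulr_gt0.
pose b i := 2 * c / v * tnth x i + 2 * e / w * tnth z i.
under eq_integral.
  move=> y _; rewrite mulrACA -expRD -big_split/=.
  rewrite (_ : \sum_(i < d) _ =
    \sum_(i < d) - (c ^+ 2 / v * tnth x i ^+ 2 + e ^+ 2 / w * tnth z i ^+ 2) +
    \sum_(i < d) (al * tnth y i ^+ 2 + b i * tnth y i)); last first.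
    by rewrite -big_split/=; apply: eq_bigr => i _; rewrite /al /b; field; rewrite !gt_eqF.
  rewrite expRD mulrA EFinM; over.
rewrite ge0_integralZl//; last first.
  by apply/measurable_EFinP; apply: measurableT_comp => //; exact: measurable_sum_quad.
rewrite integral_gauss_quad// -EFinM alE mulrACA -!exprMn -expRD -big_split/=.
congr (_ ^+ _ * expR _)%:E.
  rewrite sqrtrM ?ltW// sqrtrV ?mulr_ge0 ?ltW// sqrtrM ?ltW//.
  by field; rewrite !gt_eqF.
apply: eq_bigr => i _; rewrite /b /u /v /w; field.
by rewrite -/u -/v -/w !gt_eqF.
Qed.

Lemma continuous_mehler s x y : 0 < s -> {for s, continuous (fun s => mehler s x y)}.
Proof.
move=> s0; have := expRN_lt1 s0 => /onem_sqr_gt0; rewrite -expRN2 => v0.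
have ce2 : {for s, continuous (fun s => expR (- 2 * s))}.
  apply: continuous_comp; last exact: continuous_expR.
  by apply: cvgM => //; exact: cvg_cst.
have ce1 : {for s, continuous (fun s => expR (- s))}.
  apply: continuous_comp; last exact: continuous_expR.
  exact: cvgN.
have c1 : {for s, continuous (fun s => 1 - expR (- 2 * s))}.
  by apply: cvgB; [exact: cvg_cst|exact: ce2].
rewrite /mehler; apply: cvgM.
  apply: (@continuous_comp _ _ _ (fun s => 1 - expR (- 2 * s)) (fun v => v `^ _)) => //.
  apply: differentiable_continuous; apply/derivable1_diffP.
  by apply: derivable_powR; rewrite in_itv/= v0.
apply: continuous_comp; last exact: continuous_expR.
apply: cvgN; apply: cvgM.
  apply: cvgB.
    by apply: cvgM; [exact: ce2|exact: cvg_cst].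
  by apply: cvgM; [apply: cvgM; [exact: cvg_cst|exact: ce1]|exact: cvg_cst].
by apply: cvgV => //; rewrite gt_eqF.
Qed.

End mehler_kernel.

(** * Semigroup operators *)

Section semigroup_operators.
Context {R : realType} {d : nat}.
Implicit Types (x y z : Rvec R d) (s r t a b : R) (h : Rvec R d -> \bar R).
Local Notation gam := (@gauss_measure R d).
Local Notation leb := (@lebesgue_measure R).
Local Open Scope ereal_scope.

(* The Ornstein-Uhlenbeck (ouT) and Poisson-Hermite (phP) operators on nonnegative functions. *)
Definition ouT s h x : \bar R := \int[gam]_y ((mehler s x y)%:E * h y).
Definition phP t h x : \bar R := \int[leb]_s ((levy t s)%:E * ouT s h x).

Lemma ouT_ge0 s h x : (forall y, 0 <= h y) -> 0 <= ouT s h x.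
Proof.
by move=> h0; apply: integral_ge0 => y _; apply: mule_ge0; rewrite ?lee_fin ?mehler_ge0.
Qed.

Lemma phP_ge0 t h x : (0 <= t)%R -> (forall y, 0 <= h y) -> 0 <= phP t h x.
Proof.
move=> t0 h0; apply: integral_ge0 => s _; apply: mule_ge0; last exact: ouT_ge0.
by rewrite lee_fin levy_ge0.
Qed.

Lemma measurable_mehlerM dT (T : measurableType dT) (a : T -> R) (f g : T -> Rvec R d) h :
  measurable_fun setT a -> measurable_fun setT f -> measurable_fun setT g ->
  measurable_fun setT h ->
  measurable_fun setT (fun u => (mehler (a u) (f u) (g u))%:E * h (g u)).
Proof.
move=> ma mf mg mh; apply: emeasurable_funM.
  by apply/measurable_EFinP; exact: measurable_mehler.
exact: measurableT_comp.
Qed.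

Lemma measurable_ouT dT (T : measurableType dT) (a : T -> R) (f : T -> Rvec R d) h :
  measurable_fun setT a -> measurable_fun setT f ->
  measurable_fun setT h -> (forall y, 0 <= h y) ->
  measurable_fun setT (fun u => ouT (a u) h (f u)).
Proof.
move=> ma mf mh h0.
apply: (measurable_tonelli (@sigma_finite_gauss R d)
  (f := fun w : T * Rvec R d => (mehler (a w.1) (f w.1) w.2)%:E * h w.2)).
  by apply: measurable_mehlerM => //; exact: measurableT_comp.
by move=> w; apply: mule_ge0; rewrite ?lee_fin ?mehler_ge0.
Qed.

(** Invariance of gamma: the kernel is symmetric and has mass one in each variable. *)
Lemma integral_ouT s h : (0 < s)%R -> measurable_fun setT h -> (forall y, 0 <= h y) ->
  \int[gam]_x ouT s h x = \int[gam]_x h x.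
Proof.
move=> s0 mh h0; rewrite /ouT.
rewrite (tonelli (@sigma_finite_gauss R d) (@sigma_finite_gauss R d)
  (f := fun w : Rvec R d * Rvec R d => (mehler s w.1 w.2)%:E * h w.2)) /=; last 2 first.
- by apply: measurable_mehlerM.
- by move=> w; apply: mule_ge0; rewrite ?lee_fin ?mehler_ge0.
apply: eq_integral => y _; rewrite ge0_integralZr//; last 2 first.
- by apply/measurable_EFinP; exact: measurable_mehler.
- by move=> x _; rewrite lee_fin mehler_ge0.
under eq_integral do rewrite mehlerC.
by rewrite integral_mehler// mul1e.
Qed.

Lemma ouT_semigroup s r h x : (0 < s)%R -> (0 < r)%R ->
  measurable_fun setT h -> (forall y, 0 <= h y) ->
  ouT s (ouT r h) x = ouT (s + r) h x.
Proof.
move=> s0 r0 mh h0; rewrite /ouT.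
transitivity (\int[gam]_y \int[gam]_z ((mehler s x y)%:E * ((mehler r y z)%:E * h z))).
  apply: eq_integral => y _; rewrite ge0_integralZl//.
  - exact: measurable_mehlerM.
  - by move=> z _; apply: mule_ge0; rewrite ?lee_fin ?mehler_ge0.
  - by rewrite lee_fin mehler_ge0.
rewrite (tonelli (@sigma_finite_gauss R d) (@sigma_finite_gauss R d)
  (f := fun w : Rvec R d * Rvec R d =>
    (mehler s x w.1)%:E * ((mehler r w.1 w.2)%:E * h w.2))) /=; last 2 first.
- apply: emeasurable_funM; last exact: measurable_mehlerM.
  by apply/measurable_EFinP; exact: measurable_mehler.
- by move=> w; do 2 (apply: mule_ge0; rewrite ?lee_fin ?mehler_ge0//).
apply: eq_integral => z _; under eq_integral do rewrite muleA -EFinM.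
rewrite ge0_integralZr//; last 2 first.
- by apply/measurable_EFinP; apply: measurable_funM; exact: measurable_mehler.
- by move=> y _; rewrite lee_fin mulr_ge0 ?mehler_ge0.
by rewrite mehler_chapman_kolmogorov.
Qed.

Lemma integral_levyT t (f : R -> \bar R) : \int[leb]_s ((levy t s)%:E * f s) =
  \int[leb]_(s in Rpos) ((levy t s)%:E * f s).
Proof.
rewrite [RHS]integral_mkcond; apply: eq_integral => s _; rewrite patchE.
case: ifPn => // /negP; rewrite inE /Rpos/= in_itv/= andbT => /negP.
by rewrite -leNgt => s0; rewrite levy_le0// mul0e.
Qed.

Lemma integral_levyT_le t : (0 < t)%R -> \int[leb]_s (levy t s)%:E <= 2%:E.
Proof.
move=> t0; have := integral_levyT t (fun=> 1).
by under eq_integral do rewrite mule1; under [X in _ = X]eq_integral do rewrite mule1;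
  move=> ->; exact: integral_levy_le.
Qed.

Lemma measurable_phP_integrand dT (T : measurableType dT) t (a : T -> R) (f : T -> Rvec R d) h :
  measurable_fun setT a -> measurable_fun setT f ->
  measurable_fun setT h -> (forall y, 0 <= h y) ->
  measurable_fun setT (fun u => (levy t (a u))%:E * ouT (a u) h (f u)).
Proof.
move=> ma mf mh h0; apply: emeasurable_funM; last exact: measurable_ouT.
by apply/measurable_EFinP; apply: (measurableT_comp (measurable_levy t)).
Qed.

Lemma measurable_phP t h : (0 <= t)%R ->
  measurable_fun setT h -> (forall y, 0 <= h y) ->
  measurable_fun setT (phP t h).
Proof.
move=> t0 mh h0.
have sleb : sigma_finite setT leb by exact: sigma_finiteT.
apply: (measurable_tonelli sleb
  (f := fun w : Rvec R d * measurableTypeR R => (levy t w.2)%:E * ouT w.2 h w.1)).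
  exact: measurable_phP_integrand.
by move=> w; apply: mule_ge0; [rewrite lee_fin levy_ge0|exact: ouT_ge0].
Qed.

(** A Harnack-type comparison inherited from [le_levy]: increasing the time costs only the ratio of
    the times. It makes bounds uniform over time windows. *)
Lemma phP_le c t h x : (0 < c)%R -> (c <= t)%R ->
  measurable_fun setT h -> (forall y, 0 <= h y) ->
  phP t h x <= (t / c)%:E * phP c h x.
Proof.
move=> c0 ct mh h0; have t0 := lt_le_trans c0 ct.
rewrite /phP -ge0_integralZl//; last 3 first.
- exact: measurable_phP_integrand.
- by move=> s _; apply: mule_ge0; [rewrite lee_fin levy_ge0// ltW|exact: ouT_ge0].
- by rewrite lee_fin divr_ge0// ltW.
apply: ge0_le_integral => //.
- by move=> s _; apply: mule_ge0; [rewrite lee_fin levy_ge0// ltW|exact: ouT_ge0].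
- exact: measurable_phP_integrand.
- by apply: emeasurable_funM => //; exact: measurable_phP_integrand.
- move=> s _; rewrite muleA; apply: lee_wpmul2r; first exact: ouT_ge0.
  by rewrite -EFinM lee_fin le_levy.
Qed.

Lemma integral_phP_le t h : (0 < t)%R -> measurable_fun setT h -> (forall y, 0 <= h y) ->
  \int[gam]_x phP t h x <= 2%:E * \int[gam]_x h x.
Proof.
move=> t0 mh h0; rewrite /phP.
have sleb : sigma_finite setT leb by exact: sigma_finiteT.
rewrite (tonelli (@sigma_finite_gauss R d) sleb
  (f := fun w : Rvec R d * measurableTypeR R => (levy t w.2)%:E * ouT w.2 h w.1)) /=; last 2 first.
- exact: measurable_phP_integrand.
- by move=> w; apply: mule_ge0; [rewrite lee_fin levy_ge0// ltW|exact: ouT_ge0].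
have I0 : 0 <= \int[gam]_x h x by exact: integral_ge0.
have -> : \int[leb]_s \int[gam]_x ((levy t s)%:E * ouT s h x) =
    \int[leb]_s ((levy t s)%:E * \int[gam]_x h x).
  apply: eq_integral => s _; rewrite ge0_integralZl//; last 3 first.
  - exact: measurable_ouT.
  - by move=> x _; exact: ouT_ge0.
  - by rewrite lee_fin levy_ge0// ltW.
  have [s0|s0] := leP s 0%R; first by rewrite levy_le0// !mul0e.
  by rewrite integral_ouT.
rewrite ge0_integralZr//; last 2 first.
- by apply/measurable_EFinP; exact: measurable_levy.
- by move=> s _; rewrite lee_fin levy_ge0// ltW.
by apply: lee_wpmul2r => //; exact: integral_levyT_le.
Qed.

Lemma levy_convolution a b r : (0 < a)%R -> (0 < b)%R ->
  \int[leb]_s ((levy a s)%:E * (levy b (r - s))%:E) = (levy (a + b) r)%:E.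
Proof.
move=> a0 b0; have [r0|r0] := leP r 0%R.
  rewrite levy_le0//; apply: integral0_eq => s _.
  have [s0|s0] := leP s 0%R; first by rewrite (levy_le0 _ s0) mul0e.
  by rewrite (@levy_le0 _ b) ?mule0// subr_le0 (le_trans r0)// ltW.
rewrite -integral_levy_convolution// [RHS]integral_mkcond.
apply: eq_integral => s _; rewrite patchE; case: ifPn => [//|/negP].
rewrite inE/= in_itv/= => /negP; rewrite negb_and -!leNgt => /orP[] s0.
  by rewrite (levy_le0 _ s0) mul0e.
by rewrite (@levy_le0 _ b) ?mule0// subr_le0.
Qed.

(** The Ornstein-Uhlenbeck semigroup law merges the two inner operators into one of time r, the sum
    of the two subordination variables; integrating out s at fixed r leaves the convolution of the
    two densities. *)
Lemma phP_semigroup a b h x : (0 < a)%R -> (0 < b)%R ->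
  measurable_fun setT h -> (forall y, 0 <= h y) ->
  phP a (phP b h) x = phP (a + b) h x.
Proof.
move=> a0 b0 mh h0.
have sleb : sigma_finite setT leb by exact: sigma_finiteT.
have a0' := ltW a0; have b0' := ltW b0.
transitivity (\int[leb]_s \int[leb]_r
    ((levy a s)%:E * ((levy b (r - s))%:E * ouT r h x))).
  apply: eq_integral => s _; have [s0|s0] := leP s 0%R.
    by rewrite (levy_le0 _ s0) mul0e integral0_eq// => r _; rewrite mul0e.
  rewrite ge0_integralZl//; last 3 first.
  - apply: emeasurable_funM; last exact: measurable_ouT.
    apply/measurable_EFinP; apply: (measurableT_comp (measurable_levy b)).
    exact: measurable_funB.
  - by move=> r _; apply: mule_ge0; [rewrite lee_fin levy_ge0|exact: ouT_ge0].
  - by rewrite lee_fin levy_ge0.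
  congr (_ * _).
  (* Translating r by s undoes the shift in the second density, so that r - s becomes the
     subordination time of the inner operator. *)
  rewrite -(lebesgue_integral_translate s); last 2 first.
  - apply: emeasurable_funM; last exact: measurable_ouT.
    apply/measurable_EFinP; apply: (measurableT_comp (measurable_levy b)).
    exact: measurable_funB.
  - by move=> r; apply: mule_ge0; [rewrite lee_fin levy_ge0|exact: ouT_ge0].
  rewrite [ouT s _ x]/ouT /phP.
  transitivity (\int[gam]_y \int[leb]_r ((mehler s x y)%:E * ((levy b r)%:E * ouT r h y))).
    apply: eq_integral => y _; rewrite ge0_integralZl//.
    - exact: measurable_phP_integrand.
    - by move=> r _; apply: mule_ge0; [rewrite lee_fin levy_ge0|exact: ouT_ge0].
    - by rewrite lee_fin mehler_ge0.
  rewrite (tonelli (@sigma_finite_gauss R d) sleb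
    (f := fun w : Rvec R d * measurableTypeR R =>
    (mehler s x w.1)%:E * ((levy b w.2)%:E * ouT w.2 h w.1))) /=; last 2 first.
  - apply: emeasurable_funM; last exact: measurable_phP_integrand.
    by apply/measurable_EFinP; exact: measurable_mehler.
  - move=> w; apply: mule_ge0; first by rewrite lee_fin mehler_ge0.
    by apply: mule_ge0; [rewrite lee_fin levy_ge0|exact: ouT_ge0].
  apply: eq_integral => r _; rewrite addrK.
  under eq_integral do rewrite muleCA.
  rewrite ge0_integralZl//; last 3 first.
  - apply: emeasurable_funM; last exact: measurable_ouT.
    by apply/measurable_EFinP; exact: measurable_mehler.
  - by move=> y _; apply: mule_ge0; rewrite ?lee_fin ?mehler_ge0//; exact: ouT_ge0.
  - by rewrite lee_fin levy_ge0.
  have [r0|r0] := leP r 0%R; first by rewrite (levy_le0 _ r0) !mul0e.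
  congr (_ * _); rewrite [(r + s)%R]addrC -ouT_semigroup//.
rewrite (tonelli sleb sleb (f := fun w : measurableTypeR R * measurableTypeR R =>
   (levy a w.1)%:E * ((levy b (w.2 - w.1))%:E * ouT w.2 h x))) /=; last 2 first.
- apply: emeasurable_funM.
    by apply/measurable_EFinP; apply: (measurableT_comp (measurable_levy a)).
  apply: emeasurable_funM; last exact: measurable_ouT.
  apply/measurable_EFinP; apply: (measurableT_comp (measurable_levy b)).
  exact: measurable_funB.
- move=> w; apply: mule_ge0; first by rewrite lee_fin levy_ge0.
  by apply: mule_ge0; [rewrite lee_fin levy_ge0|exact: ouT_ge0].
apply: eq_integral => r _; under eq_integral do rewrite muleA.
rewrite ge0_integralZr//; last 3 first.
- apply: emeasurable_funM; apply/measurable_EFinP; first exact: measurable_levy.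
  by apply: (measurableT_comp (measurable_levy b)); exact: measurable_funB.
- by move=> s _; apply: mule_ge0; rewrite lee_fin levy_ge0.
- exact: ouT_ge0.
by rewrite levy_convolution.
Qed.

End semigroup_operators.

(** * Variable-exponent bounds for the semigroups *)

Section kernel_estimate.
Context {R : realType} {d : nat}.
Implicit Types (x y : Rvec R d) (s g Z : R).

Lemma dotv_quad_ge0 (a b : R) x y :
  0 <= a ^+ 2 * dotv x x + 2 * a * b * dotv x y + b ^+ 2 * dotv y y.
Proof.
rewrite /dotv !mulr_sumr -!big_split/=; apply: sumr_ge0 => i _.
rewrite (_ : _ + _ = (a * tnth x i + b * tnth y i) ^+ 2) ?sqr_ge0//; ring.
Qed.

Lemma dotv_subv x y :
  dotv (subv x y) (subv x y) = dotv x x - 2 * dotv x y + dotv y y.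
Proof.
rewrite /dotv mulr_sumr -sumrB -big_split/=; apply: eq_bigr => i _.
by rewrite /subv !tnth_mktuple; ring.
Qed.

(** The kernel has prefactor Z^d and Gaussian width 1/Z for this number Z; short times correspond to
    large Z. *)
Definition mehler_scale s : R := (Num.sqrt (1 - expR (- s) ^+ 2))^-1.

Lemma mehler_scale_ge1 s : 0 < s -> 1 <= mehler_scale s.
Proof.
move=> /expRN_lt1 c01; have v0 := onem_sqr_gt0 c01.
rewrite /mehler_scale invf_ge1 ?sqrtr_gt0// -[leRHS]sqrtr1 ler_sqrt// gerBl sqr_ge0//.
Qed.

Lemma mehler_scale_sqr s : 0 < s -> mehler_scale s ^+ 2 * (1 - expR (- s) ^+ 2) = 1.
Proof.
move=> /expRN_lt1 c01; have v0 := onem_sqr_gt0 c01.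
by rewrite /mehler_scale exprVn sqr_sqrtr ?ltW// mulVf// gt_eqF.
Qed.

(** The square completed here is |y - e^{-s} x|^2, which leaves the growth e^{|y|^2}. Its mirror
    image [mehler_sqr_r] completes |x - e^{-s} y|^2 and leaves e^{|x|^2}. Each form is effective in
    a different region. *)
Lemma mehler_sqr_l s x y : 0 < s -> mehler s x y = mehler_scale s ^+ d *
  expR (dotv y y - (dotv y y - 2 * expR (- s) * dotv x y + expR (- s) ^+ 2 * dotv x x) *
    mehler_scale s ^+ 2).
Proof.
move=> s0; have v0 := onem_sqr_gt0 (expRN_lt1 s0).
rewrite /mehler expRN2 powR_half_dim// -/(mehler_scale s); congr (_ * expR _).
rewrite !normv_sqr (_ : mehler_scale s ^+ 2 = (1 - expR (- s) ^+ 2)^-1); last first.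
  by rewrite /mehler_scale exprVn sqr_sqrtr ?ltW.
by field; rewrite gt_eqF.
Qed.

Lemma mehler_sqr_r s x y : 0 < s -> mehler s x y = mehler_scale s ^+ d *
  expR (dotv x x - (dotv x x - 2 * expR (- s) * dotv x y + expR (- s) ^+ 2 * dotv y y) *
    mehler_scale s ^+ 2).
Proof. by move=> s0; rewrite mehlerC mehler_sqr_l// (dotvC y x). Qed.

Lemma mehler_le s x y : 0 < s -> mehler s x y <= mehler_scale s ^+ d * expR (dotv x x).
Proof.
move=> s0; have Z1 := mehler_scale_ge1 s0.
rewrite mehler_sqr_r// ler_pM2l ?exprn_gt0// ?(lt_le_trans ltr01)// ler_expR.
rewrite gerBl mulr_ge0 ?sqr_ge0//.
by have := dotv_quad_ge0 1 (- expR (- s)) x y; lra.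
Qed.

Lemma exprn_le_expR (m : nat) (c : R) : 0 < c ->
  exists2 C, 0 < C & forall Z, 0 <= Z -> Z ^+ m <= C * expR (c * Z).
Proof.
move=> c0; have [C C0 HC] := ler_horner_expR 'X^(2 * m) c0.
exists (C + 1); first by rewrite ltr_wpDl.
move=> Z Z0; have := HC (Num.sqrt Z) (sqrtr_ge0 _).
rewrite hornerXn exprM sqr_sqrtr// ger0_norm ?exprn_ge0// => /le_trans; apply.
by rewrite ler_pM2r ?expR_gt0// lerDl.
Qed.

Section exponent.
Variables (p : Rvec R d -> R) (C1 Cg pinf P : R).
Hypotheses (p1 : forall x, 1 <= p x) (pP : forall x, p x <= P).
Hypotheses (C10 : 0 < C1) (Cg0 : 0 < Cg).
Hypothesis pLH : forall x y, `|p x - p y| <= C1 / ln (expR 1 + (normv (subv x y))^-1).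
Hypothesis pinfP : forall x, x <> zerov -> `|p x - pinf| <= Cg / normv x ^+ 2.

Let ln_e (u : R) : 0 <= u -> 1 <= ln (expR 1 + u).
Proof.
move=> u0; rewrite -[leLHS](expRK (1 : R)) ler_ln ?posrE ?lerDl// ?expR_gt0//.
by rewrite ltr_wpDr ?expR_gt0.
Qed.

(** The logarithm in the denominator is at least ln e = 1. In particular p(.) is bounded. *)
Lemma exponent_osc x y : `|p x - p y| <= C1.
Proof.
have n0 : 0 <= (normv (subv x y))^-1 by rewrite invr_ge0 sqrtr_ge0.
have l1 := ln_e n0; apply: le_trans (pLH x y) _.
by rewrite ler_pdivrMr ?(lt_le_trans ltr01)// ler_peMr// ltW.
Qed.

(** When |x - y|^2 <= 1/Z, the logarithm in the Hoelder bound is at least (ln Z) / 2. *)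
Let exponent_near x y Z : 2 <= Z -> dotv (subv x y) (subv x y) <= Z^-1 ->
  `|p x - p y| * ln Z <= 2 * C1.
Proof.
move=> Z2 xyZ; have Z0 : 0 < Z by rewrite (lt_le_trans _ Z2).
have lnZ0 : 0 < ln Z by rewrite ln_gt0// (lt_le_trans _ Z2)// ltr1n.
have [n0|n0] := eqVneq (normv (subv x y)) 0.
  have : dotv (subv x y) (subv x y) = 0 by rewrite -normv_sqr n0 expr0n.
  move=> /eqP; rewrite psumr_eq0 => [/allP h|i _]; last by rewrite -expr2 sqr_ge0.
  have -> : x = y.
    apply: eq_from_tnth => i; have := h i; rewrite mem_index_enum => /(_ isT).
    by rewrite mulf_eq0 orbb /subv tnth_mktuple subr_eq0 => /eqP.
  by rewrite subrr normr0 mul0r mulr_ge0// ltW.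
have npos : 0 < normv (subv x y) by rewrite lt_def n0 sqrtr_ge0.
have ub : ln Z / 2 <= ln (expR 1 + (normv (subv x y))^-1).
  rewrite ler_pdivrMr// mulrC mulr_natl -lnXn; last first.
    by rewrite ltr_wpDr ?expR_gt0// invr_ge0 ltW.
  have n1 : 0 < expR 1 + (normv (subv x y))^-1.
    by rewrite ltr_wpDr ?expR_gt0// invr_ge0 ltW.
  rewrite ler_ln ?posrE ?exprn_gt0//.
  apply: (@le_trans _ _ ((normv (subv x y))^-1 ^+ 2)).
    rewrite exprVn -[leLHS]invrK lef_pV2 ?posrE ?invr_gt0 ?exprn_gt0//.
    by rewrite normv_sqr.
  by rewrite ler_sqr ?nnegrE ?(ltW n1) ?invr_ge0 ?(ltW npos)// lerDr expR_ge0.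
have l0 : 0 < ln Z / 2 by rewrite divr_gt0.
have l1 := lt_le_trans l0 ub.
have := pLH x y; rewrite ler_pdivlMr// => h.
have : `|p x - p y| * (ln Z / 2) <= C1.
  by apply: le_trans h; rewrite ler_wpM2l.
by rewrite mulrA ler_pdivrMr// mulrC [X in _ <= X -> _]mulrC.
Qed.

(** When |y|^2 < e2 |x|^2, the growth e^{|y|^2} stays within the admissible error exp(|x|^2 /
    (8P)). *)
Let e2 := (8 * P)^-1.
Let P1 : 1 <= P. Proof. exact: le_trans (p1 zerov) (pP zerov). Qed.
Let P0 : 0 < P. Proof. exact: lt_le_trans P1. Qed.
Let e20 : 0 < e2. Proof. by rewrite invr_gt0 mulr_gt0. Qed.
Let e28 : e2 <= 8^-1.
Proof. by rewrite lef_pV2 ?posrE ?mulr_gt0// ler_peMr. Qed.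

Let dotv_gt0_neq x : 0 < dotv x x -> x <> zerov.
Proof.
move=> x0 xz; move: x0; rewrite xz /dotv big1 ?ltxx// => i _.
by rewrite /zerov tnth_mktuple mulr0.
Qed.

Let C2 := C1 + Cg * (1 + 8 * P).

(** For |x| < 1 the oscillation bound [C1] suffices. Otherwise both exponents are compared with
    [pinf], and trading |y|^2 for |x|^2 costs 1 / e2 = 8P. *)
Let exponent_far x y : dotv x x < 1 \/ e2 * dotv x x <= dotv y y ->
  dotv x x * `|p x - p y| <= C2.
Proof.
have X0 := dotvv_ge0 x; move=> H.
have [X1|X1] := ltP (dotv x x) 1.
  apply: (@le_trans _ _ C1); last first.
    by rewrite lerDl mulr_ge0 ?ltW// addr_gt0// mulr_gt0.
  apply: (@le_trans _ _ (1 * `|p x - p y|)); last by rewrite mul1r exponent_osc.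
  by rewrite ler_wpM2r// ltW.
have {}H : e2 * dotv x x <= dotv y y by case: H => // /lt_le_trans/(_ X1); rewrite ltxx.
have Xp : 0 < dotv x x by exact: lt_le_trans X1.
have Yp : 0 < dotv y y by rewrite (lt_le_trans _ H)// mulr_gt0.
have hx := pinfP (dotv_gt0_neq Xp); have hy := pinfP (dotv_gt0_neq Yp).
rewrite normv_sqr ler_pdivlMr// in hx; rewrite normv_sqr ler_pdivlMr// in hy.
have tri : `|p x - p y| <= `|p x - pinf| + `|p y - pinf|.
  by rewrite (distrC (p y)) -[in leLHS](subrKA pinf) ler_normD.
have hy' : `|p y - pinf| * dotv x x <= Cg * (8 * P).
  rewrite -(ler_pM2l e20) (_ : e2 * (Cg * (8 * P)) = Cg); last first.
    by rewrite mulrC -mulrA mulfV ?mulr1// gt_eqF// mulr_gt0.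
  by apply: le_trans hy; rewrite mulrCA ler_wpM2l.
rewrite mulrC; apply: (@le_trans _ _ ((`|p x - pinf| + `|p y - pinf|) * dotv x x)).
  by rewrite ler_wpM2r.
rewrite mulrDl /C2 mulrDr mulr1; have := lerD hx hy'; move=> /le_trans; apply.
by rewrite lerDr ltW.
Qed.

Let C3 := 2 * C1 + C2.

(* Near the diagonal, and where |x|^2 |p x - p y| stays bounded, log-Hoelder
   continuity bounds exp (g (p x - p y)); everywhere else the kernel itself is small. *)
Lemma mehler_exponent_change : exists2 C, 0 < C & forall s x y g, 0 < s -> 0 <= g ->
  g <= 1 + d%:R * ln (mehler_scale s) + dotv x x ->
  mehler s x y * expR (g * (1 - p y)) <=
  C * (mehler s x y * expR (g * (1 - p x)) + expR (dotv x x / (8 * P))).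
Proof.
have C20 : 0 < C2 by rewrite addr_gt0// mulr_gt0// addr_gt0// mulr_gt0.
have [CA CA0 HA] := exprn_le_expR d (ltac:(lra) : 0 < 8^-1 :> R).
have [CB CB0 HB] := exprn_le_expR (d + 2) (ltac:(lra) : 0 < 4^-1 :> R).
(* The summands bound |p x - p y| times the three terms 1, d ln Z and |x|^2 of the upper bound on
   [g]. *)
pose K := expR (C1 + d%:R * C3 + C2).
have K0 : 0 < K by exact: expR_gt0.
have d2 : 0 <= 2 ^+ d :> R by rewrite exprn_ge0.
exists (2 ^+ d + CA + CB + K).
  by rewrite ltr_wpDl ?expR_gt0// !addr_ge0 ?exprn_ge0// ltW.
move=> s x y g s0 g0 gle.
set M := mehler s x y; have M0 : 0 <= M by exact: mehler_ge0.
have MG : M * expR (g * (1 - p y)) <= M.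
  rewrite ler_piMr// -[leRHS]expR0 ler_expR mulr_ge0_le0// subr_le0//.
have Ex1 : 1 <= expR (dotv x x / (8 * P)).
  by rewrite -[leLHS]expR0 ler_expR divr_ge0 ?dotvv_ge0// mulr_ge0// ltW.
(* As g (1 - p y) <= 0, it is enough in the bad regions to bound the kernel itself by the error
   term. *)
have small c : c <= 2 ^+ d + CA + CB + K -> M <= c * expR (dotv x x / (8 * P)) ->
    M * expR (g * (1 - p y)) <= (2 ^+ d + CA + CB + K) *
      (M * expR (g * (1 - p x)) + expR (dotv x x / (8 * P))).
  move=> cC Mc; apply: (le_trans MG); apply: (le_trans Mc).
  have pos : 0 <= 2 ^+ d + CA + CB + K.
    by rewrite !addr_ge0 ?exprn_ge0 ?expR_ge0// ltW.
  rewrite mulrDr; apply: ler_wpDl; first by apply: mulr_ge0 => //; apply: mulr_ge0; rewrite ?expR_ge0.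
  by rewrite ler_wpM2r// expR_ge0.
have Z1 := mehler_scale_ge1 s0; have ZZ := mehler_scale_sqr s0.
have /andP[c0 c1] := expRN_lt1 s0.
have Mr := mehler_sqr_r x y s0; have Ml := mehler_sqr_l x y s0.
rewrite -/M in Mr Ml.
move: (mehler_scale s) (expR (- s)) gle Z1 ZZ c0 c1 Mr Ml => Z c gle Z1 ZZ c0 c1 Mr Ml.
have Z0 : 0 < Z by exact: lt_le_trans Z1.
have lnZ0 : 0 <= ln Z by exact: ln_ge0.
have X0 := dotvv_ge0 x; have Y0 := dotvv_ge0 y.
have c2 : 2 <= Z -> 3 / 4 <= c ^+ 2 by move=> Z2; nra.
(* First region: |x| >= 1 and |y|^2 < e2 |x|^2. For Z < 2 the kernel is at most 2^d e^{|y|^2}. For Z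
   >= 2 the square |y - c x|^2 is at least 1/4, and the resulting exponential decay in Z absorbs
   Z^d. *)
have [] := pselect (dotv x x < 1 \/ e2 * dotv x x <= dotv y y); last first.
  move=> /not_orP[/negP + /negP]; rewrite -leNgt -ltNge => X1 Ylt.
  have [Z2|Z2] := ltP Z 2.
    apply: (small (2 ^+ d)).
      by rewrite -!addrA lerDl !addr_ge0 ?expR_ge0// ltW.
    rewrite Ml; apply: ler_pM; [exact: exprn_ge0 (ltW Z0)|exact: expR_ge0| |].
      by rewrite lerXn2r ?nnegrE ?(ltW Z0)// ltW.
    rewrite ler_expR.
    have q := dotv_quad_ge0 (- c) 1 x y.
    apply: (@le_trans _ _ (dotv y y)); last by rewrite mulrC ltW.
    by rewrite gerBl mulr_ge0 ?sqr_ge0//; lra.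
  apply: (small CA).
    by rewrite -!addrA addrCA lerDl !addr_ge0 ?exprn_ge0 ?expR_ge0// ltW.
  rewrite Ml; apply: (@le_trans _ _ (Z ^+ d * expR (dotv x x / (8 * P) - 8^-1 * Z))).
    rewrite ler_pM2l ?exprn_gt0// ler_expR.
    (* From |2y - c x|^2 >= 0 follows |y - c x|^2 >= c^2 |x|^2 / 2 - |y|^2 >= (3/8 - 1/8) |x|^2. *)
    have q := dotv_quad_ge0 (- c) 2 x y.
    have Y8 : dotv y y <= 8^-1 * dotv x x.
      by apply: (le_trans (ltW Ylt)); rewrite ler_wpM2r.
    have cX : 3 / 4 * dotv x x <= c ^+ 2 * dotv x x by rewrite ler_wpM2r// c2.
    have h : 4^-1 <= dotv y y - 2 * c * dotv x y + c ^+ 2 * dotv x x by lra.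
    have ZZ2 : Z <= Z ^+ 2 by rewrite expr2 ler_peMr// ltW.
    rewrite [dotv x x / _]mulrC -/e2.
    set W := dotv y y - 2 * c * dotv x y + c ^+ 2 * dotv x x in h *.
    have : 4^-1 * Z ^+ 2 <= W * Z ^+ 2 by rewrite ler_wpM2r ?sqr_ge0.
    by move: Ylt ZZ2 Z0; lra.
  rewrite expRD mulrCA [leRHS]mulrC ler_wpM2l ?expR_ge0//.
  by rewrite expRN ler_pdivrMr ?expR_gt0// HA// ltW.
move=> /exponent_far XD.
have D0 : 0 <= `|p x - p y| by [].
have [DZ|DZ] := leP (`|p x - p y| * ln Z) C3.
  apply: (@le_trans _ _ (K * (M * expR (g * (1 - p x))))).
    rewrite (_ : g * (1 - p y) = g * (1 - p x) + g * (p x - p y)); last by ring.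
    rewrite expRD mulrA [leRHS]mulrC; apply: ler_wpM2l.
      by apply: mulr_ge0; rewrite ?expR_ge0.
    rewrite ler_expR.
    apply: (@le_trans _ _ (g * `|p x - p y|)); first by rewrite ler_wpM2l// ler_norm.
    apply: (@le_trans _ _ ((1 + d%:R * ln Z + dotv x x) * `|p x - p y|)).
      by rewrite ler_wpM2r.
    rewrite !mulrDl mul1r !lerD ?exponent_osc//.
    by rewrite -mulrA ler_wpM2l// mulrC.
  apply: ler_pM; [exact: expR_ge0|by apply: mulr_ge0; rewrite ?expR_ge0| |].
    by rewrite lerDr !addr_ge0 ?exprn_ge0// ltW.
  by rewrite lerDl expR_ge0.
(* What remains is |p x - p y| ln Z > C3. As C3 = 2 C1 + C2, this excludes in turn ln Z <= 1, |x -
   y|^2 <= 1/Z and |x|^2 > ln Z; the kernel is then bounded by a constant. *)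
have osc := exponent_osc x y.
have lnZ2 : 1 < ln Z.
  rewrite ltNge; apply/negP => l1.
  have : `|p x - p y| * ln Z <= C1 * 1 by rewrite ler_pM.
  by move: DZ; rewrite /C3; move: C10 C20; lra.
have Z2 : 2 <= Z.
  have e1 := expR_ge1Dx (1 : R).
  have : expR 1 <= Z by rewrite -[leRHS]lnK ?posrE// ler_expR ltW.
  lra.
have far : Z^-1 < dotv (subv x y) (subv x y).
  rewrite ltNge; apply/negP => /(exponent_near Z2).
  by move: DZ; rewrite /C3; move: C20; lra.
have XZ : dotv x x <= ln Z.
  rewrite leNgt; apply/negP => XZ.
  have : `|p x - p y| * ln Z <= `|p x - p y| * dotv x x by rewrite ler_wpM2l// ltW.
  by move: DZ XD; rewrite /C3 mulrC; move: C10; lra.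
apply: (small CB).
  by move: K0 d2 CA0 CB0; lra.
apply: (@le_trans _ _ CB); last by rewrite ler_peMr// ltW.
(* The factor e^{|x|^2} and the loss (1 - c)^2 |x|^2 Z^2 <= |x|^2 each cost at most ln Z in the
   exponent, hence the power d + 2 in [CB]. *)
rewrite Mr; apply: (@le_trans _ _ (Z ^+ d * expR (2 * ln Z - 4^-1 * Z))); last first.
  rewrite expRD mulrA (_ : expR (2 * ln Z) = Z ^+ 2); last by rewrite expRM_natl lnK.
  by rewrite -exprD expRN ler_pdivrMr ?expR_gt0// HB// ltW.
rewrite ler_pM2l ?exprn_gt0// ler_expR.
move: far; rewrite dotv_subv => far.
have q := dotv_quad_ge0 (2 - c) (- c) x y.
have c34 := c2 Z2.
set X := dotv x x in q far XZ X0 *; set Y := dotv y y in q far *; set S := dotv x y in q far *.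
(* Here x - c y = c (x - y) + (1 - c) x, and |u + v|^2 >= |u|^2 / 2 - |v|^2. *)
have h1 : c ^+ 2 / 2 * (X - 2 * S + Y) - (1 - c) ^+ 2 * X <= X - 2 * c * S + c ^+ 2 * Y by lra.
have h2 : (1 - c) ^+ 2 * Z ^+ 2 <= 1.
  rewrite mulrC; apply: (@le_trans _ _ (Z ^+ 2 * (1 - c ^+ 2))); last by rewrite ZZ.
  rewrite ler_wpM2l ?sqr_ge0//.
  have cc : 0 <= c * (1 - c) by rewrite mulr_ge0 ?subr_ge0 ?(ltW c0) ?(ltW c1).
  by move: cc; lra.
have h3 : 4^-1 * Z <= c ^+ 2 / 2 * (X - 2 * S + Y) * Z ^+ 2.
  have f1 : 1 <= (X - 2 * S + Y) * Z by rewrite -ler_pdivrMr// div1r ltW.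
  have f2 : Z <= (X - 2 * S + Y) * Z * Z by rewrite ler_peMl// ltW.
  rewrite (_ : c ^+ 2 / 2 * (X - 2 * S + Y) * Z ^+ 2 = c ^+ 2 / 2 * ((X - 2 * S + Y) * Z * Z)); last by ring.
  apply: (@le_trans _ _ (c ^+ 2 / 2 * Z)).
    by apply: ler_wpM2r; [exact: ltW|lra].
  by apply: ler_wpM2l => //; rewrite divr_ge0 ?sqr_ge0.
have h4 : (1 - c) ^+ 2 * X * Z ^+ 2 <= X.
  by rewrite mulrAC ler_piMl.
have h5 := ler_wpM2r (sqr_ge0 Z) h1.
lra.
Qed.

End exponent.
End kernel_estimate.

Section powers.
Context {R : realType}.

(** If h > e^g, then h = h^q h^(1 - q) <= h^q e^{g (1 - q)}, because 1 - q <= 0. *)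
Lemma powR_young (h g q : R) : 0 <= h -> 1 <= q ->
  h <= expR g + h `^ q * expR (g * (1 - q)).
Proof.
move=> h0 q1; have [hg|gh] := leP h (expR g).
  by rewrite (le_trans hg)// lerDl mulr_ge0 ?powR_ge0 ?expR_ge0.
have hp : 0 < h by rewrite (lt_trans _ gh)// expR_gt0.
apply: (@le_trans _ _ (h `^ q * expR (g * (1 - q)))); last by rewrite lerDr expR_ge0.
rewrite /powR gt_eqF// -expRD -[leLHS]lnK ?posrE// ler_expR.
have lg : g <= ln h by rewrite -[leLHS]expRK ler_ln ?posrE ?expR_gt0// ltW.
nra.
Qed.

Lemma poweR_young (h : \bar R) (g q : R) : (0 <= h)%E -> 1 <= q ->
  (h <= (expR g)%:E + h `^ q * (expR (g * (1 - q)))%:E)%E.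
Proof.
case: h => [h|_ q1|//]; last first.
  rewrite poweRyr ?gt_eqF ?(lt_le_trans ltr01)//.
  by rewrite gt0_mulye ?lte_fin ?expR_gt0// addey.
by rewrite lee_fin => h0 q1; rewrite poweR_EFin -EFinM -EFinD lee_fin powR_young.
Qed.

Lemma le_poweR (a b : \bar R) (q : R) : 0 <= q -> (0 <= a)%E -> (a <= b)%E ->
  (a `^ q <= b `^ q)%E.
Proof.
move=> q0 a0 ab; apply: gt0_ler_poweR => //; rewrite in_itv/= leey andbT//.
exact: le_trans ab.
Qed.

Lemma powR_addr_le (a b q : R) : 0 <= a -> 0 <= b -> 0 <= q ->
  (a + b) `^ q <= 2 `^ q * (a `^ q + b `^ q).
Proof.
move=> a0 b0 q0; wlog ab : a b a0 b0 / a <= b.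
  by move=> H; have [/H|/ltW/H] := leP a b; [|rewrite addrC [X in _ * X]addrC]; exact.
apply: (@le_trans _ _ ((2 * b) `^ q)).
  by rewrite ge0_ler_powR ?nnegrE ?addr_ge0 ?mulr_ge0//; lra.
by rewrite powRM// ler_wpM2l ?powR_ge0// lerDr powR_ge0.
Qed.

(** The choice e^g = (1 + b)^(1/q) balances the two terms of Young's inequality when [b] is the
    average of h^q; the 1 keeps g >= 0. *)
Lemma expR_ln_div (b q : R) : 0 <= b -> 1 <= q ->
  let g := ln (1 + b) / q in
  [/\ 0 <= g, expR (g * q) = 1 + b & expR (g * (1 - q)) * (1 + b) = expR g].
Proof.
move=> b0 q1 g; have q0 : 0 < q by rewrite (lt_le_trans ltr01).
have E : expR (g * q) = 1 + b.
  by rewrite /g divfK ?gt_eqF// lnK// posrE ltr_pwDl.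
split => //; first by rewrite divr_ge0 ?ln_ge0 ?lerDl// ltW.
by rewrite -E -expRD; congr expR; ring.
Qed.

End powers.

(** * Pointwise modular bound for the Ornstein-Uhlenbeck semigroup *)

Section boundedness.
Context {R : realType} {d : nat}.
Variables (p : Rvec R d -> R) (P CK : R).
Hypotheses (mp : measurable_fun setT p) (p1 : forall x, 1 <= p x) (pP : forall x, p x <= P).
Hypothesis CK0 : 0 < CK.
Hypothesis HK : forall s x y g, 0 < s -> 0 <= g ->
  g <= 1 + d%:R * ln (mehler_scale s) + dotv x x ->
  mehler s x y * expR (g * (1 - p y)) <=
  CK * (mehler s x y * expR (g * (1 - p x)) + expR (dotv x x / (8 * P))).
Local Notation gam := (@gauss_measure R d).
Local Notation leb := (@lebesgue_measure R).

Let P1 : 1 <= P. Proof. exact: le_trans (p1 zerov) (pP zerov). Qed.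
Let P0 : 0 < P. Proof. exact: lt_le_trans P1. Qed.
Let p0 x : 0 < p x. Proof. exact: lt_le_trans (p1 x). Qed.

Section pointwise.
Variable h : Rvec R d -> R.
Hypotheses (mh : measurable_fun setT h) (h0 : forall x, 0 <= h x).
Let hp (y : Rvec R d) : \bar R := (h y `^ p y)%:E.
Hypothesis h1 : (\int[gam]_y hp y <= 1)%E.

Let hp0 y : (0 <= hp y)%E. Proof. by rewrite lee_fin powR_ge0. Qed.
Let mhp : measurable_fun setT hp.
Proof. by apply/measurable_EFinP; exact: measurable_fun_powR2. Qed.
Let mEh : measurable_fun setT (EFin \o h). Proof. exact/measurable_EFinP. Qed.

Definition bound_const : R := (2 * (1 + CK)) `^ P * 2 `^ P.

(* With G = (1 + ouT s (h `^ p) x)^(1 / p x), Young's inequality h <= G + h^(p y) G^(1 - p y)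
   moves the exponent p y from h onto the number G, where HK replaces it by p x. *)
Lemma ouT_poweR_le s x : 0 < s ->
  (ouT s (EFin \o h) x `^ p x <=
   bound_const%:E * (1 + ouT s hp x + (expR (dotv x x / 8))%:E))%E.
Proof.
move=> s0; set Z := mehler_scale s; have Z1 : 1 <= Z := mehler_scale_ge1 s0.
have Z0 : 0 < Z by exact: lt_le_trans Z1.
set u := Z ^+ d * expR (dotv x x).
have u1 : 1 <= u.
  rewrite -[leLHS]mulr1 ler_pM// ?exprn_ege1//.
  by rewrite -[leLHS]expR0 ler_expR dotvv_ge0.
have Bu : (ouT s hp x <= u%:E)%E.
  apply: (@le_trans _ _ (\int[gam]_y (u%:E * hp y))%E).
    apply: ge0_le_integral => //.
    - by move=> y _; apply: mule_ge0; rewrite ?lee_fin ?mehler_ge0 ?powR_ge0.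
    - exact: measurable_mehlerM.
    - by apply: emeasurable_funM.
    - by move=> y _; apply: lee_wpmul2r => //; rewrite lee_fin mehler_le.
  rewrite ge0_integralZl//; last by rewrite lee_fin (le_trans ler01).
  by rewrite -[leRHS]mule1 lee_wpmul2l// lee_fin (le_trans ler01).
have B0 : (0 <= ouT s hp x)%E by exact: ouT_ge0.
have [b bE] : exists b, ouT s hp x = b%:E.
  by exists (fine (ouT s hp x)); rewrite fineK// ge0_fin_numE// (le_lt_trans Bu) ?ltry.
rewrite bE !lee_fin in B0 Bu *.
have := expR_ln_div B0 (p1 x); set g := _ / p x => -[g0 gp g1p].
(* The size restriction of [HK] holds because 1 + b <= 1 + u <= e u, and ln(e u) = 1 + d ln Z +
   |x|^2. *)
have gle : g <= 1 + d%:R * ln Z + dotv x x.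
  apply: (@le_trans _ _ (ln (1 + b))).
    by rewrite ler_pdivrMr// ler_peMr// ln_ge0// lerDl.
  rewrite -[leRHS]expRK ler_ln ?posrE ?expR_gt0 ?ltr_pwDl//.
  rewrite !expRD expRM_natl lnK ?posrE// -mulrA -/u.
  have e1 := expR_ge1Dx (1 : R); have : 2 * u <= expR 1 * u.
    by rewrite ler_wpM2r ?(le_trans ler01)//; lra.
  by move: Bu u1; lra.
set E := expR (dotv x x / (8 * P)).
have E0 : 0 < E by exact: expR_gt0.
have pt y : mehler s x y * h y <= expR g * mehler s x y +
    CK * expR (g * (1 - p x)) * (mehler s x y * h y `^ p y) + CK * E * h y `^ p y.
  have M0 : 0 <= mehler s x y := mehler_ge0 s x y.
  have := powR_young g (h0 y) (p1 y); have hpy : 0 <= h y `^ p y := powR_ge0 _ _.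
  have := HK y s0 g0 gle; rewrite -/E.
  move=> /(ler_wpM2r hpy) a1 /(ler_wpM2l M0) a2.
  move: a1 a2; set A := expR (g * (1 - p y)); set A' := expR (g * (1 - p x)).
  set M := mehler s x y; set H := h y `^ p y; set G := expR g; lra.
have T1 : (ouT s (EFin \o h) x <= ((1 + CK) * (expR g + E))%:E)%E.
  pose F1 y := (mehler s x y)%:E.
  pose F2 y := (F1 y * hp y)%E.
  have F10 y : (0 <= F1 y)%E by rewrite lee_fin mehler_ge0.
  have F20 y : (0 <= F2 y)%E by exact: mule_ge0.
  have mF1 : measurable_fun setT F1 by apply/measurable_EFinP; exact: measurable_mehler.
  have mF2 : measurable_fun setT F2 by exact: emeasurable_funM.
  have k1 : 0 <= expR g by exact: expR_ge0.
  have k2 : 0 <= CK * expR (g * (1 - p x)) by rewrite mulr_ge0 ?expR_ge0// ltW.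
  have k3 : 0 <= CK * E by rewrite mulr_ge0// ltW.
  have mk (k : R) F : measurable_fun setT F -> measurable_fun setT (fun y : Rvec R d => (k%:E * F y)%E).
    by move=> mF; exact: emeasurable_funM.
  apply: (@le_trans _ _ (\int[gam]_y ((expR g)%:E * F1 y +
     (CK * expR (g * (1 - p x)))%:E * F2 y + (CK * E)%:E * hp y))%E).
    apply: ge0_le_integral => //.
    - by move=> y _; apply: mule_ge0; rewrite ?lee_fin ?mehler_ge0//=.
    - exact: measurable_mehlerM.
    - by apply: emeasurable_funD; [apply: emeasurable_funD|]; exact: mk.
    - by move=> y _; rewrite /F2 /F1 /hp -!EFinM -!EFinD lee_fin.
  rewrite ge0_integralD//; first last.
  - exact: mk.
  - by move=> y _; apply: mule_ge0.
  - by apply: emeasurable_funD; exact: mk.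
  - by move=> y _; apply: adde_ge0; apply: mule_ge0.
  rewrite ge0_integralD//; first last.
  - exact: mk.
  - by move=> y _; apply: mule_ge0.
  - exact: mk.
  - by move=> y _; apply: mule_ge0.
  rewrite !ge0_integralZl_EFin//.
  rewrite integral_mehler// mule1 -/(ouT s hp x) bE.
  apply: (@le_trans _ _ ((expR g)%:E + (CK * expR (g * (1 - p x)))%:E * b%:E + (CK * E)%:E * 1)%E).
    by rewrite leeD2l// lee_wpmul2l// lee_fin mulr_ge0// ltW.
  rewrite mule1 -EFinM -!EFinD lee_fin.
  have : CK * expR (g * (1 - p x)) * b <= CK * expR g.
    rewrite -mulrA ler_pM2l// -g1p ler_pM2l ?expR_gt0//; lra.
  by move: E0 (expR_ge0 g) CK0; nra.
have r0 : 0 <= (1 + CK) * (expR g + E).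
  by rewrite mulr_ge0 ?addr_ge0 ?expR_ge0// ltW.
apply: (@le_trans _ _ (((1 + CK) * (expR g + E))%:E `^ p x)%E).
  by apply: le_poweR T1; [exact: ltW|exact: ouT_ge0].
rewrite poweR_EFin -!EFinD -EFinM lee_fin.
have c1 : 1 <= 2 * (1 + CK) by move: CK0; lra.
have pe (a : R) : 1 <= a -> a `^ p x <= a `^ P by move=> a1; exact: ler_powR.
rewrite powRM ?addr_ge0 ?expR_ge0 ?(ltW E0) ?(ltW CK0)//.
apply: (@le_trans _ _ ((1 + CK) `^ P * (2 `^ P * (expR g `^ p x + E `^ p x)))).
  apply: ler_pM; rewrite ?powR_ge0//.
    by apply: pe; move: CK0; lra.
  apply: (le_trans (powR_addr_le _ _ _)); rewrite ?expR_ge0 ?(ltW (p0 x))//.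
  by rewrite ler_wpM2r ?addr_ge0 ?powR_ge0// pe// ler1n.
rewrite mulrA /bound_const.
apply: ler_pM; rewrite ?mulr_ge0 ?addr_ge0 ?powR_ge0//.
  rewrite ler_wpM2r ?powR_ge0// ge0_ler_powR ?nnegrE ?(ltW P0)//; move: CK0; lra.
have -> : expR g `^ p x = 1 + b by rewrite -gp /powR gt_eqF ?expR_gt0// expRK mulrC.
rewrite lerD2l /E /powR gt_eqF ?expR_gt0// expRK ler_expR.
(* Since p x <= P, the error exp(|x|^2 / (8P)) raised to the power p x stays below exp(|x|^2 /
   8). *)
rewrite (_ : p x * _ = dotv x x / 8 * (p x / P)); last by field; rewrite gt_eqF.
by rewrite ler_piMr ?divr_ge0 ?dotvv_ge0// ler_pdivrMr// mul1r.
Qed.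

End pointwise.
End boundedness.

(** * Modular and norm bounds for the Poisson-Hermite semigroup *)

Section poisson_boundedness.
Context {R : realType} {d : nat}.
Variables (p : Rvec R d -> R) (P B : R).
Hypotheses (mp : measurable_fun setT p) (p1 : forall x, 1 <= p x) (pP : forall x, p x <= P).
Hypothesis B0 : 0 < B.
Local Notation gam := (@gauss_measure R d).
Local Notation leb := (@lebesgue_measure R).
Hypothesis HB : forall h : Rvec R d -> R, measurable_fun setT h -> (forall x, 0 <= h x) ->
  (\int[gam]_y (h y `^ p y)%:E <= 1)%E -> forall s x, 0 < s ->
  (ouT s (EFin \o h) x `^ p x <=
   B%:E * (1 + ouT s (fun y => (h y `^ p y)%:E) x + (expR (dotv x x / 8))%:E))%E.

Let P1 : 1 <= P. Proof. exact: le_trans (p1 zerov) (pP zerov). Qed.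
Let P0 : 0 < P. Proof. exact: lt_le_trans P1. Qed.
Let p0 x : 0 < p x. Proof. exact: lt_le_trans (p1 x). Qed.

Section pointwise.
Variable h : Rvec R d -> R.
Hypotheses (mh : measurable_fun setT h) (h0 : forall x, 0 <= h x).
Let hp (y : Rvec R d) : \bar R := (h y `^ p y)%:E.
Hypothesis h1 : (\int[gam]_y hp y <= 1)%E.

Let hp0 y : (0 <= hp y)%E. Proof. by rewrite lee_fin powR_ge0. Qed.
Let mhp : measurable_fun setT hp.
Proof. by apply/measurable_EFinP; exact: measurable_fun_powR2. Qed.
Let mEh : measurable_fun setT (EFin \o h). Proof. exact/measurable_EFinP. Qed.
Let Eh0 y : (0 <= (EFin \o h) y)%E. Proof. by rewrite lee_fin. Qed.

Let mouT (f : Rvec R d -> \bar R) x : measurable_fun setT f -> (forall y, 0 <= f y)%E ->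
  measurable_fun setT (fun s : measurableTypeR R => ouT s f x).
Proof. by move=> mf f0; exact: measurable_ouT. Qed.

Let mlevy t : measurable_fun setT (fun s : measurableTypeR R => (levy t s)%:E).
Proof. by apply/measurable_EFinP; exact: measurable_levy. Qed.

(** In the variable s the exponent is the constant p x, so Young's inequality, with [g] chosen from
    the average [J], plays the part of Jensen's inequality for a weight whose mass is only known to
    be at most 2. *)
Lemma phP_poweR_le t x : 0 < t ->
  (phP t (EFin \o h) x `^ p x <=
   (3 `^ P * (1 + 2 * B))%:E * (1 + phP t hp x + (expR (dotv x x / 8))%:E))%E.
Proof.
move=> t0; set E8 := expR (dotv x x / 8); set S := (1 + phP t hp x + E8%:E)%E.
have E80 : 0 < E8 by exact: expR_gt0.
have lv0 s : (0 <= (levy t s)%:E)%E by rewrite lee_fin levy_ge0// ltW.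
have ph0 : (0 <= phP t hp x)%E by apply: phP_ge0 => //; exact: ltW.
have phh0 : (0 <= phP t (EFin \o h) x)%E by apply: phP_ge0 => //; exact: ltW.
have K0 : 0 < 3 `^ P * (1 + 2 * B) by rewrite mulr_gt0 ?powR_gt0// addr_gt0// mulr_gt0.
have oT0 s : (0 <= ouT s (EFin \o h) x)%E by exact: ouT_ge0.
pose Q s := (ouT s (EFin \o h) x `^ p x)%E.
have Q0 s : (0 <= Q s)%E by exact: poweR_ge0.
have mQ : measurable_fun setT (Q : measurableTypeR R -> \bar R).
  by apply: (measurableT_comp (measurable_poweR _)); exact: mouT.
pose J := (\int[leb]_s ((levy t s)%:E * Q s))%E.
have J0 : (0 <= J)%E by apply: integral_ge0 => s _; exact: mule_ge0.
have JS : (J <= (2 * B)%:E * S)%E.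
  pose S' s := (ouT s hp x + (1 + E8)%:E)%E.
  have S'E s : S' s = (1 + ouT s hp x + E8%:E)%E.
    by rewrite /S' (EFinD 1 E8) addeA [(_ + 1%:E)%E]addeC.
  have S'0 s : (0 <= S' s)%E.
    by apply: adde_ge0; [exact: ouT_ge0|rewrite lee_fin addr_ge0// ltW].
  have mS' : measurable_fun setT (S' : measurableTypeR R -> \bar R).
    by apply: emeasurable_funD => //; exact: mouT.
  apply: (@le_trans _ _ (\int[leb]_s (B%:E * ((levy t s)%:E * S' s)))%E).
    apply: ge0_le_integral => //.
    - by move=> s _; exact: mule_ge0.
    - exact: emeasurable_funM.
    - by apply: emeasurable_funM => //; exact: emeasurable_funM.
    move=> s _; have [s0|s0] := leP s 0; first by rewrite levy_le0// !mul0e mule0.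
    rewrite muleCA; apply: lee_wpmul2l => //.
    have := HB mh h0 h1 x s0; rewrite -/(Q s) => /le_trans; apply.
    apply: lee_wpmul2l; first by rewrite lee_fin ltW.
    by rewrite S'E.
  rewrite ge0_integralZl_EFin//; last 3 first.
  - by move=> s _; exact: mule_ge0.
  - exact: emeasurable_funM.
  - exact: ltW.
  rewrite [(2 * B)%R]mulrC EFinM -muleA; apply: lee_wpmul2l; first by rewrite lee_fin ltW.
  under eq_integral do rewrite /S' ge0_muleDr ?ouT_ge0 ?lee_fin ?addr_ge0 ?(ltW E80)//.
  rewrite ge0_integralD//; first last.
  - by apply: emeasurable_funM.
  - by move=> s _; apply: mule_ge0 => //; rewrite lee_fin addr_ge0// ltW.
  - by apply: emeasurable_funM => //; exact: mouT.
  - by move=> s _; apply: mule_ge0 => //; exact: ouT_ge0.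
  rewrite -/(phP t hp x) ge0_integralZr//; first last.
  - by rewrite lee_fin addr_ge0// ltW.
  have -> : S = ((1 + E8)%:E + phP t hp x)%E by rewrite /S addeAC (EFinD 1 E8).
  have E0 : (0 <= (1 + E8)%:E)%E by rewrite lee_fin addr_ge0// ltW.
  have := integral_levyT_le t0; move: ph0; clear S.
  move: (phP t hp x) (\int[leb]_s (levy t s)%:E)%E => u I u0 I2.
  rewrite (ge0_muleDr _ E0 u0) addeC; apply: leeD; first exact: lee_wpmul2r.
  by rewrite -[leLHS]mul1e; apply: lee_wpmul2r; rewrite ?lee_fin ?ler1n.
have S1 : (1 <= S)%E.
  rewrite /S; move: ph0; move: (phP t hp x) => u u0.
  by rewrite -addeA -[leLHS]adde0 leeD2l// adde_ge0// lee_fin ltW.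
have [Sy|Sfin] := eqVneq S +oo%E; first by rewrite Sy gt0_muley ?lte_fin// leey.
have Sfn : S \is a fin_num by rewrite ge0_fin_numE ?(le_trans _ S1)// lt_neqAle Sfin leey.
have [j jE] : exists j, J = j%:E.
  exists (fine J); rewrite fineK// ge0_fin_numE// (le_lt_trans JS)//.
  by rewrite ltey_eq fin_numM.
rewrite jE lee_fin in J0.
have := expR_ln_div J0 (p1 x); set g := _ / p x => -[g0 gp g1p].
(* The factor 3 is the mass bound 2 of the density, from the first Young term, plus 1 from the
   second. *)
have T1 : (phP t (EFin \o h) x <= (3 * expR g)%:E)%E.
  apply: (@le_trans _ _ (\int[leb]_s ((expR g)%:E * (levy t s)%:E +
    (expR (g * (1 - p x)))%:E * ((levy t s)%:E * Q s)))%E).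
    apply: ge0_le_integral => //.
    - by move=> s _; exact: mule_ge0.
    - by apply: emeasurable_funM => //; exact: mouT.
    - apply: emeasurable_funD; apply: emeasurable_funM => //.
      exact: emeasurable_funM.
    move=> s _; have := poweR_young g (oT0 s) (p1 x); rewrite -/(Q s) => yo.
    apply: (@le_trans _ _ ((levy t s)%:E * ((expR g)%:E + Q s * (expR (g * (1 - p x)))%:E))%E).
      exact: lee_wpmul2l.
    rewrite ge0_muleDr; last 2 first.
    - by rewrite lee_fin expR_ge0.
    - by apply: mule_ge0 => //; rewrite lee_fin expR_ge0.
    by rewrite [((levy t s)%:E * (expR g)%:E)%E]muleC [(Q s * _)%E]muleC muleCA.
  rewrite ge0_integralD//; first last.
  - by apply: emeasurable_funM => //; exact: emeasurable_funM.
  - by move=> s _; apply: mule_ge0; [rewrite lee_fin expR_ge0|exact: mule_ge0].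
  - by apply: emeasurable_funM.
  - by move=> s _; apply: mule_ge0 => //; rewrite lee_fin expR_ge0.
  rewrite ge0_integralZl_EFin ?expR_ge0//.
  rewrite ge0_integralZl_EFin ?expR_ge0//; last 2 first.
  - by move=> s _; exact: mule_ge0.
  - exact: emeasurable_funM.
  rewrite -/J jE; apply: (@le_trans _ _ ((expR g)%:E * 2%:E + (expR (g * (1 - p x)))%:E * j%:E)%E).
    by rewrite leeD2r// lee_wpmul2l ?lee_fin ?expR_ge0//; exact: integral_levyT_le.
  rewrite -!EFinM -EFinD lee_fin.
  have : expR (g * (1 - p x)) * j <= expR g.
    by rewrite -g1p ler_pM2l ?expR_gt0// lerDr.
  lra.
apply: (@le_trans _ _ ((3 * expR g)%:E `^ p x)%E).
  by apply: le_poweR T1 => //; exact: ltW.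
rewrite poweR_EFin powRM ?expR_ge0//.
have -> : expR g `^ p x = 1 + j by rewrite -gp /powR gt_eqF ?expR_gt0// expRK mulrC.
have [S' S'E] : exists S', S = S'%:E by exists (fine S); rewrite fineK.
move: JS S1; rewrite jE S'E -EFinM !lee_fin => JS S1.
rewrite -mulrA; apply: ler_pM; rewrite ?powR_ge0 ?addr_ge0//.
  by apply: ler_powR => //; rewrite ler1n.
by move: JS S1 B0; lra.
Qed.

End pointwise.

Lemma measurable_phP_EFin t (h : Rvec R d -> R) : 0 <= t -> measurable_fun setT h ->
  (forall x, 0 <= h x) -> measurable_fun setT (phP t (EFin \o h)).
Proof.
move=> t0 mh h0; apply: measurable_phP => //.
exact/measurable_EFinP.
Qed.

(** Integrating the pointwise bound costs the mass 1 of gamma, the factor 2 of [integral_phP_le] and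
    the Gaussian integral [I8]. The summand 1 outside secures [1 <= C], which the passage to norms
    uses. *)
Lemma phP_modular : exists2 C, 1 <= C & forall h : Rvec R d -> R,
  measurable_fun setT h -> (forall x, 0 <= h x) ->
  (\int[gam]_y (h y `^ p y)%:E <= 1)%E -> forall t, 0 < t ->
  (\int[gam]_x (phP t (EFin \o h) x `^ p x) <= C%:E)%E.
Proof.
pose K := 3 `^ P * (1 + 2 * B).
have K0 : 0 < K by rewrite mulr_gt0 ?powR_gt0// addr_gt0// mulr_gt0.
have [I8 I8E] : exists I8, (\int[gam]_x (expR (dotv x x / 8))%:E)%E = I8%:E.
  exists (fine (\int[gam]_x (expR (dotv x x / 8))%:E)%E); rewrite fineK//.
  rewrite ge0_fin_numE ?integral_gauss_sqr_lty//.
  by apply: integral_ge0 => x _; rewrite lee_fin expR_ge0.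
have I80 : 0 <= I8.
  by rewrite -lee_fin -I8E; apply: integral_ge0 => x _; rewrite lee_fin expR_ge0.
exists (1 + K * (3 + I8)); first by rewrite lerDl mulr_ge0 ?(ltW K0)// addr_ge0.
move=> h mh h0 h1 t t0.
pose hp (y : Rvec R d) := (h y `^ p y)%:E.
have hp0 y : (0 <= hp y)%E by rewrite lee_fin powR_ge0.
have mhp : measurable_fun setT hp by apply/measurable_EFinP; exact: measurable_fun_powR2.
have m8 : measurable_fun setT (fun x : Rvec R d => (expR (dotv x x / 8))%:E).
  apply/measurable_EFinP; apply: measurableT_comp => //; apply: measurable_funM => //.
  exact: measurable_dotv.
have php0 x : (0 <= phP t hp x)%E by apply: phP_ge0 => //; exact: ltW.
have mphp : measurable_fun setT (phP t hp) by apply: measurable_phP => //; exact: ltW.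
have S0 x : (0 <= 1 + phP t hp x)%E by exact: adde_ge0.
have E80 (x : Rvec R d) : (0 <= (expR (dotv x x / 8))%:E)%E by rewrite lee_fin expR_ge0.
have mS : measurable_fun setT (fun x => (1 + phP t hp x + (expR (dotv x x / 8))%:E)%E).
  by apply: emeasurable_funD => //; apply: emeasurable_funD.
apply: (@le_trans _ _ (\int[gam]_x (K%:E * (1 + phP t hp x + (expR (dotv x x / 8))%:E)))%E).
  apply: ge0_le_integral => //.
  - by move=> x _; exact: poweR_ge0.
  - apply: (measurable_fun_poweR2 (measurable_phP_EFin (ltW t0) mh h0) mp p0) => x.
    by apply: phP_ge0 => [|y]; [exact: ltW|rewrite lee_fin].
  - by apply: emeasurable_funM.
  - by move=> x _; exact: phP_poweR_le.
rewrite ge0_integralZl_EFin//; last 2 first.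
- by move=> x _; exact: adde_ge0.
- exact: ltW.
have mS1 : measurable_fun setT (fun x => (1 + phP t hp x)%E) by exact: emeasurable_funD.
rewrite (ge0_integralD _ measurableT (fun x _ => S0 x) mS1 (fun x _ => E80 x) m8).
rewrite (ge0_integralD _ measurableT (fun x _ => lee01) (measurable_cst _) (fun x _ => php0 x) mphp).
rewrite I8E integral_cst// [X in (1%:E * X)%E]gauss_measure_setT mule1.
apply: (@le_trans _ _ (K%:E * (1 + 2%:E + I8%:E))%E).
  apply: lee_wpmul2l; first by rewrite lee_fin ltW.
  rewrite leeD2r// leeD2l//; apply: (le_trans (integral_phP_le t0 mhp hp0)).
  by rewrite -[leRHS]mule1 lee_wpmul2l.
by rewrite -!EFinD -EFinM lee_fin; move: K0; lra.
Qed.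

Lemma phP_scale t (k : R) (h : Rvec R d -> R) x : 0 <= t -> 0 <= k ->
  measurable_fun setT h -> (forall x, 0 <= h x) ->
  phP t (fun y => (k * h y)%:E) x = (k%:E * phP t (EFin \o h) x)%E.
Proof.
move=> t0 k0 mh h0; have mEh : measurable_fun setT (EFin \o h) by exact/measurable_EFinP.
have Eh0 y : (0 <= (EFin \o h) y)%E by rewrite lee_fin.
rewrite /phP -ge0_integralZl_EFin//; last 2 first.
- move=> s _; apply: mule_ge0; first by rewrite lee_fin levy_ge0.
  exact: ouT_ge0.
- exact: measurable_phP_integrand.
apply: eq_integral => s _; rewrite muleCA; congr (_ * _)%E.
rewrite /ouT -ge0_integralZl_EFin//; last 2 first.
- by move=> y _; apply: mule_ge0 => //; rewrite lee_fin mehler_ge0.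
- exact: measurable_mehlerM.
by apply: eq_integral => y _; rewrite EFinM muleCA.
Qed.

(** As C >= 1 and p >= 1, dividing a function by C divides its modular by at least C. Only a
    pointwise domination is asked of [u], so the first comparison is between lower integrals. *)
Lemma var_norm_phP_le : exists2 C, 1 <= C & forall (f : Rvec R d -> R) (l : R),
  measurable_fun setT f -> 0 < l ->
  (\int[gam]_x (`|(f x)%:E| * (l^-1)%:E) `^ (p x) <= 1)%E ->
  forall (t k : R) (u : Rvec R d -> \bar R), 0 < t -> 0 < k ->
  (forall x, `|u x| <= k%:E * phP t (fun y => (`|f y|)%:E) x)%E ->
  (var_norm gam setT p u <= (k * C * l)%:E)%E.
Proof.
have [C C1 HC] := phP_modular; exists C => // f l mf l0 fl t k u t0 k0 uf.
have C0 : 0 < C by exact: lt_le_trans C1.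
pose h y := `|f y| / l.
have h0 y : 0 <= h y by rewrite divr_ge0// ltW.
have mh : measurable_fun setT h.
  by apply: measurable_funM => //; exact: measurableT_comp.
have h1 : (\int[gam]_y (h y `^ p y)%:E <= 1)%E.
  by apply: le_trans fl; rewrite le_eqVlt; apply/orP; left; apply/eqP.
have fE : (fun y => (`|f y|)%:E) = (fun y => (l * h y)%:E).
  by apply/funext => y; rewrite /h mulrC divfK ?gt_eqF.
have pc : 0 < k * C * l by rewrite !mulr_gt0.
apply: ereal_inf_lbound; exists (k * C * l) => //; split => //.
have ph0 x : (0 <= phP t (EFin \o h) x)%E.
  by apply: phP_ge0 => [|y]; [exact: ltW|rewrite lee_fin].
apply: (@le_trans _ _ (\int[gam]_x ((C^-1)%:E * (phP t (EFin \o h) x `^ p x)))%E).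
  apply: ge0_le_lower_integral => x _; first exact: poweR_ge0.
  apply: (@le_trans _ _ (((C^-1)%:E * phP t (EFin \o h) x) `^ p x)%E).
    apply: le_poweR; first exact: ltW.
      by apply: mule_ge0 => //; rewrite lee_fin invr_ge0 ltW.
    have := uf x; rewrite fE phP_scale ?(ltW t0) ?(ltW l0)// => ux.
    apply: (@le_trans _ _ ((k%:E * (l%:E * phP t (EFin \o h) x)) * ((k * C * l)^-1)%:E)%E).
      by apply: lee_wpmul2r => //; rewrite lee_fin invr_ge0 ltW.
    rewrite muleA -EFinM muleC muleA -EFinM le_eqVlt; apply/orP; left; apply/eqP.
    by congr (_%:E * _)%E; field; rewrite !gt_eqF.
  have iC : (0 <= (C^-1)%:E)%E by rewrite lee_fin invr_ge0 ltW.
  rewrite (poweRM _ iC (ph0 x)) poweR_EFin; apply: lee_wpmul2r; first exact: poweR_ge0.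
  rewrite lee_fin; apply: ge1r_powR => //.
  by rewrite invr_gt0 C0/= invf_le1.
rewrite ge0_integralZl_EFin//; last 3 first.
- by move=> x _; exact: poweR_ge0.
- apply: measurable_fun_poweR2 => //.
  by apply: measurable_phP_EFin => //; exact: ltW.
- by rewrite invr_ge0 ltW.
apply: (@le_trans _ _ ((C^-1)%:E * C%:E)%E).
  by apply: lee_wpmul2l; [rewrite lee_fin invr_ge0 ltW|exact: HC].
by rewrite -EFinM mulVf// gt_eqF.
Qed.

End poisson_boundedness.

(** * Time derivatives of the Poisson-Hermite semigroup *)

Section nonneg_functions.
Context {R : realType} {d : nat}.
Implicit Types (x y : Rvec R d) (s t a b : R).
Local Notation gam := (@gauss_measure R d).
Local Notation leb := (@lebesgue_measure R).
Local Open Scope ereal_scope.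

Let sleb : sigma_finite setT leb. Proof. exact: sigma_finiteT. Qed.

(** The Poisson-Hermite kernel with respect to gamma. Writing P_a as a single integral allows
    differentiating P_a (P_b f) in b under the integral sign. *)
Definition phK a x y : \bar R := \int[leb]_s ((levy a s)%:E * (mehler s x y)%:E).

Lemma phK_ge0 a x y : (0 <= a)%R -> 0 <= phK a x y.
Proof.
by move=> a0; apply: integral_ge0 => s _; rewrite mule_ge0// lee_fin ?levy_ge0 ?mehler_ge0.
Qed.

Lemma measurable_phK a x : (0 <= a)%R -> measurable_fun setT (phK a x).
Proof.
move=> a0; apply: (measurable_tonelli sleb
  (f := fun w : Rvec R d * measurableTypeR R => (levy a w.2)%:E * (mehler w.2 x w.1)%:E)).
  apply: emeasurable_funM; apply/measurable_EFinP; last exact: measurable_mehler.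
  by apply: (measurableT_comp (measurable_levy a)).
by move=> w; rewrite mule_ge0// lee_fin ?levy_ge0 ?mehler_ge0.
Qed.

Lemma phP_phK a h x : (0 <= a)%R -> measurable_fun setT h -> (forall y, 0 <= h y) ->
  phP a h x = \int[gam]_y (phK a x y * h y).
Proof.
move=> a0 mh h0; rewrite /phP /ouT.
transitivity (\int[leb]_s \int[gam]_y ((levy a s)%:E * ((mehler s x y)%:E * h y))).
  apply: eq_integral => s _; rewrite ge0_integralZl//.
  - exact: measurable_mehlerM.
  - by move=> y _; apply: mule_ge0; rewrite ?lee_fin ?mehler_ge0.
  - by rewrite lee_fin levy_ge0.
rewrite (tonelli sleb (@sigma_finite_gauss R d) (f := fun w : measurableTypeR R * Rvec R d =>
    (levy a w.1)%:E * ((mehler w.1 x w.2)%:E * h w.2))) /=; last 2 first.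
- apply: emeasurable_funM; last exact: measurable_mehlerM.
  by apply/measurable_EFinP; apply: (measurableT_comp (measurable_levy a)).
- move=> w; apply: mule_ge0; rewrite ?lee_fin ?levy_ge0//.
  by apply: mule_ge0; rewrite ?lee_fin ?mehler_ge0.
apply: eq_integral => y _; under eq_integral do rewrite muleA.
rewrite ge0_integralZr//.
- apply: emeasurable_funM; apply/measurable_EFinP; first exact: measurable_levy.
  exact: measurable_mehler.
- by move=> s _; rewrite mule_ge0// lee_fin ?levy_ge0 ?mehler_ge0.
Qed.

(** From e^{2s} >= 1 + 2s follows 1 / (1 - e^{-2s}) <= 1 + 1 / (2s), and Z <= Z^2. *)
Lemma mehler_scale_expn_le s : (0 < s)%R ->
  (mehler_scale s ^+ d <= (1 + (2 * s)^-1) ^+ d)%R.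
Proof.
move=> s0; have Z1 := mehler_scale_ge1 s0.
have Z0 := lt_le_trans ltr01 Z1.
apply: lerXn2r; rewrite ?nnegrE ?(ltW Z0)//.
  by rewrite addr_ge0// invr_ge0 mulr_ge0// ltW.
apply: (@le_trans _ _ (mehler_scale s ^+ 2)%R).
  by rewrite expr2 ler_peMr// ltW.
rewrite (_ : mehler_scale s ^+ 2 = (1 - expR (- s) ^+ 2)^-1)%R; last first.
  rewrite /mehler_scale exprVn sqr_sqrtr// ltW//; exact: onem_sqr_gt0 (expRN_lt1 s0).
have v0 := onem_sqr_gt0 (expRN_lt1 s0).
rewrite -expRN2 in v0 *.
have e0 := expR_gt0 (2 * s); have e1 := expR_ge1Dx (2 * s)%R.
have s20 : (0 < 2 * s)%R by rewrite mulr_gt0.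
rewrite -div1r ler_pdivrMr// mulNr expRN.
have : ((expR (2 * s))^-1 <= (1 + 2 * s)^-1)%R by rewrite lef_pV2 ?posrE// addr_gt0.
move=> h; apply: (@le_trans _ _ ((1 + (2 * s)^-1) * (1 - (1 + 2 * s)^-1))%R).
  rewrite le_eqVlt; apply/orP; left; apply/eqP.
  by field; rewrite !gt_eqF// addr_gt0.
by rewrite ler_wpM2l ?addr_ge0 ?invr_ge0 ?(ltW s20)// lerD2l lerN2.
Qed.

(** Halving the time frees exp(- 3 t^2 / (16 s)), which absorbs the singularity of Z^d at s = 0. *)
Lemma levy_mehler_scale_le t : (0 < t)%R -> exists2 C, (0 < C)%R &
  forall s, (0 < s)%R -> (levy t s * mehler_scale s ^+ d <= C * levy (t / 2) s)%R.
Proof.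
move=> t0; have c0 : (0 < 3 * t ^+ 2 / 8)%R by rewrite divr_gt0// mulr_gt0// exprn_gt0.
have [C C0 HC] := exprn_le_expR d c0.
exists (2 * C * expR (3 * t ^+ 2 / 8))%R; first by rewrite !mulr_gt0// expR_gt0.
move=> s s0; set W := (1 + (2 * s)^-1)%R.
have W0 : (0 <= W)%R by rewrite addr_ge0// invr_ge0 mulr_ge0// ltW.
have lE : (levy t s = 2 * levy (t / 2) s * expR (3 * t ^+ 2 / 8) * expR (- (3 * t ^+ 2 / 8 * W)))%R.
  have E : (expR (- (t ^+ 2 / (4 * s))) = expR (- ((t / 2) ^+ 2 / (4 * s))) *
      expR (3 * t ^+ 2 / 8) * expR (- (3 * t ^+ 2 / 8 * W)))%R.
    by rewrite -!expRD; congr expR; rewrite /W; field; rewrite gt_eqF.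
  rewrite /levy E invfM; move: (expR _) (expR (3 * _ / 8)) (expR (- (_ * W))) => e1 e2 e3.
  by move: ((s * _)^-1)%R ((Num.sqrt pi)^-1)%R => u v; field.
have l0 : (0 <= levy (t / 2) s)%R by rewrite levy_ge0// divr_ge0// ltW.
rewrite lE; apply: (@le_trans _ _ (2 * levy (t / 2) s * expR (3 * t ^+ 2 / 8) *
    expR (- (3 * t ^+ 2 / 8 * W)) * (C * expR (3 * t ^+ 2 / 8 * W)))%R).
  apply: ler_wpM2l; first by do 3 (apply: mulr_ge0; rewrite ?expR_ge0//).
  apply: le_trans (HC _ W0); exact: mehler_scale_expn_le.
rewrite expRN; have := expR_gt0 (3 * t ^+ 2 / 8 * W).
move: (expR (_ * W)) (expR (3 * _ / 8)) => u v u0.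
rewrite le_eqVlt; apply/orP; left; apply/eqP; field; by rewrite gt_eqF.
Qed.

Lemma ouT_le s h x : (0 < s)%R -> measurable_fun setT h -> (forall y, 0 <= h y) ->
  ouT s h x <= (mehler_scale s ^+ d * expR (dotv x x))%:E * \int[gam]_y h y.
Proof.
move=> s0 mh h0; have Z1 := mehler_scale_ge1 s0.
have k0 : (0 <= mehler_scale s ^+ d * expR (dotv x x))%R.
  by rewrite mulr_ge0 ?expR_ge0// exprn_ge0// (le_trans ler01).
move: k0; set k := (_ * _)%R => k0.
apply: (@le_trans _ _ (\int[gam]_y (k%:E * h y))); last by rewrite ge0_integralZl_EFin.
apply: ge0_le_integral => //.
- by move=> y _; apply: mule_ge0; rewrite ?lee_fin ?mehler_ge0.
- exact: measurable_mehlerM.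
- exact: emeasurable_funM.
- by move=> y _; apply: lee_wpmul2r => //; rewrite lee_fin mehler_le.
Qed.

Lemma ouT_lty s h x : (0 < s)%R -> measurable_fun setT h -> (forall y, 0 <= h y) ->
  \int[gam]_y h y < +oo -> ouT s h x < +oo.
Proof.
move=> s0 mh h0 hy; apply: (le_lt_trans (ouT_le x s0 mh h0)).
by apply: lte_mul_pinfty => //; rewrite lee_fin mulr_ge0 ?expR_ge0// exprn_ge0//
  (le_trans ler01)// mehler_scale_ge1.
Qed.

(** Finiteness holds at every point, not merely almost everywhere: the kernel is bounded at fixed x
    once its short-time singularity is absorbed by the density. Hence real-valued integrals can be
    used pointwise in x. *)
Lemma phP_lty t h x : (0 < t)%R -> measurable_fun setT h -> (forall y, 0 <= h y) ->
  \int[gam]_y h y < +oo -> phP t h x < +oo.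
Proof.
move=> t0 mh h0 hy; have [C C0 HC] := levy_mehler_scale_le t0.
have I0 : 0 <= \int[gam]_y h y by exact: integral_ge0.
have t20 : (0 < t / 2)%R by rewrite divr_gt0.
have IF : \int[gam]_y h y \is a fin_num by rewrite ge0_fin_numE.
have cI0 : 0 <= (C * expR (dotv x x))%:E * \int[gam]_y h y.
  by apply: mule_ge0 => //; rewrite lee_fin mulr_ge0 ?expR_ge0// ltW.
apply: (@le_lt_trans _ _ (\int[leb]_s ((levy (t / 2) s)%:E *
    ((C * expR (dotv x x))%:E * \int[gam]_y h y)))).
  apply: ge0_le_integral => //.
  - move=> s _; apply: mule_ge0; first by rewrite lee_fin levy_ge0// ltW.
    exact: ouT_ge0.
  - exact: measurable_phP_integrand.
  - apply: emeasurable_funM => //; apply/measurable_EFinP; exact: measurable_levy.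
  move=> s _; have [s0|s0] := leP s 0%R; first by rewrite !levy_le0// !mul0e.
  apply: (@le_trans _ _ ((levy t s)%:E *
     ((mehler_scale s ^+ d * expR (dotv x x))%:E * \int[gam]_y h y))).
    by apply: lee_wpmul2l; [rewrite lee_fin levy_ge0// ltW|exact: ouT_le].
  rewrite !muleA -!EFinM; apply: lee_wpmul2r => //; rewrite lee_fin !mulrA.
  by apply: ler_wpM2r; rewrite ?expR_ge0// [leRHS]mulrC HC.
rewrite ge0_integralZr//; last 2 first.
- by apply/measurable_EFinP; exact: measurable_levy.
- by move=> s _; rewrite lee_fin levy_ge0// ltW.
apply: lte_mul_pinfty.
- by apply: integral_ge0 => s _; rewrite lee_fin levy_ge0// ltW.
- rewrite ge0_fin_numE; first exact: le_lt_trans (integral_levyT_le t20) (ltry _).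
  by apply: integral_ge0 => s _; rewrite lee_fin levy_ge0// ltW.
- by rewrite -ge0_fin_numE// fin_numM.
Qed.

Lemma phK_lty a x y : (0 < a)%R -> phK a x y < +oo.
Proof.
move=> a0; have [C C0 HC] := levy_mehler_scale_le a0.
have a20 : (0 < a / 2)%R by rewrite divr_gt0.
apply: (@le_lt_trans _ _ (\int[leb]_s ((levy (a / 2) s)%:E * (C * expR (dotv x x))%:E))).
  apply: ge0_le_integral => //.
  - by move=> s _; rewrite mule_ge0// lee_fin ?levy_ge0 ?mehler_ge0// ltW.
  - apply: emeasurable_funM; apply/measurable_EFinP; first exact: measurable_levy.
    exact: measurable_mehler.
  - by apply: emeasurable_funM => //; apply/measurable_EFinP; exact: measurable_levy.
  move=> s _; have [s0|s0] := leP s 0%R; first by rewrite !levy_le0// !mul0e.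
  rewrite -!EFinM lee_fin.
  apply: (@le_trans _ _ (levy a s * (mehler_scale s ^+ d * expR (dotv x x)))%R).
    by apply: ler_wpM2l; [rewrite levy_ge0// ltW|exact: mehler_le].
  by rewrite !mulrA ler_wpM2r ?expR_ge0// [leRHS]mulrC HC.
rewrite ge0_integralZr//; last 3 first.
- by apply/measurable_EFinP; exact: measurable_levy.
- by move=> s _; rewrite lee_fin levy_ge0// ltW.
- by rewrite lee_fin mulr_ge0 ?expR_ge0// ltW.
apply: (@le_lt_trans _ _ (2%:E * (C * expR (dotv x x))%:E)); last by rewrite -EFinM ltry.
apply: lee_wpmul2r; last exact: integral_levyT_le.
by rewrite lee_fin mulr_ge0 ?expR_ge0// ltW.
Qed.

Lemma phP_subordination t h x : (0 < t)%R -> measurable_fun setT h -> (forall y, 0 <= h y) ->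
  \int[leb]_(u in Rpos) ((expR (- u) / Num.sqrt u)%:E * ouT (t ^+ 2 / (4 * u)) h x) =
  (Num.sqrt pi)%:E * phP t h x.
Proof.
move=> t0 mh h0; pose c (u : R) : R := (expR (- u) / Num.sqrt u * \1_Rpos u)%R.
have c0 u : (0 <= c u)%R.
  by rewrite mulr_ge0 ?divr_ge0 ?expR_ge0 ?sqrtr_ge0// indicE.
have mc : measurable_fun setT (c : measurableTypeR R -> R).
  apply: measurable_funM; last by apply: measurable_indic; exact: measurable_Rpos.
  apply: measurable_funM; first by apply: measurableT_comp => //; exact: measurableT_comp.
  by apply: measurable_funVr; exact: measurable_fun_sqrtr.
have cT (F : R -> \bar R) : \int[leb]_(u in Rpos) ((expR (- u) / Num.sqrt u)%:E * F u) =
    \int[leb]_u ((c u)%:E * F u).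
  rewrite integral_mkcond; apply: eq_integral => u _; rewrite patchE /c indicE.
  by case: ifPn => _; rewrite ?mulr1// mulr0 mul0e.
have mtu : measurable_fun setT (fun u : measurableTypeR R => (t ^+ 2 / (4 * u))%R).
  by apply: measurable_funM => //; apply: measurable_funVr; exact: measurable_funM.
have E y : \int[leb]_u ((c u)%:E * (mehler (t ^+ 2 / (4 * u)) x y)%:E) =
    (Num.sqrt pi)%:E * phK t x y.
  rewrite -cT; have := @integral_levy_subordination R t (fun s => mehler s x y) t0
    (fun s => @continuous_mehler R d s x y) (fun s _ => mehler_ge0 s x y).
  under eq_integral do rewrite EFinM.
  move=> ->; rewrite /phK integral_levyT -ge0_integralZl_EFin//; last 3 first.
  - exact: measurable_Rpos.
  - by move=> s _; rewrite mule_ge0// lee_fin ?levy_ge0 ?mehler_ge0// ltW.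
  - apply: measurable_funTS; apply: emeasurable_funM; apply/measurable_EFinP; first exact: measurable_levy.
    exact: measurable_mehler.
  by apply: eq_integral => s _; rewrite -!EFinM mulrA.
rewrite cT phP_phK ?(ltW t0)// -ge0_integralZl_EFin//; last 2 first.
- by move=> y _; apply: mule_ge0 => //; apply: phK_ge0; exact: ltW.
- by apply: emeasurable_funM => //; apply: measurable_phK; exact: ltW.
rewrite /ouT.
transitivity (\int[leb]_u \int[gam]_y ((c u)%:E * ((mehler (t ^+ 2 / (4 * u)) x y)%:E * h y))).
  apply: eq_integral => u _; rewrite ge0_integralZl//.
  - exact: measurable_mehlerM.
  - by move=> y _; apply: mule_ge0; rewrite ?lee_fin ?mehler_ge0.
  - by rewrite lee_fin.
rewrite (tonelli sleb (@sigma_finite_gauss R d) (f := fun w : measurableTypeR R * Rvec R d =>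
    (c w.1)%:E * ((mehler (t ^+ 2 / (4 * w.1)) x w.2)%:E * h w.2))) /=; last 2 first.
- apply: emeasurable_funM.
    by apply/measurable_EFinP; exact: (measurableT_comp mc).
  by apply: measurable_mehlerM => //; exact: (measurableT_comp mtu).
- move=> w; apply: mule_ge0; rewrite ?lee_fin//.
  by apply: mule_ge0; rewrite ?lee_fin ?mehler_ge0.
apply: eq_integral => y _; under eq_integral do rewrite muleA.
rewrite ge0_integralZr//; last 2 first.
- apply: emeasurable_funM; apply/measurable_EFinP => //.
  exact: measurable_mehler.
- by move=> s _; rewrite mule_ge0// lee_fin ?mehler_ge0.
by rewrite E muleA.
Qed.

End nonneg_functions.

Section nonneg_real_functions.
Context {R : realType} {d : nat}.
Local Notation gam := (@gauss_measure R d).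
Local Notation leb := (@lebesgue_measure R).
Variable h : Rvec R d -> R.
Hypotheses (mh : measurable_fun setT h) (h0 : forall y, 0 <= h y).
Hypothesis Ih : (\int[gam]_y (h y)%:E < +oo)%E.

Let mEh : measurable_fun setT (EFin \o h). Proof. exact/measurable_EFinP. Qed.
Let Eh0 y : (0 <= (EFin \o h) y)%E. Proof. by rewrite lee_fin. Qed.

Lemma ouT_fineK s x : 0 < s -> (fine (ouT s (EFin \o h) x))%:E = ouT s (EFin \o h) x.
Proof.
move=> s0; rewrite fineK// ge0_fin_numE; last exact: ouT_ge0.
exact: ouT_lty.
Qed.

Lemma phP_fineK t x : 0 < t -> (fine (phP t (EFin \o h) x))%:E = phP t (EFin \o h) x.
Proof.
move=> t0; rewrite fineK// ge0_fin_numE; first exact: phP_lty.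
by apply: phP_ge0 => //; exact: ltW.
Qed.

Lemma phK_fineK a (x y : Rvec R d) : 0 < a -> (fine (phK a x y))%:E = phK a x y :> \bar R.
Proof.
move=> a0; rewrite fineK// ge0_fin_numE; first exact: phK_lty.
by apply: phK_ge0; exact: ltW.
Qed.

Let integrable_weighted (w : R -> R) (r : R -> R) x (K : \bar R) :
  measurable_fun Rpos w -> measurable_fun Rpos (fun s => ouT (r s) (EFin \o h) x) ->
  (forall s, 0 < s -> 0 <= w s) -> (forall s, 0 < s -> 0 < r s) ->
  (\int[leb]_(s in Rpos) ((w s)%:E * ouT (r s) (EFin \o h) x) = K)%E -> (K < +oo)%E ->
  leb.-integrable Rpos (fun s => (w s * fine (ouT (r s) (EFin \o h) x))%:E) /\
  \int[leb]_(s in Rpos) (w s * fine (ouT (r s) (EFin \o h) x)) = fine K.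
Proof.
move=> mw mT w0 r0 IK Ky.
have posP s : Rpos s -> 0 < s by rewrite /Rpos/= in_itv/= andbT.
have E s : Rpos s -> (w s * fine (ouT (r s) (EFin \o h) x))%:E =
    ((w s)%:E * ouT (r s) (EFin \o h) x)%E.
  by move=> /posP s0; rewrite EFinM ouT_fineK// r0.
have IE : (\int[leb]_(s in Rpos) (w s * fine (ouT (r s) (EFin \o h) x))%:E = K)%E.
  by rewrite -IK; apply: eq_integral => s /[!inE]; exact: E.
split; last by rewrite /Rintegral IE.
apply/integrableP; split.
  apply/measurable_EFinP; apply: measurable_funM => //.
  exact: measurableT_comp.
apply: le_lt_trans Ky; rewrite -IE; apply: ge0_le_lower_integral => s /posP s0 //.
by rewrite lee_fin ger0_norm// mulr_ge0 ?w0// fine_ge0// ouT_ge0.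
Qed.

Lemma integral_levy_fine_ouT t x : 0 < t ->
  leb.-integrable Rpos (fun s => (levy t s * fine (ouT s (EFin \o h) x))%:E) /\
  \int[leb]_(s in Rpos) (levy t s * fine (ouT s (EFin \o h) x)) =
  fine (phP t (EFin \o h) x).
Proof.
move=> t0; apply: (integrable_weighted (r := id)) => //.
- by apply: measurable_funTS; exact: measurable_levy.
- by apply: measurable_funTS; exact: measurable_ouT.
- by move=> s _; rewrite levy_ge0// ltW.
- by rewrite /phP integral_levyT.
- exact: phP_lty.
Qed.

Lemma integral_subordination_fine_ouT t x : 0 < t ->
  leb.-integrable Rpos (fun u => (expR (- u) / Num.sqrt u *
    fine (ouT (t ^+ 2 / (4 * u)) (EFin \o h) x))%:E) /\
  \int[leb]_(u in Rpos) (expR (- u) / Num.sqrt u *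
    fine (ouT (t ^+ 2 / (4 * u)) (EFin \o h) x)) =
  Num.sqrt pi * fine (phP t (EFin \o h) x).
Proof.
move=> t0.
rewrite (_ : _ * fine (phP _ _ _) = fine ((Num.sqrt pi)%:E * phP t (EFin \o h) x)%E); last first.
  by rewrite -phP_fineK.
apply: (integrable_weighted (w := fun u => expR (- u) / Num.sqrt u)
  (r := fun u => t ^+ 2 / (4 * u))) => //.
- apply: measurable_funTS; apply: measurable_funM.
    by apply: measurableT_comp => //; exact: measurableT_comp.
  by apply: measurable_funVr; exact: measurable_fun_sqrtr.
- apply: measurable_funTS; apply: measurable_ouT => //.
  by apply: measurable_funM => //; apply: measurable_funVr; exact: measurable_funM.
- by move=> u u0; rewrite /= divr_gt0 ?exprn_gt0 ?mulr_gt0.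
- by rewrite phP_subordination.
- by rewrite -phP_fineK// -EFinM ltry.
Qed.

Lemma phP_add_phK a b x : 0 < a -> 0 < b ->
  gam.-integrable setT (fun y => (fine (phK a x y) * fine (phP b (EFin \o h) y))%:E) /\
  fine (phP (a + b) (EFin \o h) x) =
  \int[gam]_y (fine (phK a x y) * fine (phP b (EFin \o h) y)).
Proof.
move=> a0 b0; have ph0 y : (0 <= phP b (EFin \o h) y)%E by apply: phP_ge0 => //; exact: ltW.
have mph : measurable_fun setT (phP b (EFin \o h)) by apply: measurable_phP => //; exact: ltW.
have E y : (fine (phK a x y) * fine (phP b (EFin \o h) y))%:E =
    (phK a x y * phP b (EFin \o h) y)%E by rewrite EFinM phK_fineK// phP_fineK.
have IE : (\int[gam]_y (fine (phK a x y) * fine (phP b (EFin \o h) y))%:E =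
    phP (a + b) (EFin \o h) x)%E.
  rewrite -phP_semigroup// phP_phK//; last exact: ltW.
  by apply: eq_integral => y _; exact: E.
split; last by rewrite /Rintegral IE.
apply/integrableP; split.
  under eq_fun do rewrite E; apply: emeasurable_funM => //.
  by apply: measurable_phK; exact: ltW.
have lty : (phP (a + b) (EFin \o h) x < +oo)%E by apply: phP_lty => //; exact: addr_gt0.
apply: le_lt_trans lty; rewrite -IE; apply: ge0_le_lower_integral => y _ //.
by rewrite lee_fin ger0_norm// mulr_ge0// fine_ge0// phK_ge0// ltW.
Qed.

End nonneg_real_functions.

(** * Signed functions and their time derivatives *)

Section signed_functions.
Context {R : realType} {d : nat}.
Local Notation gam := (@gauss_measure R d).
Local Notation leb := (@lebesgue_measure R).
Variable f : Rvec R d -> R.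
Hypothesis mf : measurable_fun setT f.
Hypothesis If : (\int[gam]_y (`|f y|)%:E < +oo)%E.

Let fa y := `|f y|.
Let fp y := Num.max (f y) 0.
Let fm y := Num.max (- f y) 0.

Let mfa : measurable_fun setT fa. Proof. exact: measurableT_comp. Qed.
Let mfp : measurable_fun setT fp. Proof. exact: measurable_maxr. Qed.
Let mfm : measurable_fun setT fm.
Proof. by apply: measurable_maxr => //; exact: measurableT_comp. Qed.
Let fa0 y : 0 <= fa y. Proof. exact: normr_ge0. Qed.
Let fp0 y : 0 <= fp y. Proof. by rewrite le_max lexx orbT. Qed.
Let fm0 y : 0 <= fm y. Proof. by rewrite le_max lexx orbT. Qed.
Let fE y : f y = fp y - fm y.
Proof.
rewrite /fp /fm; have [y0|y0] := leP 0 (f y).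
  by rewrite (max_r (_ : - f y <= 0)) ?subr0 ?oppr_le0.
by rewrite (max_l (_ : 0 <= - f y)) ?opprK ?add0r// oppr_ge0 ltW.
Qed.
Let fpa y : fp y <= fa y. Proof. by rewrite ge_max ler_norm normr_ge0. Qed.
Let fma y : fm y <= fa y. Proof. by rewrite /fa ge_max -normrN ler_norm normr_ge0. Qed.

Let Ifp : (\int[gam]_y (fp y)%:E < +oo)%E.
Proof. by apply: le_lt_trans If; apply: ge0_le_lower_integral => y _; rewrite lee_fin. Qed.
Let Ifm : (\int[gam]_y (fm y)%:E < +oo)%E.
Proof. by apply: le_lt_trans If; apply: ge0_le_lower_integral => y _; rewrite lee_fin. Qed.

Definition ouR s x : R := \int[gam]_y (mehler s x y * f y).
(* The k-th time derivative of the Poisson-Hermite integral of f. *)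
Definition poissonn k t x : R := \int[leb]_(s in Rpos) (ouR s x * levyn k t s).

Let integrable_mehlerM (g : Rvec R d -> R) s x : 0 < s -> measurable_fun setT g ->
  (\int[gam]_y (`|g y|)%:E < +oo)%E ->
  gam.-integrable setT (fun y => (mehler s x y * g y)%:E).
Proof.
move=> s0 mg Ig; apply/integrableP; split.
  apply/measurable_EFinP; apply: measurable_funM => //; exact: measurable_mehler.
have := @ouT_lty R d s (fun y => (`|g y|)%:E) x s0 _ _ Ig.
under eq_integral do rewrite abse_EFin normrM ger0_norm ?mehler_ge0// EFinM.
by apply => //; apply/measurable_EFinP; exact: measurableT_comp.
Qed.

Lemma ouR_le s x : 0 < s -> ((`|ouR s x|)%:E <= ouT s (EFin \o fa) x)%E.
Proof.
move=> s0; have iM := integrable_mehlerM x s0 mf If.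
rewrite /ouR EFin_normr_Rintegral//.
apply: (le_trans (le_abse_integral _ measurableT _)); first exact: measurable_int iM.
rewrite le_eqVlt; apply/orP; left; apply/eqP; apply: eq_integral => y _.
by rewrite abse_EFin normrM ger0_norm ?mehler_ge0.
Qed.

Lemma ouR_split s x : 0 < s ->
  ouR s x = fine (ouT s (EFin \o fp) x) - fine (ouT s (EFin \o fm) x).
Proof.
move=> s0; have ip : gam.-integrable setT (fun y => (mehler s x y * fp y)%:E).
  apply: integrable_mehlerM => //.
  by under eq_integral do rewrite ger0_norm//.
have im : gam.-integrable setT (fun y => (mehler s x y * fm y)%:E).
  apply: integrable_mehlerM => //.
  by under eq_integral do rewrite ger0_norm//.
rewrite -[fine (ouT s (EFin \o fp) x)]/(\int[gam]_y (mehler s x y * fp y)).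
rewrite -[fine (ouT s (EFin \o fm) x)]/(\int[gam]_y (mehler s x y * fm y)).
rewrite -RintegralB//; apply: eq_Rintegral => y _.
by rewrite fE mulrBr.
Qed.

Lemma ornstein_uhlenbeck_ouR s x : 0 < s -> ornstein_uhlenbeck s f x = ouR s x.
Proof.
move=> s0; have v0 := onem_sqr_gt0 (expRN_lt1 s0); rewrite -expRN2 in v0.
have iM := integrable_mehlerM x s0 mf If.
set A := (1 - expR (- 2 * s)) `^ (- (d%:R / 2)); have A0 : 0 < A by exact: powR_gt0.
rewrite /ornstein_uhlenbeck -/A -RintegralZl//.
  by apply: eq_Rintegral => y _; rewrite mulrA.
have := integrableZl measurableT A^-1 iM; apply: eq_integrable => // y _.
by rewrite -EFinM /mehler -/A !mulrA mulVf ?mul1r// gt_eqF.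
Qed.

Lemma measurable_ouR dT (T : measurableType dT) (a : T -> R) (b : T -> Rvec R d) :
  measurable_fun setT a -> measurable_fun setT b ->
  measurable_fun setT (fun w => ouR (a w) (b w)).
Proof.
move=> ma mb; apply: (@measurable_fun_Rintegral _ _ _ _ _ (sfm (@sigma_finite_gauss R d)) setT
  (fun w : T * Rvec R d => mehler (a w.1) (b w.1) w.2 * f w.2)) => //.
apply: measurable_funM; last exact: measurableT_comp.
by apply: measurable_mehler => //; exact: measurableT_comp.
Qed.

Let posP (s : R) : Rpos s -> 0 < s. Proof. by rewrite /Rpos/= in_itv/= andbT. Qed.

Let mposR : @measurable _ (measurableTypeR R) (@Rpos R). Proof. exact: measurable_Rpos. Qed.

Lemma poissonn0 t x : 0 < t ->
  poissonn 0 t x = fine (phP t (EFin \o fp) x) - fine (phP t (EFin \o fm) x).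
Proof.
move=> t0; have [ip ep] := integral_levy_fine_ouT mfp fp0 Ifp x t0.
have [im em] := integral_levy_fine_ouT mfm fm0 Ifm x t0.
rewrite -[X in X - _]ep -[X in _ - X]em -RintegralB//; apply: eq_Rintegral => s /[!inE]/posP s0.
by rewrite ouR_split// levyn0// -mulrBr mulrC.
Qed.

(** Subordination was proved for nonnegative functions; integrability lets it be applied to the
    positive and negative parts separately. *)
Lemma poisson_hermiteE t x : 0 < t -> poisson_hermite t f x = poissonn 0 t x.
Proof.
move=> t0; have [ip ep] := integral_subordination_fine_ouT mfp fp0 Ifp x t0.
have [im em] := integral_subordination_fine_ouT mfm fm0 Ifm x t0.
rewrite poissonn0// /poisson_hermite.
have sp0 : Num.sqrt (pi : R) != 0 by rewrite gt_eqF// sqrtr_gt0 pi_gt0.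
apply: (mulfI sp0); rewrite mulrA mulfV// mul1r mulrBr -[X in X - _]ep -[X in _ - X]em -RintegralB//.
apply: eq_Rintegral => u /[!inE]/posP u0.
have r0 : 0 < t ^+ 2 / (4 * u) by rewrite divr_gt0 ?exprn_gt0 ?mulr_gt0.
by rewrite ornstein_uhlenbeck_ouR// ouR_split// mulrBr.
Qed.

Lemma measurable_poissonn k t : measurable_fun setT (poissonn k t).
Proof.
apply: (@measurable_fun_Rintegral _ _ _ _ (measurableTypeR R) leb Rpos
  (fun w : Rvec R d * measurableTypeR R => ouR w.2 w.1 * levyn k t w.2)) => //.
apply: measurable_funM; first exact: measurable_ouR.
by apply: (measurableT_comp (measurable_levyn k t)).
Qed.

Section derivatives.
Variable x : Rvec R d.

Let F k t s := ouR s x * levyn k t s.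

Let dF k (t : R) s : 0 < t -> Rpos s -> is_derive t (1 : R) (F k ^~ s) (F k.+1 t s).
Proof. by move=> t0 /posP s0; have := is_derive_levyn k t s0 => h; exact: is_deriveZ. Qed.

Let mF k t : 0 < t -> measurable_fun Rpos (F k t).
Proof.
move=> t0; apply: measurable_funTS; apply: measurable_funM; first exact: measurable_ouR.
exact: measurable_levyn.
Qed.

Let mEfa : measurable_fun setT (EFin \o fa). Proof. exact/measurable_EFinP. Qed.

Let integrable_levy_ouR c : 0 < c ->
  leb.-integrable Rpos (fun s => (`|ouR s x| * levy c s)%:E).
Proof.
move=> c0; have [i _] := integral_levy_fine_ouT mfa fa0 If x c0.
apply: le_integrable i => //.
  apply/measurable_EFinP; apply: measurable_funTS; apply: measurable_funM; last exact: measurable_levy.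
  by apply: measurableT_comp => //; exact: measurable_ouR.
move=> s /posP s0; have l0 : 0 <= levy c s by rewrite levy_ge0// ltW.
have T0 : 0 <= fine (ouT s (EFin \o fa) x).
  by rewrite fine_ge0// ouT_ge0// => y; rewrite lee_fin.
rewrite !abse_EFin lee_fin ger0_norm; last by rewrite mulr_ge0.
rewrite ger0_norm; last by rewrite mulr_ge0.
by rewrite mulrC ler_wpM2l// -lee_fin ouT_fineK//; exact: ouR_le.
Qed.

Let domF k c : 0 < c -> exists G : R -> R,
  [/\ forall s, 0 <= G s, leb.-integrable Rpos (EFin \o G)
    & forall t s, c < t -> t < 4 * c -> Rpos s -> `|F k t s| <= G s].
Proof.
move=> c0; have [C C0 HC] := @levyn_le R k; have c20 : 0 < c / 2 by rewrite divr_gt0.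
have K0 : 0 <= C * c ^- k * 4 by rewrite !mulr_ge0// invr_ge0 exprn_ge0// ltW.
exists (fun s => C * c ^- k * 4 * (`|ouR s x| * levy (c / 2) s)); split.
- by move=> s; rewrite mulr_ge0// mulr_ge0// levy_ge0// ltW.
- have := integrableZl mposR (C * c ^- k * 4) (integrable_levy_ouR c20).
  by apply: eq_integrable.
move=> t s ct t4 /posP s0; rewrite /F normrM mulrCA ler_wpM2l//.
have t0 := lt_trans c0 ct; apply: (le_trans (HC _ _ t0 s0)).
have h1 : t ^- k <= c ^- k.
  by rewrite lef_pV2 ?posrE ?exprn_gt0// lerXn2r ?nnegrE ?(ltW c0) ?(ltW t0)// ltW.
(* The ratio 4 of the window enters as the time ratio in [le_levy]. *)
have h2 : levy (t / 2) s <= 4 * levy (c / 2) s.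
  apply: (@le_trans _ _ (t / 2 / (c / 2) * levy (c / 2) s)).
    by apply: le_levy => //; rewrite ler_pM2r// ltW.
  rewrite ler_wpM2r ?levy_ge0 ?(ltW c20)//.
  by rewrite ler_pdivrMr// mulrA ler_wpM2r// ltW.
rewrite -[leRHS]mulrA; apply: ler_pM => //.
- by rewrite mulr_ge0// invr_ge0 exprn_ge0// ltW.
- by rewrite levy_ge0// divr_ge0// ltW.
- by rewrite ler_wpM2l.
Qed.

Lemma is_derive_poissonn k (t : R) : 0 < t ->
  is_derive t (1 : R) (fun t => poissonn k t x) (poissonn k.+1 t x).
Proof. exact: (is_derive_iterated mposR dF mF domF). Qed.

Lemma derive1n_poisson_hermite k (t : R) : 0 < t ->
  derive1n k (fun s => poisson_hermite s f x) t = poissonn k t x.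
Proof.
apply: (derive1n_iterated mposR dF mF domF) => {}t t0.
exact: poisson_hermiteE.
Qed.

Lemma integrable_poissonn k t : 0 < t ->
  leb.-integrable Rpos (fun s => (ouR s x * levyn k t s)%:E).
Proof. exact: (integrable_iterated mposR mF domF). Qed.

End derivatives.

Lemma poissonn_le k : exists2 C, 0 < C & forall t x, 0 < t ->
  ((`|poissonn k t x|)%:E <= (C * t ^- k)%:E * phP (t / 2) (EFin \o fa) x)%E.
Proof.
have [C C0 HC] := @levyn_le R k; exists (C + 1); first by rewrite ltr_wpDl.
move=> t x t0; have t20 : 0 < t / 2 by rewrite divr_gt0.
have K0 : 0 <= (C + 1) * t ^- k by rewrite mulr_ge0 ?addr_ge0// invr_ge0 exprn_ge0// ltW.
have tk : 0 <= t ^- k by rewrite invr_ge0 exprn_ge0// ltW.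
have [i e] := integral_levy_fine_ouT mfa fa0 If x t20.
have iF := integrable_poissonn x k t0.
rewrite -phP_fineK// -e -EFinM lee_fin -RintegralZl//.
apply: (le_trans (le_normr_Rintegral mposR iF)).
apply: le_Rintegral => //.
- exact: integrable_norm.
- have := integrableZl mposR ((C + 1) * t ^- k) i.
  by apply: eq_integrable.
move=> s /posP s0; rewrite normrM.
apply: (@le_trans _ _ (fine (ouT s (EFin \o fa) x) * ((C + 1) * t ^- k * levy (t / 2) s))).
  apply: ler_pM => //.
    by rewrite -lee_fin ouT_fineK//; exact: ouR_le.
  apply: (le_trans (HC _ _ t0 s0)); rewrite ler_wpM2r ?levy_ge0 ?(ltW t20)//.
  by rewrite ler_wpM2r// lerDl.
by rewrite mulrC mulrA.
Qed.

End signed_functions.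

(** * Semigroup law for the time derivatives *)

Section poisson_derivatives.
Context {R : realType} {d : nat}.
Local Notation gam := (@gauss_measure R d).
Variable f : Rvec R d -> R.
Hypothesis mf : measurable_fun setT f.
Hypothesis If : (\int[gam]_y (`|f y|)%:E < +oo)%E.

Let fa y := `|f y|.
Let mfa : measurable_fun setT fa. Proof. exact: measurableT_comp. Qed.
Let fa0 y : 0 <= fa y. Proof. exact: normr_ge0. Qed.

Section kernel.
Variables (a : R) (x : Rvec R d).
Hypothesis a0 : 0 < a.

Let F k t y := fine (phK a x y) * poissonn f k t y.

Let pk0 y : 0 <= fine (phK a x y).
Proof. by rewrite fine_ge0// phK_ge0// ltW. Qed.

Let dF k (t : R) y : 0 < t -> setT y -> is_derive t (1 : R) (F k ^~ y) (F k.+1 t y).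
Proof. by move=> t0 _; have := is_derive_poissonn mf If y k t0 => h; exact: is_deriveZ. Qed.

Let mF k t : 0 < t -> measurable_fun setT (F k t).
Proof.
move=> t0; apply: measurable_funM; last exact: measurable_poissonn.
by apply: measurableT_comp => //; apply: measurable_phK; exact: ltW.
Qed.

Let domF k c : 0 < c -> exists G : Rvec R d -> R,
  [/\ forall y, 0 <= G y, gam.-integrable setT (EFin \o G)
    & forall t y, c < t -> t < 4 * c -> setT y -> `|F k t y| <= G y].
Proof.
move=> c0; have [C C0 HC] := poissonn_le mf If k; have c20 : 0 < c / 2 by rewrite divr_gt0.
have [i _] := phP_add_phK mfa fa0 If x a0 c20.
have K0 : 0 <= C * c ^- k * 4 by rewrite !mulr_ge0// ?invr_ge0 ?exprn_ge0// ltW.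
have ph0 b y : 0 < b -> 0 <= fine (phP b (EFin \o fa) y).
  by move=> b0; rewrite fine_ge0// phP_ge0 ?(ltW b0)// => z; rewrite lee_fin.
exists (fun y => C * c ^- k * 4 * (fine (phK a x y) * fine (phP (c / 2) (EFin \o fa) y))); split.
- by move=> y; rewrite mulr_ge0// mulr_ge0// ph0.
- by have := integrableZl measurableT (C * c ^- k * 4) i; apply: eq_integrable.
move=> t y ct t4 _; rewrite /F normrM (ger0_norm (pk0 y)) mulrCA ler_wpM2l//.
have t0 := lt_trans c0 ct; have t20 : 0 < t / 2 by rewrite divr_gt0.
have mEfa : measurable_fun setT (EFin \o fa) by exact/measurable_EFinP.
have h1 : t ^- k <= c ^- k.
  by rewrite lef_pV2 ?posrE ?exprn_gt0// lerXn2r ?nnegrE ?(ltW c0) ?(ltW t0)// ltW.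
have h2 : fine (phP (t / 2) (EFin \o fa) y) <= 4 * fine (phP (c / 2) (EFin \o fa) y).
  apply: (@le_trans _ _ (t / 2 / (c / 2) * fine (phP (c / 2) (EFin \o fa) y))).
    have e1 := phP_fineK mfa fa0 If y t20; have e2 := phP_fineK mfa fa0 If y c20.
    rewrite -lee_fin EFinM [leLHS]e1 [X in (_ * X)%E]e2.
    by apply: phP_le => //; rewrite ler_pM2r// ltW.
  apply: ler_wpM2r; first exact: ph0.
  by rewrite ler_pdivrMr// mulrA ler_wpM2r// ltW.
have h3 : `|poissonn f k t y| <= C * t ^- k * fine (phP (t / 2) (EFin \o fa) y).
  have e1 := phP_fineK mfa fa0 If y t20.
  by rewrite -lee_fin EFinM [X in (_ <= _ * X)%E]e1; exact: HC.
suff H (u v w : R) : u <= 4 * v -> w <= C * t ^- k * u -> 0 <= u ->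
    w <= C * c ^- k * 4 * v by exact: (H _ _ _ h2 h3 (ph0 _ y t20)).
move=> uv wu u0; apply: (le_trans wu); rewrite -[leRHS]mulrA; apply: ler_pM => //.
- by rewrite mulr_ge0// ?(ltW C0)// invr_ge0 exprn_ge0// ltW.
- by rewrite ler_pM2l.
Qed.

(** The induction differentiates both sides in b with a fixed: the left side by the chain rule, the
    right side under the integral against the kernel. The case k = 0 is the semigroup law for the
    positive and negative parts. *)
Lemma poissonn_semigroup k b : 0 < b ->
  poissonn f k (a + b) x = \int[gam]_y (fine (phK a x y) * poissonn f k b y).
Proof.
elim: k b => [|k IH] b b0.
  pose fp y := Num.max (f y) 0; pose fm y := Num.max (- f y) 0.
  have mfp : measurable_fun setT fp by exact: measurable_maxr.
  have mfm : measurable_fun setT fm by apply: measurable_maxr => //; exact: measurableT_comp.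
  have fp0 y : 0 <= fp y by rewrite le_max lexx orbT.
  have fm0 y : 0 <= fm y by rewrite le_max lexx orbT.
  have Ifp : (\int[gam]_y (fp y)%:E < +oo)%E.
    apply: le_lt_trans If; apply: ge0_le_lower_integral => y _; rewrite lee_fin//.
    by rewrite ge_max ler_norm normr_ge0.
  have Ifm : (\int[gam]_y (fm y)%:E < +oo)%E.
    apply: le_lt_trans If; apply: ge0_le_lower_integral => y _; rewrite lee_fin//.
    by rewrite ge_max -normrN ler_norm normr_ge0.
  have [ip ep] := phP_add_phK mfp fp0 Ifp x a0 b0.
  have [im em] := phP_add_phK mfm fm0 Ifm x a0 b0.
  have e (t : R) z : 0 < t -> poissonn f 0 t z =
      fine (phP t (EFin \o fp) z) - fine (phP t (EFin \o fm) z).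
    exact: (poissonn0 mf If).
  rewrite [LHS](e _ _ (addr_gt0 a0 b0)).
  rewrite [X in X - _]ep [X in _ - X]em.
  rewrite -[LHS](RintegralB measurableT ip im).
  by apply: eq_Rintegral => y _; rewrite (e _ _ b0) mulrBr.
have d1 := is_derive_iterated measurableT dF mF domF k b0.
rewrite -[RHS]/(\int[gam]_y F k.+1 b y) -(@derive_val _ _ _ _ _ _ _ d1).
have ab0 : 0 < a + b by rewrite addr_gt0.
have da : is_derive b (1 : R) (fun b => a + b) 1.
  by have := is_deriveD (is_derive_cst a b (1 : R)) (is_derive_id b (1 : R)); rewrite add0r.
have d2 := @is_derive1_comp _ (fun t => poissonn f k t x) (fun b => a + b) _ _ _
  (is_derive_poissonn mf If x k ab0) da.
rewrite mulr1 in d2; rewrite -(@derive_val _ _ _ _ _ _ _ d2).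
apply: near_eq_derive; near=> u; rewrite /= IH//.
by near: u; exact: lt_nbhsr.
Unshelve. all: by end_near. Qed.

Lemma poissonn_semigroup_le k b : 0 < b ->
  ((`|poissonn f k (a + b) x|)%:E <= phP a (fun y => (`|poissonn f k b y|)%:E) x)%E.
Proof.
move=> b0; rewrite poissonn_semigroup//.
have iF := integrable_iterated measurableT mF domF k b0.
rewrite EFin_normr_Rintegral// phP_phK//; last 2 first.
- exact: ltW.
- apply/measurable_EFinP; apply: measurableT_comp => //; exact: measurable_poissonn.
apply: (le_trans (le_abse_integral _ measurableT _)); first exact: measurable_int iF.
rewrite le_eqVlt; apply/orP; left; apply/eqP; apply: eq_integral => y _.
rewrite abse_EFin normrM (ger0_norm (pk0 y)) EFinM.
by congr (_ * _)%E; exact: phK_fineK.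
Qed.

End kernel.

(** The mean value theorem gives a time c in ]t, 2t[. Writing the derivative at c as P_{c - t/2}
    applied to the one at t/2 moves the unknown c into the operator, and c - t/2 <= 3 (t/2) then
    gives the factor 3 by [phP_le]. *)
Lemma poissonn_increment_le k t x : 0 < t ->
  ((`|poissonn f k (2 * t) x - poissonn f k t x|)%:E <=
   (3 * t)%:E * phP (t / 2) (fun y => (`|poissonn f k.+1 (t / 2) y|)%:E) x)%E.
Proof.
move=> t0; have t20 : 0 < t / 2 by rewrite divr_gt0.
have tt : t < 2 * t by rewrite ltr_pMl// ltr1n.
have dU s : t < s -> is_derive s (1 : R) (fun t => poissonn f k t x) (poissonn f k.+1 s x).
  by move=> ts; apply: is_derive_poissonn => //; exact: lt_trans ts.
have dU' s : t <= s -> is_derive s (1 : R) (fun t => poissonn f k t x) (poissonn f k.+1 s x).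
  by move=> ts; apply: is_derive_poissonn => //; exact: lt_le_trans ts.
have [||c] := @MVT _ (fun t => poissonn f k t x) (fun t => poissonn f k.+1 t x) _ _ tt.
- by move=> s; rewrite in_itv/= => /andP[ts _]; exact: dU.
- apply: derivable_within_continuous => s; rewrite in_itv/= => /andP[ts _].
  by have := dU' _ ts => ?; exact: ex_derive.
rewrite in_itv/= => /andP[tc c2] ->.
have ct : 2 * t - t = t by ring.
have mU : measurable_fun setT (fun y => (`|poissonn f k.+1 (t / 2) y|)%:E).
  by apply/measurable_EFinP; apply: measurableT_comp => //; exact: measurable_poissonn.
have U0 y : (0 <= (`|poissonn f k.+1 (t / 2) y|)%:E)%E by rewrite lee_fin.
rewrite ct normrM (gtr0_norm t0) mulrC [(3 * t)%R]mulrC !EFinM -muleA.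
apply: lee_wpmul2l; first by rewrite lee_fin ltW.
have a0 : 0 < c - t / 2 by lra.
have := poissonn_semigroup_le x a0 k.+1 t20; rewrite subrK => /le_trans; apply.
apply: (le_trans (phP_le x t20 _ mU U0)); first lra.
apply: lee_wpmul2r; first by apply: phP_ge0 => //; exact: ltW.
by rewrite lee_fin ler_pdivrMr//; lra.
Qed.

End poisson_derivatives.

(** * Norms of the time derivatives *)

Section convexity.
Context {R : realType}.

Lemma powR_convex (q th a b : R) : 1 <= q -> 0 <= th <= 1 -> 0 <= a -> 0 <= b ->
  (th * a + (1 - th) * b) `^ q <= th * a `^ q + (1 - th) * b `^ q.
Proof.
move=> q1 /andP[t0 t1] a0 b0.
have := @convex_powR R q q1 (Itv01 t0 t1) a b.
rewrite !inE/= !in_itv/= !andbT => /(_ a0 b0).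
by rewrite !convRE.
Qed.

End convexity.

Section var_norm_elementary.
Context dT (T : measurableType dT) (R : realType).
Variables (nu : {measure set T -> \bar R}) (D : set T) (q : T -> R).
Implicit Types u v : T -> \bar R.

Lemma var_norm_ltP u (a : \bar R) : (var_norm nu D q u < a)%E ->
  exists l : R, [/\ 0 < l, (l%:E < a)%E &
    (\int[nu]_(x in D) (`|u x| * (l^-1)%:E) `^ (q x) <= 1)%E].
Proof. by move=> /ereal_inf_lt[_ [l [l0 ul] <-] la]; exists l. Qed.

Lemma var_norm_le_modular u (l : R) : 0 < l ->
  (\int[nu]_(x in D) (`|u x| * (l^-1)%:E) `^ (q x) <= 1)%E ->
  (var_norm nu D q u <= l%:E)%E.
Proof. by move=> l0 ul; apply: ereal_inf_lbound; exists l. Qed.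

Lemma eq_var_norm u v : (forall x, D x -> u x = v x) ->
  var_norm nu D q u = var_norm nu D q v.
Proof.
move=> uv; rewrite /var_norm; congr (ereal_inf (image _ _)).
apply/funext => l /=; congr (_ /\ is_true (_ <= 1)%E).
by apply: eq_integral => x; rewrite inE => Dx; rewrite uv.
Qed.

End var_norm_elementary.

Section var_norm_facts.
Context dT (T : measurableType dT) (R : realType).
Variables (nu : {measure set T -> \bar R}) (p : T -> R).
Hypothesis p1 : forall x, 1 <= p x.
Local Notation vn := (var_norm nu setT p).

Lemma var_norm_ge0 (u : T -> \bar R) : (0 <= vn u)%E.
Proof. by apply: le_ereal_inf_tmp => _ [l [l0 _] <-]; rewrite lee_fin ltW. Qed.

Lemma var_norm_le_scale (u g : T -> \bar R) (K : R) : 0 < K ->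
  (forall l, 0 < l -> (\int[nu]_x (`|g x| * (l^-1)%:E) `^ (p x) <= 1)%E ->
    (vn u <= (K * l)%:E)%E) ->
  (vn u <= K%:E * vn g)%E.
Proof.
move=> K0 H; rewrite muleC -lee_pdivrMr//.
apply: le_ereal_inf_tmp => _ [l [l0 gl] <-].
rewrite lee_pdivrMr// -EFinM mulrC; exact: H.
Qed.

(** Convexity of the power with weights l1 / (l1 + l2) and l2 / (l1 + l2). Strict bounds provide
    admissible [l1] and [l2] without the infimum having to be attained. *)
Lemma var_norm_triangle (u u1 u2 : T -> R) (a b : R) :
  measurable_fun setT u1 -> measurable_fun setT u2 -> measurable_fun setT p ->
  (forall x, `|u x| <= `|u1 x| + `|u2 x|) ->
  (vn (EFin \o u1) < a%:E)%E -> (vn (EFin \o u2) < b%:E)%E ->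
  (vn (EFin \o u) < (a + b)%:E)%E.
Proof.
move=> m1 m2 mp uu /var_norm_ltP[l1 [l10 l1a H1]] /var_norm_ltP[l2 [l20 l2b H2]].
have l12 : 0 < l1 + l2 by rewrite addr_gt0.
apply: (@le_lt_trans _ _ (l1 + l2)%:E); last first.
  by rewrite lte_fin ltrD// -lte_fin.
apply: (var_norm_le_modular l12).
set th := l1 / (l1 + l2).
have th1 : 1 - th = l2 / (l1 + l2) by rewrite /th; field; rewrite gt_eqF.
have th0 : 0 < th by rewrite divr_gt0.
have th10 : 0 < 1 - th by rewrite th1 divr_gt0.
pose F1 x := (`|u1 x| / l1) `^ p x; pose F2 x := (`|u2 x| / l2) `^ p x.
have mF (v : T -> R) (l : R) : measurable_fun setT v ->
    measurable_fun setT (fun x => ((`|v x| / l) `^ p x)%:E).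
  move=> mv; apply/measurable_EFinP; apply: measurable_fun_powR2 => //.
  by apply: measurable_funM => //; exact: measurableT_comp.
apply: (@le_trans _ _ (\int[nu]_x (th%:E * (F1 x)%:E + (1 - th)%:E * (F2 x)%:E))%E).
  apply: ge0_le_lower_integral => x _; first exact: poweR_ge0.
  rewrite abse_EFin -EFinM poweR_EFin -!EFinM -EFinD lee_fin.
  apply: (@le_trans _ _ ((th * (`|u1 x| / l1) + (1 - th) * (`|u2 x| / l2)) `^ p x)).
    rewrite ge0_ler_powR ?nnegrE ?(le_trans _ (p1 x))//.
    - by rewrite mulr_ge0// invr_ge0 ltW.
    - by rewrite addr_ge0// mulr_ge0 ?divr_ge0 ?(ltW th0) ?(ltW th10)// ltW.
    rewrite th1 /th (_ : l1 / _ * _ + _ = (`|u1 x| + `|u2 x|) / (l1 + l2)); last first.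
      by field; rewrite !gt_eqF.
    by rewrite ler_wpM2r// invr_ge0 ltW.
  apply: powR_convex; rewrite ?(ltW th0)//.
  - by rewrite -subr_ge0 ltW.
  - by rewrite divr_ge0// ltW.
  - by rewrite divr_ge0// ltW.
rewrite ge0_integralD//; last 4 first.
- by move=> x _; rewrite mule_ge0// lee_fin ?powR_ge0// ltW.
- by apply: emeasurable_funM => //; exact: mF.
- by move=> x _; rewrite mule_ge0// lee_fin ?powR_ge0// ltW.
- by apply: emeasurable_funM => //; exact: mF.
rewrite ge0_integralZl_EFin//; last 3 first.
- by move=> x _; rewrite lee_fin powR_ge0.
- exact: mF.
- exact: ltW.
rewrite ge0_integralZl_EFin//; last 3 first.
- by move=> x _; rewrite lee_fin powR_ge0.
- exact: mF.
- exact: ltW.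
have Fle (v : T -> R) (l : R) : (\int[nu]_x (`|(v x)%:E| * (l^-1)%:E) `^ (p x) <= 1)%E ->
    (\int[nu]_x ((`|v x| / l) `^ p x)%:E <= 1)%E.
  apply: le_trans; rewrite le_eqVlt; apply/orP; left; apply/eqP.
  by apply: eq_integral => x _; rewrite abse_EFin -EFinM poweR_EFin.
have {}H1 := Fle _ _ H1; have {}H2 := Fle _ _ H2.
apply: (@le_trans _ _ (th%:E * 1 + (1 - th)%:E * 1)%E).
  apply: leeD; [move: H1|move: H2]; rewrite /F1 /F2; move: (integral _ _ _) => I I1.
    by apply: lee_wpmul2l => //; rewrite lee_fin ltW.
  by apply: lee_wpmul2l => //; rewrite lee_fin ltW.
by rewrite !mule1 -EFinD addrC subrK.
Qed.

End var_norm_facts.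

Section derivative_norms.
Context {R : realType} {d : nat}.
Local Notation gam := (@gauss_measure R d).
Variables (p : Rvec R d -> R) (C : R).
Hypotheses (mp : measurable_fun setT p) (p1 : forall x, 1 <= p x).
Hypothesis C0 : 0 < C.
Local Notation vn := (var_norm gam setT p).
Hypothesis HC : forall (f : Rvec R d -> R) (l : R),
  measurable_fun setT f -> 0 < l ->
  (\int[gam]_x (`|(f x)%:E| * (l^-1)%:E) `^ (p x) <= 1)%E ->
  forall (t k : R) (u : Rvec R d -> \bar R), 0 < t -> 0 < k ->
  (forall x, `|u x| <= k%:E * phP t (fun y => (`|f y|)%:E) x)%E ->
  (vn u <= (k * C * l)%:E)%E.

Lemma var_norm_phP_bound (f : Rvec R d -> R) (u : Rvec R d -> \bar R) (t k : R) :
  measurable_fun setT f -> 0 < t -> 0 < k ->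
  (forall x, `|u x| <= k%:E * phP t (fun y => (`|f y|)%:E) x)%E ->
  (vn u <= (k * C)%:E * vn (EFin \o f))%E.
Proof.
move=> mf t0 k0 uf; apply: var_norm_le_scale; first exact: mulr_gt0.
by move=> l l0 fl; exact: (HC mf l0 fl t0 k0 uf).
Qed.

Variable f : Rvec R d -> R.
Hypothesis mf : measurable_fun setT f.
Hypothesis f_fin : (vn (EFin \o f) < +oo)%E.

(** For v >= 0 one has v <= 1 + v^{p x}, and gamma is a probability measure. *)
Lemma integrable_var_Lp : (\int[gam]_y (`|f y|)%:E < +oo)%E.
Proof.
have [l [l0 _ fl]] := var_norm_ltP f_fin.
have mF : measurable_fun setT (fun x => ((`|f x| / l) `^ p x)%:E).
  apply/measurable_EFinP; apply: measurable_fun_powR2 => //.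
  by apply: measurable_funM => //; exact: measurableT_comp.
apply: (@le_lt_trans _ _ (\int[gam]_x (l%:E * (1 + ((`|f x| / l) `^ p x)%:E)))%E).
  apply: ge0_le_lower_integral => x _; first by rewrite lee_fin.
  rewrite -EFinD -EFinM lee_fin mulrC -ler_pdivrMr//.
  have [x1|x1] := lerP (`|f x| / l) 1.
    by rewrite (le_trans x1)// lerDl powR_ge0.
  rewrite (@le_trans _ _ ((`|f x| / l) `^ p x))// ?lerDr//.
  by rewrite -[leLHS]powRr1 ?(le_trans _ (ltW x1))// ler_powR// ltW.
rewrite ge0_integralZl//; last 3 first.
- by apply: emeasurable_funD.
- by move=> x _; rewrite adde_ge0// lee_fin powR_ge0.
- by rewrite lee_fin ltW.
rewrite ge0_integralD//; last by move=> x _; rewrite lee_fin powR_ge0.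
rewrite integral_cst// mul1e gauss_measure_setT.
apply: (@le_lt_trans _ _ (l%:E * (1 + 1))%E); last by rewrite -EFinD -EFinM ltry.
by apply: lee_wpmul2l; [rewrite lee_fin ltW|exact: leeD].
Qed.

Definition poisson_norm k (t : R) : R := fine (vn (fun x => (poissonn f k t x)%:E)).
Local Notation g := poisson_norm.
Local Notation N := (fine (vn (EFin \o f))).

Let NK : vn (EFin \o f) = N%:E.
Proof. by rewrite fineK// ge0_fin_numE// var_norm_ge0. Qed.

Lemma poisson_norm_ge0 k t : 0 <= g k t.
Proof. by apply: fine_ge0; exact: var_norm_ge0. Qed.

Let norm_le k : exists2 A, 0 <= A & forall t, 0 < t ->
  (vn (fun x => (poissonn f k t x)%:E) <= (A * t ^- k)%:E)%E.
Proof.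
have [A A0 HA] := poissonn_le mf integrable_var_Lp k.
exists (A * C * N).
  by rewrite mulr_ge0 ?fine_ge0 ?var_norm_ge0// mulr_ge0 ?ltW.
move=> t t0; have tk : 0 < t ^- k by rewrite invr_gt0 exprn_gt0.
have t20 : 0 < t / 2 by rewrite divr_gt0.
apply: (le_trans (var_norm_phP_bound (u := fun x => (poissonn f k t x)%:E)
  mf t20 (mulr_gt0 A0 tk) _)).
  by move=> x; exact: HA.
by rewrite NK -EFinM lee_fin le_eqVlt; apply/orP; left; apply/eqP; ring.
Qed.

Lemma poisson_normK k t : 0 < t ->
  vn (fun x => (poissonn f k t x)%:E) = (g k t)%:E.
Proof.
move=> t0; have [A A0 HA] := norm_le k.
have := le_lt_trans (HA _ t0) (ltry _).
rewrite /poisson_norm; move: (var_norm_ge0 gam p (fun x => (poissonn f k t x)%:E)).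
by move: (vn _) => v v0 vy; rewrite fineK// ge0_fin_numE.
Qed.

Lemma poisson_norm_le k : exists2 A, 0 <= A & forall t, 0 < t -> g k t <= A * t ^- k.
Proof.
have [A A0 HA] := norm_le k; exists A => // t t0.
by rewrite -lee_fin -poisson_normK// HA.
Qed.

Lemma poisson_norm_decr k s t : 0 < s -> s < t -> g k t <= C * g k s.
Proof.
move=> s0 st; have t0 := lt_trans s0 st.
rewrite -lee_fin -poisson_normK// EFinM -poisson_normK// -[X in (X%:E * _)%E]mul1r.
have ts : 0 < t - s by rewrite subr_gt0.
apply: (var_norm_phP_bound _ ts) => //; first exact: measurable_poissonn.
move=> x; rewrite mul1e abse_EFin.
by have := poissonn_semigroup_le mf integrable_var_Lp x ts k s0; rewrite subrK.
Qed.

Lemma poisson_norm_step k t : 0 < t ->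
  g k t <= g k (2 * t) + 3 * t * C * g k.+1 (t / 2).
Proof.
move=> t0; have t20 : 0 < t / 2 by rewrite divr_gt0.
have tt0 : 0 < 2 * t by rewrite mulr_gt0.
(* The margin [e] is there to meet the strict bounds of the triangle inequality. *)
apply/ler_addgt0Pr => e e0; rewrite -lee_fin -poisson_normK//.
set u2 := fun x => poissonn f k (2 * t) x - poissonn f k t x.
have h2 : (vn (EFin \o u2) <= (3 * t * C)%:E * (g k.+1 (t / 2))%:E)%E.
  rewrite -poisson_normK//; apply: (var_norm_phP_bound _ t20).
  - exact: measurable_poissonn.
  - by rewrite mulr_gt0.
  by move=> x; have := poissonn_increment_le mf integrable_var_Lp k x t0.
rewrite [e]splitr addrACA; apply: ltW.
apply: (@var_norm_triangle _ _ _ gam p p1 _ (poissonn f k (2 * t)) u2) => //.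
- exact: measurable_poissonn.
- by apply: measurable_funB; exact: measurable_poissonn.
- move=> x; rewrite (_ : poissonn f k t x = poissonn f k (2 * t) x - u2 x).
    exact: ler_normB.
  by rewrite /u2 subKr.
- by rewrite poisson_normK// lte_fin ltrDl divr_gt0.
- by rewrite (le_lt_trans h2)// -EFinM lte_fin ltrDl divr_gt0.
Qed.

End derivative_norms.

(** * Norms in the time variable *)

Section dyadic_iteration.
Context {R : realType}.

(** Doubling t up to the scale of 1 sums the errors c t^(-dl). As dl > 0 they form a geometric
    series dominated by the smallest scale, so no power of t is lost. *)
Lemma dyadic_step (a b : R -> R) (j : nat) (beta C M A0 : R) :
  0 < C -> beta < j%:R -> 0 <= M -> 0 <= A0 ->
  (forall t, 0 < t <= 1 -> b t <= M * t `^ (beta - j.+1%:R)) ->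
  (forall t, 0 < t -> a t <= a (2 * t) + 3 * t * C * b (t / 2)) ->
  (forall t, 0 < t -> a t <= A0 * t ^- j) ->
  exists2 A, 0 <= A & forall t, 0 < t <= 1 -> a t <= A * t `^ (beta - j%:R).
Proof.
move=> C0 bj M0 A00 bM ab aA.
set dl := j%:R - beta; have dl0 : 0 < dl by rewrite subr_gt0.
have -> : beta - j%:R = - dl by rewrite /dl opprB.
(* This is the constant in 3 t C M (t/2)^(-(1 + dl)) = c t^(-dl). *)
set c := 3 * C * M * 2 `^ (1 + dl).
have c0 : 0 <= c by rewrite !mulr_ge0// ?powR_ge0// ltW.
have r1 : 0 < 1 - 2 `^ (- dl) :> R.
  have := @gt0_ltr_powR R dl dl0 1 2; rewrite !nnegrE powR1 => /(_ ler01 (ler0n _ _)).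
  by rewrite subr_gt0 powRN invf_lt1 ?powR_gt0// => -> //; rewrite ltr1n.
(* A satisfies A * 2 `^ (- dl) + c <= A, which closes the induction over dyadic scales. *)
set A := A0 * 2 ^+ j + c / (1 - 2 `^ (- dl)).
have A_ge0 : 0 <= A by rewrite addr_ge0 ?divr_ge0 ?mulr_ge0 ?exprn_ge0// ltW.
have A_ge : A * 2 `^ (- dl) + c <= A.
  rewrite -lerBrDl -[X in _ <= X - _]mulr1 -mulrBr mulrDl divfK ?gt_eqF//.
  by rewrite lerDr !mulr_ge0 ?exprn_ge0// ltW.
have ab' t : 0 < t <= 1 -> a t <= a (2 * t) + c * t `^ (- dl).
  move=> /andP[t0 t1]; apply: (le_trans (ab t t0)); rewrite lerD2l.
  apply: (@le_trans _ _ (3 * t * C * (M * (t / 2) `^ (beta - j.+1%:R)))).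
    apply: ler_wpM2l; first by rewrite !mulr_ge0// ltW.
    by apply: bM; rewrite divr_gt0// ler_pdivrMr//; lra.
  have -> : beta - j.+1%:R = - (1 + dl) by rewrite /dl -natr1; ring.
  rewrite powRM ?invr_ge0 ?(ltW t0)// -[2^-1]powR_inv1// -powRrM mulN1r opprK.
  rewrite opprD powRD; last by rewrite (gt_eqF t0) implybT.
  rewrite powR_inv1 ?(ltW t0)// /c le_eqVlt; apply/orP; left; apply/eqP.
  by move: (_ `^ _) (_ `^ _) => u v; field; rewrite gt_eqF.
exists A => // t /andP[t0 t1].
have H n : forall t, 2^-1 ^+ n.+1 < t <= 1 -> a t <= A * t `^ (- dl).
  (* On ]1/2, 1] the a priori bound [aA] starts the induction and accounts for the summand A0 2^j of
     [A]; points at smaller scales are doubled. *)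
  elim: n => [|n IH] s /andP[s0 s1].
    have {}s0 : 2^-1 < s by rewrite -[_^-1]expr1.
    have sp : 0 < s by rewrite (lt_trans _ s0)// invr_gt0.
    apply: (le_trans (aA _ sp)).
    have s2 : s ^- j <= 2 ^+ j.
      rewrite -exprVn lerXn2r ?nnegrE ?invr_ge0 ?(ltW sp)//.
      by rewrite invf_ple ?posrE// ltW.
    have sd : 1 <= s `^ (- dl).
      by rewrite -[leLHS](@powRr0 _ s) ger_powR ?sp// oppr_le0 ltW.
    apply: (@le_trans _ _ (A * 1)); last by rewrite ler_wpM2l.
    rewrite mulr1 (le_trans (ler_wpM2l A00 s2))// lerDl.
    by rewrite divr_ge0// ltW.
  have sp : 0 < s by rewrite (le_lt_trans _ s0)// exprn_ge0// invr_ge0.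
  have [s2|s2] := lerP s 2^-1; last first.
    apply: IH; rewrite s1 andbT (le_lt_trans _ s2)// exprSr.
    by rewrite ler_piMl ?invr_ge0// exprn_ile1// ?invr_ge0// invf_le1// ler1n.
  apply: (le_trans (ab' _ _)); first by rewrite sp.
  have : a (2 * s) <= A * (2 * s) `^ (- dl).
    apply: IH; rewrite mulrC -ler_pdivlMr// div1r s2 andbT.
    by rewrite -ltr_pdivrMr// -exprSr.
  rewrite powRM ?(ltW sp)// => as2.
  apply: (le_trans (lerD as2 (lexx _))).
  by rewrite mulrA -mulrDl ler_wpM2r// powR_ge0.
have [n nt] : exists n, 2^-1 ^+ n.+1 < t.
  exists (Num.truncn t^-1); set n := Num.truncn _.
  have tn : t^-1 < n.+1%:R by exact: truncnS_gt.
  rewrite exprVn invf_plt ?posrE ?exprn_gt0// (lt_trans tn)//.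
  by rewrite -natrX ltr_nat ltn_expl.
by apply: (H n); rewrite nt.
Qed.

(** Each step lowers the order of differentiation by one; beta < k2 keeps the exponent of t negative
    at every order met on the way. *)
Lemma dyadic_descent (g : nat -> R -> R) (k1 k2 : nat) (beta C M : R) :
  0 < C -> 0 <= M -> (k2 <= k1)%N -> beta < k2%:R ->
  (forall k, exists2 A, 0 <= A & forall t, 0 < t -> g k t <= A * t ^- k) ->
  (forall k t, 0 < t -> g k t <= g k (2 * t) + 3 * t * C * g k.+1 (t / 2)) ->
  (forall t, 0 < t <= 1 -> g k1 t <= M * t `^ (beta - k1%:R)) ->
  exists2 A, 0 <= A & forall t, 0 < t <= 1 -> g k2 t <= A * t `^ (beta - k2%:R).
Proof.
move=> C0 M0 + + gA gs; move=> /subnK <-; set m := (k1 - k2)%N; move: m M M0.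
elim=> [|m IH] M M0 bk gM; first by exists M.
have bm : beta < (m + k2)%N%:R by rewrite (lt_le_trans bk)// ler_nat leq_addl.
have [A0 A00 HA0] := gA (m + k2)%N.
have [A A_ge0 HA] := dyadic_step C0 bm M0 A00 gM (gs _) HA0.
exact: (IH A).
Qed.

End dyadic_iteration.

(** * The measure dt/t *)

Section haar.
Context {R : realType}.
Local Notation leb := (@lebesgue_measure R).
Local Notation haar := (@haar_measure R).
Local Notation mR := (measurableTypeR R).

Lemma haar_null (N : set mR) : measurable N -> leb N = 0%E -> haar N = 0%E.
Proof.
move=> mN N0; rewrite /= /mdensity; apply: null_set_integral => //.
by apply/measurable_EFinP; apply: measurable_funTS; exact: measurable_haar_density.
Qed.

(** The density is at least 1/t on an interval of length t/2. The exact measure is ln 2; the set [N]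
    is meant for the points where an exponent drops below 1. *)
Lemma haar_dyadic_ge (t : R) (N : set mR) : 0 < t -> measurable N -> leb N = 0%E ->
  ((2^-1)%:E <= haar (`](t / 2)%R, t[%classic `\` N))%E.
Proof.
move=> t0 mN N0; set I : set mR := `]t / 2, t[%classic.
have mI : measurable I by exact: measurable_itv.
have lI0 : leb I = (t / 2)%:E.
  rewrite /I lebesgue_measure_itv/= lte_fin ltr_pdivrMr// ltr_pMr// ltr1n -EFinD.
  by congr _%:E; field.
have lI : leb (I `\` N) = (t / 2)%:E.
  rewrite measureD//; last by rewrite [X in (X < _)%E]lI0 ltry.
  rewrite [X in (_ - X)%E](@subset_measure0 _ _ _ leb (I `&` N) N)//; last exact: measurableI.
  by rewrite sube0 [LHS]lI0.
rewrite /= /mdensity.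
apply: (@le_trans _ _ (\int[leb]_(s in I `\` N) (t^-1)%:E)%E).
  rewrite integral_cst//; last exact: measurableD.
  by rewrite [X in (_ * X)%E]lI -EFinM lee_fin mulrA mulVf ?gt_eqF// mul1r.
apply: ge0_le_lower_integral => s []; rewrite /I/= in_itv/= => /andP[ts st] _.
  by rewrite lee_fin invr_ge0 ltW.
have s0 : 0 < s by rewrite (lt_trans _ ts)// divr_gt0.
rewrite /haar_density indicE mem_set ?mulr1; last by rewrite /Rpos/= in_itv/= s0.
by rewrite lee_fin lef_pV2 ?posrE// ltW.
Qed.

Lemma ge0_integral_haar_Rpos (f : R -> R) : measurable_fun setT f -> (forall t, 0 <= f t) ->
  (\int[haar]_(t in Rpos) (f t)%:E <= \int[leb]_(t in Rpos) (f t / t)%:E)%E.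
Proof.
move=> mf f0; have mf' : measurable_fun setT (EFin \o f) by exact/measurable_EFinP.
apply: (@le_trans _ _ (\int[haar]_t (f t)%:E)%E).
  by apply: ge0_subset_integral => //; [exact: measurable_Rpos|move=> x _; rewrite lee_fin].
rewrite (ge0_integral_mdensity leb haar_density_ge0 measurable_haar_density mf'); last first.
  by move=> x; rewrite lee_fin.
rewrite [leRHS]integral_mkcond le_eqVlt; apply/orP; left; apply/eqP.
apply: eq_integral => t _; rewrite /= patchE /haar_density indicE.
by case: ifPn => _; rewrite ?mulr1 ?mulr0 -EFinM ?mulr0.
Qed.

(** The integrand is a substitute for min(t^dl, t^(-dl)), comparable to it up to a factor 4, with
    the explicit primitive -1 / (dl (1 + t^dl)) for dt/t. *)
Lemma integral_haar_bump_le (dl : R) : 0 < dl ->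
  (\int[haar]_(t in Rpos) (t `^ dl / (1 + t `^ dl) ^+ 2)%:E <= (dl^-1)%:E)%E.
Proof.
move=> dl0.
have P0 (t : R) : 0 < 1 + t `^ dl by rewrite ltr_pwDl ?powR_ge0.
have mP : measurable_fun setT (fun t : R => t `^ dl) by exact: measurable_powR.
apply: (@le_trans _ _ (\int[leb]_(t in Rpos) (t `^ dl / (1 + t `^ dl) ^+ 2 / t)%:E)%E).
  apply: ge0_integral_haar_Rpos => [|t]; last by rewrite divr_ge0 ?powR_ge0 ?sqr_ge0.
  apply: measurable_funM => //; apply: measurable_funVr.
  by apply: measurable_funX; apply: measurable_funD.
have dpow (x : R) : 0 < x -> is_derive x (1 : R) (fun t => t `^ dl) (dl * x `^ (dl - 1)).
  by move=> x0; exact: is_derive1_powR.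
have dF (x : R) : Rpos x -> is_derive x (1 : R) (fun t => - dl^-1 * (1 + t `^ dl)^-1)
    (x `^ dl / (1 + x `^ dl) ^+ 2 / x).
  rewrite /Rpos/= in_itv/= andbT => x0.
  have d1 := dpow x x0.
  have n0 : 1 + x `^ dl != 0 by rewrite gt_eqF.
  have d2 : is_derive x (1 : R) (fun t => 1 + t `^ dl) (dl * x `^ (dl - 1)).
    by rewrite -[dl * _]add0r; exact: (is_deriveD (is_derive_cst (1 : R) x (1 : R)) d1).
  have d3 := @is_deriveV R (fun t => 1 + t `^ dl) x _ (1 : R) n0 d2.
  apply: (is_derive_eq (is_deriveZ (- dl^-1) d3)).
  have -> : x `^ (dl - 1) = x `^ dl / x.
    by rewrite powRD ?(gt_eqF x0) ?implybT// powR_inv1// ltW.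
  rewrite /GRing.scale/=; move: n0; move: (x `^ dl) => u u0.
  by field; rewrite u0 !gt_eqF.
apply: (ge0_FTC_exhausts_le exhausts_Rpos open_Rpos _ dF).
- by move=> x; rewrite /Rpos/= in_itv/= andbT => x0;
    rewrite !divr_ge0 ?powR_ge0 ?sqr_ge0// ltW.
- move=> x; rewrite /Rpos/= in_itv/= andbT => x0.
  have cp : {for x, continuous (fun t : R => t `^ dl)}.
    by apply: differentiable_continuous; apply/derivable1_diffP; have := dpow x x0 => ?; exact: ex_derive.
  apply: cvgM; last by apply: cvgV; [rewrite gt_eqF|exact: cvg_id].
  apply: cvgM => //; apply: cvgV; first by rewrite expf_neq0// gt_eqF.
  by rewrite expr2; under eq_fun do rewrite expr2; apply: cvgM; apply: cvgD => //; exact: cvg_cst.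
move=> x y _ _; rewrite !mulNr opprK addrC -mulrBr -[leRHS]mulr1 ler_wpM2l ?invr_ge0 ?(ltW dl0)//.
rewrite lerBlDr (@le_trans _ _ 1)// ?lerDl ?invr_ge0 ?(ltW (P0 _))//.
by rewrite invf_le1// lerDl powR_ge0.
Qed.

End haar.

Section haar_modular.
Context {R : realType}.
Local Notation leb := (@lebesgue_measure R).
Local Notation haar := (@haar_measure R).
Local Notation mR := (measurableTypeR R).

Let Rpos_gt0 (t : R) : Rpos t -> 0 < t.
Proof. by rewrite /Rpos/= in_itv/= andbT. Qed.

Let gt0_Rpos (t : R) : 0 < t -> Rpos t.
Proof. by rewrite /Rpos/= in_itv/= andbT. Qed.

Lemma P_zero_infty_ge1 (q : R -> R) : P_zero_infty q -> exists N : set mR,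
  [/\ measurable N, leb N = 0%E & forall t, 0 < t -> ~ N t -> 1 <= q t].
Proof.
move=> [_ _ [/ess_infP[N [mN N0 NP]] _ _] _]; exists (N `&` Rpos); split => //.
  by apply: measurableI => //; exact: measurable_Rpos.
move=> t t0 nN; apply: contrapT => qt; apply: nN; split; last exact: gt0_Rpos.
by apply: NP => /=; rewrite lee_fin.
Qed.

Local Notation modular q h l :=
  (\int[haar]_(t in Rpos) (`|(h t)%:E| * (l^-1)%:E) `^ (q t))%E.

(** The exponents are controlled only off a null set, and the functions of time need not be
    measurable; hence the detour through lower integrals. *)
Lemma le_haar_modular (q1 q2 h1 h2 : R -> R) (l1 l2 : R) (N : set mR) :
  measurable N -> leb N = 0%E ->
  (forall t, 0 < t -> ~ N t -> (`|h1 t| / l1) `^ q1 t <= (`|h2 t| / l2) `^ q2 t) ->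
  (modular q1 h1 l1 <= modular q2 h2 l2)%E.
Proof.
move=> mN N0 H.
apply: (@le_trans _ _ (\int[haar]_(t in Rpos `\` N) (`|(h1 t)%:E| * (l1^-1)%:E) `^ (q1 t))%E).
  by apply: ge0_lower_integral_setD_null => //; [exact: haar_null|move=> t _; exact: poweR_ge0].
rewrite integral_mkcond [leRHS]integral_mkcond.
apply: ge0_le_lower_integral => t _; rewrite !patchE.
  by case: ifP => _ //; exact: poweR_ge0.
case: ifPn; last by case: ifP => _ // _; exact: poweR_ge0.
rewrite inE => -[pt nt]; rewrite mem_set// !abse_EFin -!EFinM !poweR_EFin lee_fin.
by apply: H => //; exact: Rpos_gt0.
Qed.

(* On ]t / 2, t[, of Haar measure at least 1 / 2, the integrand dominates its value at t. *)
Lemma haar_modular_bounded (q g : R -> R) (kappa C l : R) :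
  P_zero_infty q -> 0 < C -> 0 < l -> 0 <= kappa <= 1 ->
  (forall t, 0 < t -> 0 <= g t) ->
  (forall s t, 0 < s -> s < t -> g t <= C * g s) ->
  (modular q (fun t => t `^ kappa * g t) l <= 1)%E ->
  forall t, 0 < t -> t `^ kappa * g t <= 4 * C * l.
Proof.
move=> /P_zero_infty_ge1[N [mN N0 qN]] C0 l0 /andP[k0 k1] g0 gC Hm t t0.
(* For t/2 < s < t, the bound kappa <= 1 loses a factor 2 and the quasi-monotonicity of [g] a factor
   [C], so the normalised function at s is at least v. If v > 2, its power with exponent q s >= 1 is
   at least v, and the modular exceeds 2 times 1/2. *)
set v := t `^ kappa * g t / (2 * C * l).
have cl : 0 < 2 * C * l by rewrite !mulr_gt0.
suff v2 : v <= 2.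
  by move: v2; rewrite /v ler_pdivrMr// !mulrA -natrM.
rewrite leNgt; apply/negP => v2.
have v0 : 0 < v by rewrite (lt_trans _ v2).
set A : set mR := `](t / 2), t[%classic `\` N.
have mA : measurable A by apply: measurableD => //; exact: measurable_itv.
have AR : A `<=` Rpos.
  move=> s [/=]; rewrite in_itv/= => /andP[ts _] _; apply: gt0_Rpos.
  by rewrite (lt_trans _ ts)// divr_gt0.
have : (v%:E * haar A <= modular q (fun t => t `^ kappa * g t) l)%E.
  rewrite -integral_cst// integral_mkcond [leRHS]integral_mkcond.
  apply: ge0_le_lower_integral => s _; rewrite !patchE.
    by case: ifP => _ //; rewrite lee_fin ltW.
  case: ifPn; last by case: ifP => _ // _; exact: poweR_ge0.
  rewrite inE => As; rewrite mem_set; last exact: AR.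
  move: (As) => -[/=]; rewrite in_itv/= => /andP[ts st] nN.
  have s0 : 0 < s by apply: Rpos_gt0; exact: AR.
  rewrite ?abse_EFin -?EFinM ?poweR_EFin lee_fin.
  have vs : v <= `|s `^ kappa * g s| / l.
    rewrite ger0_norm ?mulr_ge0 ?powR_ge0 ?g0//.
    rewrite ler_pdivlMr// (_ : v * l = t `^ kappa * g t / (2 * C)); last first.
      by rewrite /v; field; rewrite !gt_eqF.
    rewrite ler_pdivrMr ?mulr_gt0// mulrC.
    have gs := gC _ _ s0 st.
    have ps : t `^ kappa <= 2 * s `^ kappa.
      apply: (@le_trans _ _ ((2 * s) `^ kappa)).
        rewrite ge0_ler_powR ?nnegrE ?(ltW t0) ?mulr_ge0 ?(ltW s0)//.
        by rewrite mulrC -ler_pdivrMr// ltW.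
      rewrite powRM ?(ltW s0)// ler_wpM2r ?powR_ge0//.
      by rewrite -[leRHS]powRr1// ler_powR// ler1n.
    rewrite mulrC; apply: (@le_trans _ _ (2 * s `^ kappa * (C * g s))).
      by apply: ler_pM; rewrite ?powR_ge0 ?g0.
    by rewrite le_eqVlt; apply/orP; left; apply/eqP; ring.
  apply: (le_trans vs); rewrite -[leLHS]powRr1 ?(le_trans _ vs) ?(ltW v0)//.
  by rewrite ler_powR ?qN// (le_trans _ vs)// (le_trans _ (ltW v2))// ler1n.
move=> /le_trans/(_ Hm); rewrite leNgt => /negP; apply.
apply: (@lt_le_trans _ _ (v%:E * (2^-1)%:E)%E).
  by rewrite -EFinM lte_fin ltr_pdivlMr// mul1r.
by apply: lee_wpmul2l; [rewrite lee_fin ltW|exact: haar_dyadic_ge].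
Qed.

Lemma haar_var_norm_le_exponent (q1 q2 h : R -> R) (M l : R) :
  P_zero_infty q1 -> {ae leb, forall t : R, 0 < t -> q1 t <= q2 t} ->
  0 < l -> 0 <= M -> (forall t, 0 < t -> 0 <= h t <= M) ->
  (modular q1 h l <= 1)%E ->
  (var_norm haar Rpos q2 (EFin \o h) < +oo)%E.
Proof.
move=> [_ q10 _ _] [N [mN N0 NP]] l0 M0 hM Hm.
(* A constant above [M] makes the quotient at most 1, and one above [l] keeps its q1-modular at most
   1. *)
have L0 : 0 < M + l by rewrite ltr_wpDl.
apply: (@le_lt_trans _ _ (M + l)%:E); last exact: ltry.
apply: (var_norm_le_modular L0).
apply: le_trans Hm; apply: (le_haar_modular mN N0) => t t0 nN.
have q12 : q1 t <= q2 t.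
  by apply: contrapT => nq; apply: nN; apply: NP => /= H; apply: nq; exact: H.
have /andP[h0 h1] := hM _ t0; rewrite ger0_norm//.
apply: (@le_trans _ _ ((h t / (M + l)) `^ q1 t)); last first.
  rewrite ge0_ler_powR ?nnegrE ?divr_ge0 ?(ltW (q10 _ t0)) ?(ltW l0) ?(ltW L0)//.
  by rewrite ler_wpM2l// lef_pV2 ?posrE// lerDr.
have [h00|hn0] := eqVneq (h t) 0.
  by rewrite h00 mul0r !powR0 ?gt_eqF ?q10// (lt_le_trans _ q12)// q10.
rewrite ger_powR// divr_gt0//=; last by rewrite lt_def hn0.
by rewrite ler_pdivrMr// mul1r (le_trans h1)// lerDl ltW.
Qed.

Lemma haar_var_norm_bump (q h : R -> R) (K dl : R) : P_zero_infty q ->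
  0 < dl -> 0 <= K ->
  (forall t, 0 < t -> 0 <= h t <= K * (t `^ dl / (1 + t `^ dl) ^+ 2)) ->
  (var_norm haar Rpos q (EFin \o h) < +oo)%E.
Proof.
move=> /P_zero_infty_ge1[N [mN N0 qN]] dl0 K0 hK.
(* The summand [K] makes h / l <= 1, so that a power with exponent at least 1 only decreases it; the
   summand [K / dl] then bounds the integral by 1. *)
set l := K / dl + K + 1.
have l0 : 0 < l by rewrite ltr_wpDl// addr_ge0// divr_ge0// ltW.
apply: (@le_lt_trans _ _ l%:E); last exact: ltry.
apply: (var_norm_le_modular l0).
pose b t : R := t `^ dl / (1 + t `^ dl) ^+ 2.
have b0 t : 0 <= b t by rewrite divr_ge0 ?powR_ge0 ?sqr_ge0.
have b1 t : b t <= 1.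
  have u0 := powR_ge0 t dl.
  rewrite /b ler_pdivrMr ?mul1r ?exprn_gt0 ?ltr_pwDl//.
  by move: u0; move: (t `^ dl) => u u0; nra.
apply: (@le_trans _ _ (modular (fun=> 1%R) (fun t => K * b t) l)%E).
  apply: (le_haar_modular mN N0) => t t0 nN.
  have /andP[h0 h1] := hK _ t0.
  have Kb : 0 <= K * b t by rewrite mulr_ge0.
  rewrite (ger0_norm h0) (ger0_norm Kb) powRr1 ?divr_ge0 ?(ltW l0)//.
  apply: (@le_trans _ _ (h t / l)); last by rewrite ler_wpM2r// invr_ge0 ltW.
  have hl : h t / l <= 1.
    rewrite ler_pdivrMr// mul1r (le_trans h1)// (@le_trans _ _ K)//.
      exact: ler_piMr (b1 t).
    by rewrite /l -addrA addrC -addrA lerDl addr_ge0// divr_ge0// ltW.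
  have [h00|hn0] := eqVneq (h t) 0.
    by rewrite h00 mul0r powR0// gt_eqF// (lt_le_trans _ (qN _ t0 nN)).
  rewrite -[leRHS]powRr1 ?divr_ge0 ?(ltW l0)// ger_powR ?qN// hl andbT.
  by rewrite divr_gt0// lt_def hn0.
have Kl0 : 0 <= K / l by rewrite divr_ge0// ltW.
apply: (@le_trans _ _ (\int[haar]_(t in Rpos) ((K / l)%:E * (b t)%:E))%E).
  rewrite le_eqVlt; apply/orP; left; apply/eqP.
  apply: eq_integral => t _; rewrite abse_EFin -!EFinM poweR_EFin.
  have Kb : 0 <= K * b t by rewrite mulr_ge0.
  rewrite (ger0_norm Kb) powRr1 ?divr_ge0 ?(ltW l0)//.
  by congr EFin; ring.
have mb : measurable_fun Rpos (EFin \o b).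
  apply/measurable_EFinP; apply: measurable_funTS; apply: measurable_funM.
    exact: measurable_powR.
  by apply: measurable_funVr; apply: measurable_funX; apply: measurable_funD.
rewrite ge0_integralZl_EFin//; [|exact: measurable_Rpos|by move=> t _; rewrite lee_fin].
apply: (@le_trans _ _ ((K / l)%:E * (dl^-1)%:E)%E).
  by apply: lee_wpmul2l; [rewrite lee_fin|exact: integral_haar_bump_le].
rewrite -EFinM lee_fin mulrAC ler_pdivrMr// mul1r /l -addrA lerDl.
by rewrite addr_ge0.
Qed.

End haar_modular.

(** * Inclusions *)

Section inclusion.
Context {R : realType} {d : nat}.
Local Notation gam := (@gauss_measure R d).

Lemma poisson_hermite_bounded (p : Rvec R d -> R) : P_gauss_infty p -> LH0 p ->
  exists2 C, 0 < C & forall (f : Rvec R d -> R) (l : R),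
  measurable_fun setT f -> 0 < l ->
  (\int[gam]_x (`|(f x)%:E| * (l^-1)%:E) `^ (p x) <= 1)%E ->
  forall (t k : R) (u : Rvec R d -> \bar R), 0 < t -> 0 < k ->
  (forall x, `|u x| <= k%:E * phP t (fun y => (`|f y|)%:E) x)%E ->
  (var_norm gam setT p u <= (k * C * l)%:E)%E.
Proof.
move=> [mp p1 [Cg [pinf [Cg0 _ pinfP]]]] [C1 C10 pLH].
(* Log-Hoelder continuity supplies the upper bound P of the exponent, measured from its value at the
   origin. *)
have pP x : p x <= p zerov + C1.
  by rewrite -lerBlDl (le_trans (ler_norm _))//; exact: exponent_osc.
have [CK CK0 HK] := mehler_exponent_change p1 pP C10 Cg0 pLH pinfP.
have B0 : 0 < bound_const (p zerov + C1) CK.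
  by rewrite /bound_const mulr_gt0// powR_gt0// mulr_gt0// addr_gt0.
have [C C_ge1 HC] := var_norm_phP_le mp p1 pP B0
  (fun h mh h0 h1 s x s0 => ouT_poweR_le mp p1 pP CK0 HK mh h0 h1 x s0).
by exists C => //; exact: lt_le_trans C_ge1.
Qed.

(** After this reduction, the inclusion is a statement about real functions of time satisfying three
    inequalities. *)
Lemma besov_poisson_norm (p f : Rvec R d -> R) : P_gauss_infty p -> LH0 p ->
  var_Lp gam setT p f -> exists (g : nat -> R -> R) (C : R),
  [/\ 0 < C, (forall k t, 0 <= g k t),
    (forall k, exists2 A, 0 <= A & forall t, 0 < t -> g k t <= A * t ^- k),
    (forall k s t, 0 < s -> s < t -> g k t <= C * g k s) /\
    (forall k t, 0 < t -> g k t <= g k (2 * t) + 3 * t * C * g k.+1 (t / 2)) &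
    forall k (a : R) q,
    var_norm (@haar_measure R) Rpos q (fun t => (t `^ (k%:R - a))%:E * var_norm gam setT p
      (fun x => (derive1n k (fun s => poisson_hermite s f x) t)%:E))%E =
    var_norm (@haar_measure R) Rpos q (EFin \o (fun t => t `^ (k%:R - a) * g k t))].
Proof.
move=> hp hpLH [mf f_fin]; have [mp p1 _] := hp.
have [C C0 HC] := poisson_hermite_bounded hp hpLH.
have If := integrable_var_Lp mp p1 mf f_fin.
exists (poisson_norm p f), C; split => //.
- exact: poisson_norm_ge0.
- exact: (poisson_norm_le mp p1 C0 HC mf f_fin).
- by split; [exact: (poisson_norm_decr mp p1 C0 HC mf f_fin)|
             exact: (poisson_norm_step mp p1 C0 HC mf f_fin)].
move=> k a q; apply: eq_var_norm => t; rewrite /Rpos/= in_itv/= andbT => t0.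
rewrite EFinM; congr (_ * _)%E.
apply: etrans (poisson_normK mp p1 C0 HC mf f_fin k t0).
by apply: eq_var_norm => x _; rewrite derive1n_poisson_hermite.
Qed.

Lemma besov_order_le (a1 a2 : R) : 0 <= a2 -> a2 < a1 -> 0 <= a1 ->
  (besov_order a2 <= besov_order a1)%N.
Proof.
move=> a20 a21 a10; have [_] := besov_orderP a20; apply.
by have [a1k _] := besov_orderP a10; exact: lt_trans a1k.
Qed.

(** Minimality of the order places k - alpha in the range allowed for [kappa] in
    [haar_modular_bounded]. *)
Lemma besov_order_itv (a : R) : 0 <= a -> 0 <= (besov_order a)%:R - a <= 1.
Proof.
move=> a0; have [ak _] := besov_orderP a0; rewrite subr_ge0 ltW//=.
rewrite lerBlDr addrC -natr1 lerD2r /besov_order.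
by have /andP[] := truncn_itv a0.
Qed.

End inclusion.

Theorem proposition2p1 (R : realType) (d : nat) (p : Rvec R d -> R)
    (q1 q2 : R -> R) (alpha1 alpha2 : R)
    (hd : (0 < d)%N)
    (hp : P_gauss_infty p) (hpLH : LH0 p)
    (hq1 : P_zero_infty q1) (hq2 : P_zero_infty q2)
    (ha1 : 0 <= alpha1) (ha2 : 0 <= alpha2) :
  (0 < alpha2 -> alpha2 < alpha1 ->
     besov alpha1 p q1 `<=` besov alpha2 p q2) /\
  (alpha1 = alpha2 ->
     {ae lebesgue_measure, forall t : R, 0 < t -> q1 t <= q2 t} ->
     besov alpha1 p q1 `<=` besov alpha2 p q2).
Proof.
suff H f : besov alpha1 p q1 f ->
  (0 < alpha2 -> alpha2 < alpha1 -> besov alpha2 p q2 f) /\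
  (alpha1 = alpha2 -> {ae lebesgue_measure, forall t : R, 0 < t -> q1 t <= q2 t} ->
   besov alpha2 p q2 f).
  split=> [a0 a21 f /H[/(_ a0 a21)]//|a12 q12 f /H[_ /(_ a12 q12)]//].
move=> [fL]; have [g [C [C0 g0 gA [gC gs] gE]]] := besov_poisson_norm hp hpLH fL.
rewrite gE => /var_norm_ltP[l [l0 _ Hl]].
have hM := haar_modular_bounded hq1 C0 l0 (besov_order_itv ha1) (fun t _ => g0 _ t)
  (gC (besov_order alpha1)) Hl.
have M0 : 0 <= 4 * C * l by rewrite !mulr_ge0// ltW.
split=> [a20 a21|a12 q12]; (split; first by []); rewrite gE; last first.
  rewrite -a12; apply: (haar_var_norm_le_exponent hq1 q12 l0 M0 _ Hl) => t t0.
  by rewrite mulr_ge0 ?powR_ge0//=; exact: hM.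
set K1 := besov_order alpha1 in hM Hl *; set K2 := besov_order alpha2.
have K21 : (K2 <= K1)%N by exact: besov_order_le.
have aK2 : alpha2 < K2%:R by have [] := besov_orderP ha2.
have [b [ab ba bK]] : exists b, [/\ alpha2 < b, b < alpha1 & b < K2%:R].
  have : alpha2 < Num.min alpha1 K2%:R by rewrite lt_min a21.
  move=> /midf_lt[h1 h2]; exists ((alpha2 + Num.min alpha1 K2%:R) / 2); split => //.
    by rewrite (lt_le_trans h2)// ge_min lexx.
  by rewrite (lt_le_trans h2)// ge_min lexx orbT.
have gM t : 0 < t <= 1 -> g K1 t <= 4 * C * l * t `^ (b - K1%:R).
  move=> /andP[t0 t1]; apply: (@le_trans _ _ (4 * C * l * t `^ (alpha1 - K1%:R))).
    have := hM t t0; rewrite -(opprB alpha1) powRN mulrC ler_pdivrMr ?powR_gt0//.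
  by rewrite ler_wpM2l// ger_powR ?t0// lerD2r ltW.
have [A A0 HA] := dyadic_descent C0 M0 K21 bK gA gs gM.
have [A' A'0 HA'] := gA K2.
(* Near 0 the function is O(t^(b - alpha2)), and at infinity the a priori bound gives
   O(t^(-alpha2)); the latter is a decay because alpha2 > 0. *)
set dl := Num.min (b - alpha2) alpha2.
have dl0 : 0 < dl by rewrite lt_min subr_gt0 ab.
have AA0 : 0 <= A + A' by rewrite addr_ge0.
(* The factor 4 is the cost of replacing min(v, 1/v) by v / (1 + v)^2, where v = t^dl. *)
apply: (@haar_var_norm_bump _ _ _ (4 * (A + A')) dl) => //; first by rewrite mulr_ge0.
move=> t t0; rewrite mulr_ge0 ?powR_ge0//=.
have v0 : 0 < t `^ dl by rewrite powR_gt0.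
have [t1|t1] := lerP t 1.
  apply: (@le_trans _ _ ((A + A') * t `^ dl)).
    apply: (@le_trans _ _ (t `^ (K2%:R - alpha2) * (A * t `^ (b - K2%:R)))).
      by rewrite ler_wpM2l ?powR_ge0// HA// t0.
    rewrite mulrCA -powRD ?(gt_eqF t0) ?implybT// addrC subrKA.
    apply: ler_pM; rewrite ?powR_ge0 ?lerDl//.
    by rewrite ger_powR ?t0// /dl ge_min lexx.
  rewrite [4 * _]mulrC -mulrA ler_wpM2l// mulrA ler_pdivlMr ?exprn_gt0 ?ltr_pwDl ?powR_ge0//.
  have v1 : t `^ dl <= 1.
    by rewrite -[leRHS](powRr0 t) ger_powR ?t0// ltW.
  by move: v0 v1; move: (t `^ dl) => v v0 v1; nra.
have v1 : 1 <= t `^ dl.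
  by rewrite -[leLHS](powRr0 t) ler_powR ?(ltW t1)// ltW.
apply: (@le_trans _ _ ((A + A') * (t `^ dl)^-1)).
  apply: (@le_trans _ _ (t `^ (K2%:R - alpha2) * (A' * t ^- K2))).
    by rewrite ler_wpM2l ?powR_ge0// HA'.
  rewrite mulrCA -powR_invn ?(ltW t0)// -powRD ?(gt_eqF t0) ?implybT//.
  rewrite addrAC subrr add0r -powRN; apply: ler_pM; rewrite ?powR_ge0 ?lerDr//.
  by rewrite ler_powR ?(ltW t1)// lerN2 /dl ge_min lexx orbT.
rewrite [4 * _]mulrC -mulrA ler_wpM2l// mulrA ler_pdivlMr ?exprn_gt0 ?ltr_pwDl ?powR_ge0//.
rewrite mulrC ler_pdivrMr//.
by move: v0 v1; move: (t `^ dl) => v v0 v1; nra.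
Qed.
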